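(* For each integer $K\ge 2$, put $\beta=\frac{1}{1+K^2}$ and consider the ($2\pi$-periodic, traveling-wave) Kawahara equation $$c\,u+u_{xx}+\beta\,u_{xxxx}+u^2=0,\qquad x\in\mathbb{T}=[-\pi,\pi]\ \text{(periodic)}, \qquad (\ast)$$ with unknown real-valued even $2\pi$-periodic profile $u$ and velocity $c\in\mathbb{R}$. Let $u_r=u_r(x;a,b,c_r)$ be the function (depending on $K$) defined in the context; for $(a,b,c_r)\in\mathbb{R}^3$ sufficiently small, $u_r(\cdot\,;a,b,c_r)\in \mathrm{H}^\infty_{\mathrm{per},\mathrm{even}}(\mathbb{T})$ and $u_r$ is real analytic in its final three arguments $a,b,c_r$. Then $(\ast)$ has the following Wilton ripple solutions. (1) If $K=2$ (so $\beta=1/5$), there exist two $a$-parameter families of solutions $u_+(x;a)$ and $u_-(x;a)$ that solve $(\ast)$ for all sufficiently small $a\in\mathbb{R}$, with respective velocities $$c_\pm=\frac45-\frac{a}{\sqrt2}\,\tilde c_r^{\pm}(a),$$ where $\tilde c_r^{\pm}(a)$ are real analytic functions with $\tilde c_r^{\pm}(0)=\pm1$. The solutions have the form $$u_\pm(x;a)=a\Big(\cos(x)+\frac{1}{\sqrt2}\tilde b^{\pm}(a)\cos(2x)\Big)+u_r\Big(x;a,\frac{a}{\sqrt2}\tilde b^{\pm}(a),-\frac{a}{\sqrt2}\tilde c_r^{\pm}(a)\Big),$$ where $\tilde b^{\pm}(a)$ are real analytic functions with $\tilde b^{\pm}(0)=\pm1$. (2) If $K=3$ (so $\beta=1/10$),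 there exist three $a$-parameter families of solutions $u_\sigma(x;a)$, $\sigma\in\{1,2,3\}$, that solve $(\ast)$ for all sufficiently small $a\in\mathbb{R}$, with velocities $$c_\sigma=\frac{9}{10}+a^2\,\tilde c_r^{(\sigma)}(a),$$ where $\tilde c_r^{(\sigma)}(a)$ are real analytic functions with $$\tilde c_r^{(1)}(0)\approx 4.27863,\quad \tilde c_r^{(2)}(0)\approx1.48289,\quad \tilde c_r^{(3)}(0)\approx0.37396.$$ The solutions have the form $$u_\sigma(x;a)=a\Big(\cos(x)+\tilde b^{(\sigma)}(a)\cos(3x)\Big)+u_r\Big(x;a,a\tilde b^{(\sigma)}(a),a^2\tilde c_r^{(\sigma)}(a)\Big),$$ where $\tilde b^{(\sigma)}(a)$ are real analytic functions with $$\tilde b^{(1)}(0)\approx-1.78374,\quad \tilde b^{(2)}(0)\approx-0.54488,\quad \tilde b^{(3)}(0)\approx0.59468.$$ (3) If $K\ge4$ (so $\beta=1/(1+K^2)$), there exists one $a$-parameter family of solutions $u(x;a)$ that solves $(\ast)$ for all sufficiently small $a\in\mathbb{R}$, with velocity $$c=\frac{K^2}{K^2+1}+a^2\,\tilde c_r(a),$$ where $\tilde c_r(a)$ is a real analytic function with $$\tilde c_r(0)=\frac{(K^2+1)(5K^2-24)}{6K^2(K^2-4)}.$$ The solutions have the form $$u(x;a)=a\Big(\cos(x)+\tilde b(a)\cos(Kx)\Big)+u_r\Big(x;a,a\tilde b(a),a^2\tilde c_r(a)\Big),$$ where $\tilde b(a)$ is a real analytic function that is not identically zero for sufficiently small $a$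 and satisfies $\tilde b(a)=\mathcal{O}(a^{K-3})$ as $a\to0$.
   Context: Equation $(\ast)$ is the rescaled, once-integrated traveling-wave form of the Kawahara equation $u_t=\alpha u_{xxx}+\beta u_{5x}+\sigma(u^2)_x$; $c$ is the (rescaled) velocity of the wave. Function spaces: $\mathrm{L}^2_{\mathrm{per},\mathrm{even}}(\mathbb{T})$ is the space of real even $2\pi$-periodic $\mathrm{L}^2$ functions, and $\mathrm{H}^4_{\mathrm{per},\mathrm{even}}(\mathbb{T})$ is the Hilbert space of $f(x)=\sum_{k\ge0}\widehat f_k\cos(kx)$ with $\sum_{k\ge0}(1+k^2)^4|\widehat f_k|^2<\infty$, where $\widehat f_k=\frac1\pi\int_{-\pi}^{\pi}f(x)\cos(kx)\,dx$ for $k>0$ and $\widehat f_0=\frac1{2\pi}\int_{-\pi}^{\pi}f(x)\,dx$. The spaces $\mathrm{H}^s_{\mathrm{per},\mathrm{even}}(\mathbb{T})$ are defined analogously, and $\mathrm{H}^\infty_{\mathrm{per},\mathrm{even}}(\mathbb{T})=\bigcap_{s}\mathrm{H}^s_{\mathrm{per},\mathrm{even}}(\mathbb{T})$. Definition of $u_r$: fix $K\ge2$, $\beta=1/(1+K^2)$, $c_0=1-\beta=K^2/(K^2+1)$, and $\mathcal{L}=\partial_x^2+\beta\partial_x^4$. The nullspace of $c_0+\mathcal{L}$ on $\mathrm{H}^4_{\mathrm{per},\mathrm{even}}(\mathbb{T})$ is $\mathrm{Span}\{\cos(x),\cos(Kx)\}$. Let $\mathrm{Null}\{c_0+\mathcal{L}\}^\perp$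 be the set of $f\in\mathrm{H}^4_{\mathrm{per},\mathrm{even}}(\mathbb{T})$ that are $\mathrm{L}^2(\mathbb{T})$-orthogonal to $\cos(x)$ and $\cos(Kx)$, and let $\mathcal{Q}f=f-\widehat f_1\cos(x)-\widehat f_K\cos(Kx)$. For $(a,b,c_r)\in\mathbb{R}^3$ in a sufficiently small neighborhood of the origin, $u_r=u_r(\cdot\,;a,b,c_r)\in\mathrm{Null}\{c_0+\mathcal{L}\}^\perp$ is the unique small solution (given by the analytic implicit function theorem, with $u_r(\cdot\,;0,0,0)=0$) of the auxiliary equation $$c_r u_r+\mathcal{Q}(c_0+\mathcal{L})u_r+\mathcal{Q}\big(a\cos(x)+b\cos(Kx)+u_r\big)^2=0.$$ Real analyticity of $u_r$ in $(a,b,c_r)$ is understood for the map $(a,b,c_r)\mapsto u_r(\cdot\,;a,b,c_r)$ from a neighborhood of $0\in\mathbb{R}^3$ into $\mathrm{H}^4_{\mathrm{per},\mathrm{even}}(\mathbb{T})$. Wilton ripples: $2\pi$-periodic traveling-wave solutions forming a branch parameterized by one small-amplitude parameter $a$, whose profile at zero amplitude has a codimension-1 bifurcation from a linear combination of $\cos(x)$ and $\cos(Kx)$ for some $K\in\mathbb{N}\setminus\{1\}$. Conventions: ''real analytic function of $a$'' means real-valued and real analytic on some open interval around $a=0$; ''sufficiently small $a$'' means $|a|<\varepsilon$ for some $\varepsilon>0$ (depending on $K$). The symbol $\approx$ indicates numerical values rounded to the displayed five decimal places. *)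

(* Defs.v *)
From HB Require Import structures.
From mathcomp Require Import all_boot all_order all_algebra.
From mathcomp Require Import all_classical all_reals all_analysis.

Set Implicit Arguments.
Unset Strict Implicit.
Unset Printing Implicit Defensive.

Import Order.TTheory GRing.Theory Num.Theory.
Import numFieldNormedType.Exports.

Local Open Scope classical_set_scope.
Local Open Scope ring_scope.

Local Notation "f ^`( n )" := (derive1n n f) : ring_scope.

Section Spaces.
Context {R : realType}.
Implicit Types (f g v phi : R -> R) (s n k : nat).

Definition torus : set R := `[- pi, pi].

Definition even_periodic f : Prop :=
  (forall x, f (- x) = f x) /\ (forall x, f (x + 2 * pi) = f x).

Definition L2_per_even f : Prop :=
  [/\ even_periodic f, measurable_fun setT f &
      (@lebesgue_measure R).-integrable torus (fun x => (f x ^+ 2)%:E)].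

Definition fourier f k : R :=
  (if k == 0%N then (2 * pi)^-1 else pi^-1) *
  \int[@lebesgue_measure R]_(x in torus) (f x * cos (k%:R * x)).

Definition sobolev_terms s f : R^nat :=
  fun k => (1 + k%:R ^+ 2) ^+ s * fourier f k ^+ 2.

(* For s >= 1 the cosine series of an element of H^s converges absolutely, so
   the elements are taken to be their continuous representatives and the series
   is required to converge to f at every point. *)
Definition H_per_even s f : Prop :=
  [/\ L2_per_even f,
      forall x, series (fun k => fourier f k * cos (k%:R * x)) @ \oo --> f x &
      cvgn (series (sobolev_terms s f))].

(* The spaces decrease with the exponent, so integer exponents suffice. *)
Definition Hinfty_per_even f : Prop :=
  forall s, (1 <= s)%N -> H_per_even s f.

(* Meaningful only when H_per_even s f holds. *)
Definition H_norm s f : R := Num.sqrt (limn (series (sobolev_terms s f))).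

Definition smooth_periodic phi : Prop :=
  (forall n x, derivable phi^`(n) x 1) /\
  (forall x, phi (x + 2 * pi) = phi x).

(* g is the n-th derivative of f on the circle in the sense of distributions. *)
Definition weak_derivative n f g : Prop :=
  forall phi, smooth_periodic phi ->
    \int[@lebesgue_measure R]_(x in torus) (f x * phi^`(n) x) =
    (-1) ^+ n * \int[@lebesgue_measure R]_(x in torus) (g x * phi x).

End Spaces.

Section Analyticity.
Context {R : realType}.

Definition analytic_at (f : R -> R) (x0 : R) : Prop :=
  exists (coef : R^nat) (r : R), 0 < r /\
    forall h, `|h| < r -> pseries coef h @ \oo --> f (x0 + h).

Definition real_analytic (f : R -> R) : Prop :=
  exists eps : R, 0 < eps /\ forall a, `|a| < eps -> analytic_at f a.

Definition partial_sum3 (A : nat -> nat -> nat -> R -> R) (a b c : R) (N : nat)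
    : R -> R :=
  fun x => \sum_(i < N) \sum_(j < N) \sum_(l < N)
             a ^+ i * b ^+ j * c ^+ l * A i j l x.

(* Analyticity, at the point (a0, b0, c0), of a map of three real variables into
   H^s: a power series with coefficients in H^s which, by the bound on the
   coefficients, converges absolutely in H^s on the open box of half-side r. *)
Definition analytic3_at (s : nat) (F : R -> R -> R -> R -> R) (a0 b0 c0 : R)
    : Prop :=
  exists (A : nat -> nat -> nat -> R -> R) (r M : R),
    [/\ 0 < r,
        forall i j l, H_per_even s (A i j l),
        forall i j l, H_norm s (A i j l) * r ^+ (i + j + l) <= M &
        forall a b c, `|a| < r -> `|b| < r -> `|c| < r ->
          H_per_even s (F (a0 + a) (b0 + b) (c0 + c)) /\
          H_norm s (fun x => F (a0 + a) (b0 + b) (c0 + c) x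
                             - partial_sum3 A a b c N x) @[N --> \oo] --> 0].

End Analyticity.

Section Kawahara.
Context {R : realType}.
Variable K : nat.
Implicit Types (a b c : R) (u v f : R -> R).

Definition beta : R := (1 + K%:R ^+ 2)^-1.

Definition vel0 : R := 1 - beta.

Definition kawahara c u : Prop :=
  [/\ even_periodic u,
      forall n x, (n < 4)%N -> derivable u^`(n) x 1 &
      forall x, c * u x + u^`(2) x + beta * u^`(4) x + u x ^+ 2 = 0].

Definition null_perp f : Prop :=
  [/\ H_per_even 4 f,
      \int[@lebesgue_measure R]_(x in torus) (f x * cos x) = 0 &
      \int[@lebesgue_measure R]_(x in torus) (f x * cos (K%:R * x)) = 0].

Definition projQ f : R -> R :=
  fun x => f x - fourier f 1 * cos x - fourier f K * cos (K%:R * x).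

(* The equation is an identity in L^2, where v2 and v4 are the second and fourth
   derivatives of v (for v in H^4 they exist and are unique almost
   everywhere). *)
Definition auxiliary_equation a b c v : Prop :=
  exists v2 v4 : R -> R,
    [/\ L2_per_even v2, L2_per_even v4,
        weak_derivative 2 v v2, weak_derivative 4 v v4 &
        {ae @lebesgue_measure R, forall x, torus x ->
          c * v x
          + projQ (fun y => vel0 * v y + (v2 y + beta * v4 y)) x
          + projQ (fun y => (a * cos y + b * cos (K%:R * y) + v y) ^+ 2) x = 0}].

(* ur is, near the origin, the unique small solution of the auxiliary equation;
   the uniqueness clause determines ur a b c for all small (a, b, c),
   independently of eps and delta. Values away from the origin are
   unconstrained. *)
Definition is_ur (ur : R -> R -> R -> R -> R) : Prop :=
  (forall x, ur 0 0 0 x = 0) /\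
  exists eps delta : R, [/\ 0 < eps, 0 < delta &
    forall a b c, `|a| < eps -> `|b| < eps -> `|c| < eps ->
      [/\ null_perp (ur a b c), H_norm 4 (ur a b c) < delta,
          auxiliary_equation a b c (ur a b c) &
          forall v, null_perp v -> H_norm 4 v < delta ->
            auxiliary_equation a b c v -> forall x, v x = ur a b c x]].

End Kawahara.

Arguments beta {R} K.
Arguments vel0 {R} K.

(* x rounds to the five-place decimal d. *)
Definition approx5 {R : realType} (x d : R) : Prop :=
  `|x - d| <= (2 * 10 ^+ 5)^-1.

(* Main.v *)
Require Import Defs.
From mathcomp Require Import all_boot all_order all_algebra.
From mathcomp Require Import all_classical all_reals all_analysis.
From mathcomp Require Import ring lra zify.

Set Implicit Arguments.
Unset Strict Implicit.

Import Order.TTheory GRing.Theory Num.Theory.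
Import numFieldNormedType.Exports.

Local Open Scope classical_set_scope.
Local Open Scope ring_scope.

(** The modes of the profile and the velocity are rescaled by powers of [a] chosen
    so that the equation for mode [k] is divisible by a power of [a].  At [a = 0]
    the divided system has an explicit solution, where its linearization is
    invertible: it is diagonal on high modes and injective on the low ones.  What
    remains is a fixed-point equation [z = g + l z + B(z, z)] whose terms are finite
    combinations of monomials in [a] times [cos(kx)].  Its tree expansion converges
    in an l^1 norm with weight [2^k], hence the solution is a power series in [a]
    with exponentially decaying modes, and no implicit function theorem is needed.
    The same expansion in the parameters [(a, b, c)] gives [u_r], and uniqueness of
    small solutions of the auxiliary equation identifies the nonresonant part of
    the profile with [u_r]. *)

(** * Absolutely summable real sequences *)

Section AbsoluteSeries.
Context {R : realType}.
Implicit Types (x y M : nat -> R) (S T : R).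

(** The obstacle is the resonance: c_0 + L annihilates cos(x) and cos(Kx), so modes 1 and K of the
    equation cannot be solved for their own amplitudes; they determine the velocity and the second
    amplitude instead, at an order in a that depends on K. For K = 2 the square of the first-order
    profile already reaches modes 1 and 2: the velocity correction has order a and the balance is
    b^2 = 1/2. For K = 3 it has order a^2, and eliminating the slaved modes 0, 2, 4, 6 leaves a
    cubic in b. For K >= 4 powers of a cos(x) generate modes 2, 3, ... in turn and reach mode K at
    order a^K; against a velocity correction of order a^2 this gives a second amplitude of order
    a^(K-2), whose limit solves a linear equation. The limit linearization is injective because b is
    nonzero, because the root of the cubic is simple, and because the coefficient of the linear
    equation is nonzero, respectively. Off the resonances the symbol of c_0 + L stays away from
    zero, so inverting it loses nothing in the weighted norm; |p - q| <= p + q makes that norm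
    submultiplicative for products of cosines. *)

Definition abs_bounded x S := forall n, \sum_(i < n) `|x i| <= S.

Definition tsum x : R := limn (series x).

Lemma abs_bounded_cvg x S : abs_bounded x S -> cvgn (series x).
Proof.
move=> xS; apply: normed_cvg; apply: nondecreasing_is_cvgn.
  by apply: nondecreasing_series => n _ _; exact: normr_ge0.
by exists S => _ [n _ <-]; move: (xS n); rewrite -(big_mkord xpredT (fun i => `|x i|)).
Qed.

Lemma cvg_tsum x S : abs_bounded x S -> series x @ \oo --> tsum x.
Proof. exact: abs_bounded_cvg. Qed.

Lemma abs_bounded_ge0 x S : abs_bounded x S -> 0 <= S.
Proof. by move=> /(_ 0%N); rewrite big_ord0. Qed.

Lemma abs_bounded_le x M S : (forall n, `|x n| <= M n) -> abs_bounded M S ->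
  abs_bounded x S.
Proof.
move=> xM MS n; apply: le_trans (MS n); apply: ler_sum => i _.
by apply: le_trans (xM i) _; exact: ler_norm.
Qed.

Lemma abs_bounded_le_norm x y S : (forall n, `|x n| <= `|y n|) ->
  abs_bounded y S -> abs_bounded x S.
Proof. by move=> xy yS n; apply: le_trans (yS n); exact: ler_sum. Qed.

Lemma abs_boundedZ x S k : abs_bounded x S ->
  abs_bounded (fun n => k * x n) (`|k| * S).
Proof.
move=> xS n; under eq_bigr do rewrite normrM.
by rewrite -mulr_sumr ler_wpM2l.
Qed.

Lemma abs_boundedD x y S T : abs_bounded x S -> abs_bounded y T ->
  abs_bounded (fun n => x n + y n) (S + T).
Proof.
move=> xS yT n; apply: le_trans (lerD (xS n) (yT n)).
by rewrite -big_split /=; apply: ler_sum => i _; exact: ler_normD.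
Qed.

Lemma norm_tsum_le x S : abs_bounded x S -> `|tsum x| <= S.
Proof.
move=> xS; have /cvg_norm cx := cvg_tsum xS.
rewrite -(cvg_lim _ cx)//; apply: limr_le; first by apply/cvg_ex; eexists; exact: cx.
near=> n; apply: le_trans (xS n).
by rewrite /series/= big_mkord; exact: ler_norm_sum.
Unshelve. all: by end_near. Qed.

Lemma tsum_ext x y : x =1 y -> tsum x = tsum y.
Proof. by move=> /funext ->. Qed.

Lemma cvg_tsum_eq x (l : R) : series x @ \oo --> l -> tsum x = l.
Proof. by move=> h; exact: cvg_lim. Qed.

Lemma tsumD x y S T : abs_bounded x S -> abs_bounded y T ->
  tsum (fun n => x n + y n) = tsum x + tsum y.
Proof.
move=> xS yT; have := @lim_seriesD _ x y (abs_bounded_cvg xS) (abs_bounded_cvg yT).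
by [].
Qed.

Lemma tsumZ x S k : abs_bounded x S -> tsum (fun n => k * x n) = k * tsum x.
Proof. by move=> xS; have := @lim_seriesZ _ x k (abs_bounded_cvg xS). Qed.

Lemma tsum_finite x N : (forall n, (N <= n)%N -> x n = 0) ->
  tsum x = \sum_(i < N) x i.
Proof.
move=> x0; apply: cvg_tsum_eq; apply: cvg_near_cst; near=> n.
rewrite /series/= (@big_cat_nat _ _ _ N)//=; last by near: n; exists N.
rewrite big_mkord [X in _ + X]big_nat [X in _ + X]big1 ?addr0//.
by move=> i /andP[/x0].
Unshelve. all: by end_near. Qed.

Lemma le_tsum x y S T : abs_bounded x S -> abs_bounded y T ->
  (forall n, x n <= y n) -> tsum x <= tsum y.
Proof. by move=> xS yT; apply: lim_series_le; exact: abs_bounded_cvg. Qed.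

Lemma sum_le_tsum x S n : abs_bounded x S -> (forall i, 0 <= x i) ->
  \sum_(i < n) x i <= tsum x.
Proof.
move=> xS x0; have cx := abs_bounded_cvg xS.
rewrite -(big_mkord xpredT x).
by apply: (@nondecreasing_cvgn_le _ (series x)) => //; apply: nondecreasing_series.
Qed.

Lemma tail_small x S (e : R) : abs_bounded x S -> 0 < e ->
  exists N, forall n, \sum_(N <= i < n) `|x i| <= e.
Proof.
move=> xS e0; pose y n := `|x n|.
have yS : abs_bounded y S by move=> n; under eq_bigr do rewrite normr_id.
have cy := cvg_tsum yS.
move/cvgrPdist_le : cy => /(_ e e0)[N _ hN].
exists N => n; have [Nn|/ltnW nN] := leqP N n; last by rewrite big_geq// ltW.
have := hN N (leqnn _); rewrite /series/= => h.
have := sum_le_tsum n yS (fun=> normr_ge0 _).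
rewrite -(big_mkord xpredT y) (@big_cat_nat _ _ _ N)//= => h2.
by move: h; rewrite ler_norml => /andP[_ h]; rewrite -/y; lra.
Qed.

Lemma cvg_sum_ord (f : nat -> nat -> R) (l : nat -> R) m :
  (forall i, f N i @[N --> \oo] --> l i) ->
  (\sum_(i < m) f N i) @[N --> \oo] --> \sum_(i < m) l i.
Proof.
move=> fl; elim: m => [|m IH].
  rewrite big_ord0 (_ : (fun N => _) = fun=> 0); first exact: cvg_cst.
  by apply/funext => N; rewrite big_ord0.
rewrite big_ord_recr/= (_ : (fun N => _) =
  (fun N => \sum_(i < m) f N i) \+ (fun N => f N m)); first exact: cvgD.
by apply/funext => N; rewrite big_ord_recr.
Qed.

(* Tannery's theorem *)
Lemma cvg_tsum_dominated (b : nat -> nat -> R) x M S :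
  abs_bounded M S -> (forall N n, `|b N n| <= M n) ->
  (forall n, b N n @[N --> \oo] --> x n) -> tsum (b N) @[N --> \oo] --> tsum x.
Proof.
move=> MS bM bx.
have xM n : `|x n| <= M n.
  rewrite -(cvg_lim _ (cvg_norm (bx n)))//.
  apply: limr_le; first by apply/cvg_ex; eexists; exact: (cvg_norm (bx n)).
  by near=> k.
have M0 n : `|M n| = M n by rewrite ger0_norm// (le_trans _ (xM n)).
apply/cvgrPdist_le => e e0.
have e3 : 0 < e / 3 by rewrite divr_gt0.
have [m hm] := tail_small MS e3.
pose d N n := `|x n - b N n|.
have hfin : \forall N \near \oo, \sum_(i < m) d N i <= e / 3.
  have cv : (\sum_(i < m) d N i) @[N --> \oo] --> (0 : R).
    have := @cvg_sum_ord d (fun=> 0) m; rewrite big1_eq; apply => i.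
    rewrite -(normr0 R); apply: cvg_norm.
    by rewrite -(subrr (x i)); apply: cvgB; [exact: cvg_cst|exact: bx].
  move/cvgrPdist_le : cv => /(_ _ e3); apply: filterS => N.
  by rewrite sub0r normrN; apply: le_trans; exact: ler_norm.
near=> N.
have bN : abs_bounded (b N) S by exact: abs_bounded_le MS.
have xS : abs_bounded x S by exact: abs_bounded_le MS.
have bNN := abs_boundedZ (-1) bN.
have -> : tsum x - tsum (b N) = tsum (fun n => x n + -1 * b N n).
  by rewrite (tsumD xS bNN) (tsumZ _ bN) mulN1r.
apply: norm_tsum_le => n.
have dE i : `|x i + -1 * b N i| = d N i by rewrite mulN1r.
under eq_bigr do rewrite dE.
have [nm|mn] := leqP n m.
  have h : \sum_(i < n) d N i <= \sum_(i < m) d N i.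
    rewrite -!(big_mkord xpredT (d N)) (@big_cat_nat _ _ _ n 0 m)//=.
    by rewrite lerDl sumr_ge0// => i _; exact: normr_ge0.
  apply: le_trans h _; apply: (@le_trans _ _ (e/3)); last by lra.
  by near: N.
rewrite -(big_mkord xpredT (d N)) (@big_cat_nat _ _ _ m 0 n)//=; last exact: ltnW.
have h1 : \sum_(0 <= i < m) d N i <= e / 3 by rewrite big_mkord; near: N.
have h2 : \sum_(m <= i < n) d N i <= 2 * (e / 3).
  apply: (@le_trans _ _ (\sum_(m <= i < n) 2 * `|M i|)); last first.
    by rewrite -mulr_sumr ler_wpM2l.
  apply: ler_sum => i _; rewrite M0 mulr2n mulrDl mul1r.
  by apply: le_trans (ler_normB _ _) _; apply: lerD.
by lra.
Unshelve. all: by end_near. Qed.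

(** Summation over the triangle p + q < n by rows instead of diagonals; exact at every finite n. *)
Lemma sum_cauchy_prod x y n :
  \sum_(j < n) \sum_(p < j.+1) x p * y (j - p)%N =
  \sum_(p < n) x p * \sum_(q < n - p) y q.
Proof.
elim: n => [|n IH]; first by rewrite !big_ord0.
rewrite big_ord_recr/= IH.
have -> : \sum_(p < n.+1) x p * \sum_(q < n.+1 - p) y q =
          \sum_(p < n.+1) (x p * \sum_(q < n - p) y q + x p * y (n - p)%N).
  apply: eq_bigr => p _; rewrite -mulrDr subSn; last by rewrite -ltnS.
  by rewrite big_ord_recr.
rewrite big_split/=; congr (_ + _).
by rewrite [RHS]big_ord_recr/= subnn big_ord0 mulr0 addr0.
Qed.

Lemma sum_cauchy_prod_le x y n : (forall i, 0 <= x i) -> (forall i, 0 <= y i) ->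
  \sum_(j < n) \sum_(p < j.+1) x p * y (j - p)%N <=
  (\sum_(p < n) x p) * \sum_(q < n) y q.
Proof.
move=> x0 y0; rewrite sum_cauchy_prod mulr_suml; apply: ler_sum => p _.
apply: ler_wpM2l => //.
rewrite -!(big_mkord xpredT y) (@big_cat_nat _ _ _ (n - p) 0 n)//=; last exact: leq_subr.
by rewrite lerDl sumr_ge0.
Qed.

Lemma cauchy_prod_bounded x y S T : abs_bounded x S -> abs_bounded y T ->
  abs_bounded (fun n => \sum_(p < n.+1) x p * y (n - p)%N) (S * T).
Proof.
move=> xS yT n.
apply: (@le_trans _ _ (\sum_(j < n) \sum_(p < j.+1) `|x p| * `|y (j - p)%N|)).
  apply: ler_sum => j _; apply: le_trans (ler_norm_sum _ _ _) _.
  by apply: ler_sum => p _; rewrite normrM.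
have := @sum_cauchy_prod_le (fun i => `|x i|) (fun i => `|y i|) n.
move=> /(_ (fun=> normr_ge0 _) (fun=> normr_ge0 _))/le_trans; apply.
by apply: ler_pM => //; apply: sumr_ge0.
Qed.

(** By the finite identity, the N-th partial sum of the Cauchy product is itself a series in p, with
    terms [x p] times a partial sum of [y]. These are dominated by [T * |x p|], so Tannery's theorem
    passes to the limit. *)
Lemma tsum_cauchy_prod x y S T : abs_bounded x S -> abs_bounded y T ->
  tsum (fun n => \sum_(p < n.+1) x p * y (n - p)%N) = tsum x * tsum y.
Proof.
move=> xS yT; apply: cvg_tsum_eq.
pose b N p := if (p < N)%N then x p * \sum_(q < N - p) y q else 0.
have -> : series (fun n => \sum_(p < n.+1) x p * y (n - p)%N) = fun N => tsum (b N).
  apply/funext => N; rewrite /series/= big_mkord sum_cauchy_prod.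
  rewrite (@tsum_finite (b N) N); first by apply: eq_bigr => p _; rewrite /b ltn_ord.
  by move=> n Nn; rewrite /b ltnNge Nn.
rewrite -(mulrC (tsum y)) -(tsumZ _ xS).
have T0 := abs_bounded_ge0 yT.
apply: (@cvg_tsum_dominated _ _ (fun n => T * `|x n|) (`|T| * S)).
- apply: (@abs_boundedZ (fun n => `|x n|)) => n.
  by under eq_bigr do rewrite normr_id.
- move=> N n; rewrite /b; case: ifP => _; last by rewrite normr0 mulr_ge0.
  rewrite normrM mulrC; apply: ler_wpM2r => //.
  by apply: le_trans (ler_norm_sum _ _ _) _.
- move=> n; rewrite mulrC.
  have -> : x n * tsum y = tsum (fun q => x n * y q) by rewrite (tsumZ _ yT).
  have cv := cvg_tsum yT.
  have cv2 : (fun N => x n * series y N) @ \oo --> x n * tsum y.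
    by apply: cvgM => //; exact: cvg_cst.
  rewrite (tsumZ _ yT).
  rewrite -(cvg_shiftn n) /=.
  apply: cvg_trans cv2; apply: near_eq_cvg; near=> N.
  rewrite /b/= addnK /series/= big_mkord; case: ltnP => // .
  rewrite -[X in (_ <= X)%N]add0n leq_add2r leqn0 => /eqP ->.
  by rewrite big_ord0 mulr0.
Unshelve. all: by end_near. Qed.

End AbsoluteSeries.

(** * Finite formal linear combinations *)

Section FormalSums.
Context {R : realType}.
Implicit Types (I J L : Type).

(* A finite list of pairs (coefficient, index) stands for the corresponding
   formal linear combination of indices. *)
Definition fsum I := seq (R * I).

Definition ev I (e : I -> R) (s : fsum I) : R := \sum_(t <- s) t.1 * e t.2.

(** Repeated indices are not merged, so this only bounds the weighted l^1 norm from above. In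
    exchange it is exactly additive under concatenation and computes through [lin]. *)
Definition nrm I (w : I -> R) (s : fsum I) : R := \sum_(t <- s) `|t.1| * w t.2.

Definition scl I (c : R) (s : fsum I) : fsum I := [seq (c * t.1, t.2) | t <- s].

Definition lin I J (T : J -> fsum I) (s : fsum J) : fsum I :=
  flatten [seq scl t.1 (T t.2) | t <- s].

Definition bil I J L (B : I -> J -> fsum L) (s : fsum I) (s' : fsum J) : fsum L :=
  lin (fun i => lin (B i) s') s.

Definition supp I (P : I -> bool) (s : fsum I) := all (fun t => P t.2) s.

Lemma ev_nil I (e : I -> R) : ev e [::] = 0.
Proof. by rewrite /ev big_nil. Qed.

Lemma ev_cons I (e : I -> R) t s : ev e (t :: s) = t.1 * e t.2 + ev e s.
Proof. by rewrite /ev big_cons. Qed.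

Lemma ev_cat I (e : I -> R) s s' : ev e (s ++ s') = ev e s + ev e s'.
Proof. by rewrite /ev big_cat. Qed.

Lemma ev_scl I (e : I -> R) c s : ev e (scl c s) = c * ev e s.
Proof. by rewrite /ev big_map mulr_sumr; apply: eq_bigr => t _; rewrite mulrA. Qed.

Lemma ev_lin I J (e : I -> R) (T : J -> fsum I) s :
  ev e (lin T s) = ev (fun j => ev e (T j)) s.
Proof.
elim: s => [|t s IH]; first by rewrite !ev_nil.
by rewrite /lin/= ev_cat ev_scl ev_cons; congr (_ + _).
Qed.

Lemma ev_bil I J L (e : L -> R) (B : I -> J -> fsum L) s s' :
  ev e (bil B s s') = ev (fun i => ev (fun j => ev e (B i j)) s') s.
Proof.
rewrite ev_lin; congr (ev _ s); apply/funext => i; exact: ev_lin.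
Qed.

Lemma eq_ev I (e f : I -> R) s : e =1 f -> ev e s = ev f s.
Proof. by move=> /funext ->. Qed.

Lemma ev_flatten I (e : I -> R) (ss : seq (fsum I)) :
  ev e (flatten ss) = \sum_(s <- ss) ev e s.
Proof.
by elim: ss => [|s ss IH]; rewrite ?ev_nil ?big_nil//= ev_cat big_cons IH.
Qed.

Lemma evDe I (e f : I -> R) s : ev (fun i => e i + f i) s = ev e s + ev f s.
Proof. by rewrite /ev -big_split/=; apply: eq_bigr => t _; rewrite mulrDr. Qed.

Lemma evZe I c (e : I -> R) s : ev (fun i => c * e i) s = c * ev e s.
Proof. by rewrite /ev mulr_sumr; apply: eq_bigr => t _; rewrite mulrCA. Qed.

Lemma ev_sume I n (e : nat -> I -> R) s :
  ev (fun i => \sum_(j < n) e j i) s = \sum_(j < n) ev (e j) s.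
Proof.
by rewrite /ev exchange_big; apply: eq_bigr => t _; rewrite mulr_sumr.
Qed.

Lemma ev_supp0 I (P : I -> bool) (e : I -> R) s :
  supp P s -> (forall i, P i -> e i = 0) -> ev e s = 0.
Proof.
move=> sP e0; elim: s sP => [|t s IH]/=; first by rewrite ev_nil.
by move=> /andP[Pt /IH Ps]; rewrite ev_cons Ps e0// mulr0 addr0.
Qed.

Lemma supp_cat I (P : I -> bool) s s' : supp P (s ++ s') = supp P s && supp P s'.
Proof. exact: all_cat. Qed.

Lemma supp_flatten I (P : I -> bool) (ss : seq (fsum I)) :
  supp P (flatten ss) = all (supp P) ss.
Proof. by elim: ss => [//|s ss IH] /=; rewrite supp_cat IH. Qed.

Lemma supp_lin I J (P : I -> bool) (P' : J -> bool) (T : J -> fsum I) s :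
  supp P' s -> (forall j, P' j -> supp P (T j)) -> supp P (lin T s).
Proof.
move=> + PT; elim: s => [//|t s IH] /= /andP[Pt Ps].
by rewrite supp_cat IH// andbT /supp all_map; exact: PT.
Qed.

Lemma nrm_nil I (w : I -> R) : nrm w [::] = 0.
Proof. by rewrite /nrm big_nil. Qed.

Lemma nrm_cons I (w : I -> R) t s : nrm w (t :: s) = `|t.1| * w t.2 + nrm w s.
Proof. by rewrite /nrm big_cons. Qed.

Lemma nrm_cat I (w : I -> R) s s' : nrm w (s ++ s') = nrm w s + nrm w s'.
Proof. by rewrite /nrm big_cat. Qed.

Lemma nrm_scl I (w : I -> R) c s : nrm w (scl c s) = `|c| * nrm w s.
Proof.
by rewrite /nrm big_map mulr_sumr; apply: eq_bigr => t _; rewrite normrM mulrA.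
Qed.

Lemma nrm_lin I J (w : I -> R) (T : J -> fsum I) s :
  nrm w (lin T s) = nrm (fun j => nrm w (T j)) s.
Proof.
elim: s => [|t s IH]; first by rewrite !nrm_nil.
by rewrite /lin/= nrm_cat nrm_scl nrm_cons; congr (_ + _).
Qed.

Lemma nrm_flatten I (w : I -> R) (ss : seq (fsum I)) :
  nrm w (flatten ss) = \sum_(s <- ss) nrm w s.
Proof.
by elim: ss => [|s ss IH]; rewrite ?nrm_nil ?big_nil//= nrm_cat big_cons IH.
Qed.

Lemma nrmZw I c (w : I -> R) s : nrm (fun i => c * w i) s = c * nrm w s.
Proof. by rewrite /nrm mulr_sumr; apply: eq_bigr => t _; rewrite mulrCA. Qed.

Lemma nrm_ge0 I (w : I -> R) s : (forall i, 0 <= w i) -> 0 <= nrm w s.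
Proof. by move=> w0; apply: sumr_ge0 => t _; rewrite mulr_ge0. Qed.

Lemma ler_nrm I (v w : I -> R) s : (forall i, v i <= w i) -> nrm v s <= nrm w s.
Proof. by move=> vw; apply: ler_sum => t _; rewrite ler_wpM2l. Qed.

Lemma nrm_bil I J L (u : I -> R) (v : J -> R) (w : L -> R) C
    (B : I -> J -> fsum L) s s' :
  (forall i j, nrm w (B i j) <= C * (u i * v j)) ->
  nrm w (bil B s s') <= C * (nrm u s * nrm v s').
Proof.
move=> hB; rewrite /bil nrm_lin.
have -> : C * (nrm u s * nrm v s') = nrm (fun i => (C * nrm v s') * u i) s.
  by rewrite nrmZw; ring.
apply: ler_nrm => i; rewrite nrm_lin.
have -> : C * nrm v s' * u i = nrm (fun j => (C * u i) * v j) s'.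
  by rewrite nrmZw; ring.
by apply: ler_nrm => j; rewrite -mulrA.
Qed.

Lemma norm_ev_le I (w e : I -> R) C s : (forall i, `|e i| <= C * w i) ->
  `|ev e s| <= C * nrm w s.
Proof.
move=> ew; apply: le_trans (ler_norm_sum _ _ _) _; rewrite -nrmZw.
by apply: ler_sum => t _; rewrite normrM ler_wpM2l.
Qed.

End FormalSums.

(** * Convergent series of formal combinations *)

Section FormalSeries.
Context {R : realType} (I : Type) (w : I -> R) (Z : nat -> @fsum R I) (S : R).
Hypothesis w0 : forall i, 0 <= w i.
Hypothesis ZS : abs_bounded (fun n => nrm w (Z n)) S.

(* The value at the functional e of the formal series with terms Z n. *)
Definition levp (Y : nat -> @fsum R I) (e : I -> R) : R :=
  tsum (fun n => ev e (Y n)).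

Lemma lev_abs_bounded C e : 0 <= C -> (forall i, `|e i| <= C * w i) ->
  abs_bounded (fun n => ev e (Z n)) (C * S).
Proof.
move=> C0 ew; rewrite -(ger0_norm C0).
apply: abs_bounded_le (abs_boundedZ C ZS) => n; exact: norm_ev_le.
Qed.

Lemma levD C D e f : 0 <= C -> (forall i, `|e i| <= C * w i) ->
  0 <= D -> (forall i, `|f i| <= D * w i) ->
  levp Z (fun i => e i + f i) = levp Z e + levp Z f.
Proof.
move=> C0 eC D0 fD.
rewrite -(tsumD (lev_abs_bounded C0 eC) (lev_abs_bounded D0 fD)).
by apply: tsum_ext => n; rewrite evDe.
Qed.

Lemma levZ c C e : 0 <= C -> (forall i, `|e i| <= C * w i) ->
  levp Z (fun i => c * e i) = c * levp Z e.
Proof.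
move=> C0 eC; rewrite -(tsumZ _ (lev_abs_bounded C0 eC)).
by apply: tsum_ext => n; rewrite evZe.
Qed.

Lemma lev_sum n (C : nat -> R) (e : nat -> I -> R) : (forall j, 0 <= C j) ->
  (forall j i, `|e j i| <= C j * w i) ->
  levp Z (fun i => \sum_(j < n) e j i) = \sum_(j < n) levp Z (e j).
Proof.
move=> C0 eC; elim: n => [|n IH].
  rewrite big_ord0 /levp (@tsum_finite _ _ 0) ?big_ord0// => n _.
  by rewrite ev_sume big_ord0.
rewrite big_ord_recr/= -IH -(@levD (\sum_(j < n) C j) (C n)) //.
- by congr levp; apply/funext => i; rewrite big_ord_recr.
- exact: sumr_ge0.
- move=> i; rewrite mulr_suml; apply: le_trans (ler_norm_sum _ _ _) _.
  exact: ler_sum.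
Qed.

Lemma eq_lev (e f : I -> R) : e =1 f -> levp Z e = levp Z f.
Proof. by move=> /funext ->. Qed.

(** Dominated convergence in the functional: pointwise convergence on indices suffices, since each
    term of the series is a finite sum. It serves both to resum over modes and to expand in powers
    of the amplitude. *)
Lemma cvg_lev C (e : nat -> I -> R) f : 0 <= C ->
  (forall N i, `|e N i| <= C * w i) -> (forall i, e N i @[N --> \oo] --> f i) ->
  levp Z (e N) @[N --> \oo] --> levp Z f.
Proof.
move=> C0 eC ef.
apply: (@cvg_tsum_dominated _ _ _ (fun n => C * nrm w (Z n)) (`|C| * S)).
- exact: abs_boundedZ.
- by move=> N n; exact: norm_ev_le.
- move=> n; rewrite /ev; elim: (Z n) => [|t s IH].
    rewrite big_nil (_ : (fun N => _) = fun=> 0); first exact: cvg_cst.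
    by apply/funext => N; rewrite big_nil.
  rewrite big_cons (_ : (fun N => _) =
     (fun N => t.1 * e N t.2) \+ (fun N => \sum_(t <- s) t.1 * e N t.2)).
    by apply: cvgD => //; apply: cvgM => //; exact: cvg_cst.
  by apply/funext => N; rewrite big_cons.
Qed.

Lemma lev_supp0 (P : I -> bool) e : (forall n, supp P (Z n)) ->
  (forall i, P i -> e i = 0) -> levp Z e = 0.
Proof.
move=> ZP e0; rewrite /levp (@tsum_finite _ _ 0) ?big_ord0// => n _.
exact: ev_supp0 (ZP n) e0.
Qed.

End FormalSeries.

(** * Tree expansion of a quadratic fixed-point equation *)

Section QuadraticSolver.
Context {R : realType} (I : Type).
Variables (w : I -> R) (g : @fsum R I) (l : I -> @fsum R I).
Variables (B : I -> I -> @fsum R I) (C c0 : R).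
Hypothesis w0 : forall i, 0 <= w i.
Hypothesis gc : nrm w g <= c0.
Hypothesis lw : forall i, nrm w (l i) <= 4^-1 * w i.
Hypothesis Bw : forall i j, nrm w (B i j) <= C * (w i * w j).
Hypothesis C0 : 0 <= C.
Hypothesis small : 8 * C * c0 <= 1.

Definition qstep (Y : nat -> @fsum R I) n : @fsum R I :=
  lin l (Y n) ++ flatten [seq bil B (Y p) (Y (n - p)%N) | p <- iota 0 n.+1].

(** Term n+1 depends on all earlier terms, which structural recursion does not provide; [qiter n] is
    therefore the whole table of terms up to n, extended by one entry at each step. *)
Fixpoint qiter n : nat -> @fsum R I :=
  if n is n'.+1 then fun j => if (j <= n')%N then qiter n' j else qstep (qiter n') n'
  else fun=> g.

(* The tree expansion of the fixed point of z = g + l z + B(z, z); the n-th term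
   collects the trees with n+1 leaves and unary nodes. *)
Definition qsol n := qiter n n.

Lemma qiter_qsol n j : (j <= n)%N -> qiter n j = qsol j.
Proof.
elim: n j => [|n IH] j; first by rewrite leqn0 => /eqP ->.
rewrite leq_eqVlt => /orP[/eqP -> //|]; rewrite ltnS => jn /=.
by rewrite jn IH.
Qed.

Lemma qsol0 : qsol 0 = g. Proof. by []. Qed.

Lemma qsolS n : qsol n.+1 = qstep qsol n.
Proof.
rewrite /qsol/= ltnn /qstep qiter_qsol//; congr (_ ++ flatten _).
apply/eq_in_map => p; rewrite mem_iota ltnS => /= pn.
by rewrite !qiter_qsol// leq_subr.
Qed.

Lemma nrm_qsolS n : nrm w (qsol n.+1) <= 4^-1 * nrm w (qsol n) +
  C * \sum_(p < n.+1) nrm w (qsol p) * nrm w (qsol (n - p)).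
Proof.
rewrite qsolS nrm_cat; apply: lerD.
  by rewrite nrm_lin -nrmZw; exact: ler_nrm.
rewrite nrm_flatten big_map (_ : iota 0 n.+1 = index_iota 0 n.+1)//.
rewrite big_mkord mulr_sumr; apply: ler_sum => p _; exact: nrm_bil.
Qed.

(** Induction on partial sums. If n terms sum to at most 2 c0, the next partial sum is at most c0 +
    (2 c0) / 4 + C (2 c0)^2, and [small] makes the last summand at most c0 / 2, which restores 2
    c0. *)
Lemma qsol_bounded : abs_bounded (fun n => nrm w (qsol n)) (2 * c0).
Proof.
have c00 : 0 <= c0 by apply: le_trans gc; exact: nrm_ge0.
pose x n := nrm w (qsol n).
have x0 n : 0 <= x n by exact: nrm_ge0.
suff H n : \sum_(i < n) x i <= 2 * c0.
  by move=> n; under eq_bigr do rewrite ger0_norm ?nrm_ge0//; exact: H.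
elim: n => [|n IH]; first by rewrite big_ord0 mulr_ge0.
rewrite big_ord_recl/=.
set T := \sum_(i < n) x i in IH.
have T0 : 0 <= T by exact: sumr_ge0.
have h1 : \sum_(i < n) x (bump 0 i) <= 4^-1 * T + C * (T * T).
  apply: (@le_trans _ _ (\sum_(i < n) (4^-1 * x i +
      C * \sum_(p < i.+1) x p * x (i - p)%N))).
    by apply: ler_sum => i _; exact: nrm_qsolS.
  rewrite big_split/= -mulr_sumr lerD2l -mulr_sumr ler_wpM2l//.
  exact: sum_cauchy_prod_le.
have h2 : C * (T * T) <= C * (2 * c0 * (2 * c0)).
  by rewrite ler_wpM2l// ler_pM.
have h3 : C * (2 * c0 * (2 * c0)) <= 2^-1 * c0.
  rewrite (_ : _ * _ = (8 * C * c0) * (2^-1 * c0)); last by field.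
  by rewrite ler_piMl// mulr_ge0.
have : x 0%N <= c0 by [].
by lra.
Qed.

Lemma qsol_supp (P : I -> bool) : supp P g -> (forall i, P i -> supp P (l i)) ->
  (forall i j, P i -> P j -> supp P (B i j)) -> forall n, supp P (qsol n).
Proof.
move=> Pg Pl PB n; have [m] := ubnP n; elim: m n => // m IH [|n] nm //.
rewrite qsolS supp_cat; apply/andP; split; first exact: supp_lin (IH n nm) Pl.
rewrite supp_flatten all_map; apply/allP => p; rewrite mem_iota add0n => /andP[_].
rewrite [(p < _)%N]ltnS/= => pn; rewrite ltnS in nm.
have Pp : supp P (qsol p) by apply: IH; exact: leq_ltn_trans pn nm.
have Pnp : supp P (qsol (n - p)) by apply: IH; exact: leq_ltn_trans (leq_subr _ _) nm.
by apply: supp_lin Pp _ => i Pi; apply: supp_lin Pnp _ => j; exact: PB.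
Qed.

(** The fixed-point equation is only ever read through functionals. One that factors on [B] turns
    the convolution in the recursion into a Cauchy product, hence into a product of two values.
    Evaluations at a point x factor in this way. *)
Lemma qsol_eq D e f h : 0 <= D -> (forall i, `|e i| <= D * w i) ->
  (forall i, `|f i| <= D * w i) -> (forall i, `|h i| <= D * w i) ->
  (forall i j, ev e (B i j) = f i * h j) ->
  levp qsol e =
    ev e g + levp qsol (fun i => ev e (l i)) + levp qsol f * levp qsol h.
Proof.
move=> D0 eD fD hD eB; have ZS := qsol_bounded.
have elD i : `|ev e (l i)| <= D * w i.
  apply: le_trans (norm_ev_le _ eD) _; rewrite ler_wpM2l//.
  by apply: le_trans (lw i) _; rewrite ler_piMl//; lra.
rewrite /levp -(tsum_cauchy_prod (lev_abs_bounded ZS D0 fD) (lev_abs_bounded ZS D0 hD)).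
have b1 := lev_abs_bounded ZS D0 elD.
have b2 := cauchy_prod_bounded (lev_abs_bounded ZS D0 fD) (lev_abs_bounded ZS D0 hD).
rewrite -addrA -(tsumD b1 b2).
have be := lev_abs_bounded ZS D0 eD.
apply/eqP; rewrite addrC -subr_eq; apply/eqP.
symmetry; apply: cvg_tsum_eq.
have cv := cvg_tsum be.
(* The recursion produces terms from index 1 on; the shift separates the initial term [g]. *)
rewrite -(cvg_shiftn 1) in cv.
have cv2 : (fun n => series (fun n => ev e (qsol n)) (n + 1)%N - ev e g) @ \oo -->
   tsum (fun n => ev e (qsol n)) - ev e g by apply: cvgB => //; exact: cvg_cst.
apply: cvg_trans cv2; apply: near_eq_cvg; near=> n.
rewrite /series/= addn1 big_nat_recl// qsol0 [ev e g + _]addrC addrK.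
apply: eq_bigr => i _; rewrite qsolS ev_cat ev_lin; congr (_ + _).
rewrite ev_flatten big_map (_ : iota 0 i.+1 = index_iota 0 i.+1)// big_mkord.
apply: eq_bigr => p _; rewrite ev_bil.
under eq_ev => j do under eq_ev => j' do rewrite eB.
under eq_ev => j do rewrite evZe mulrC.
by rewrite evZe mulrC.
Unshelve. all: by end_near. Qed.

End QuadraticSolver.

(** * Cosine series with rapidly decreasing coefficients *)

Section CosineSeries.
Context {R : realType}.
Implicit Types (c : nat -> R) (x y h th : R).

Lemma sin_lipschitz x h : `|sin (x + h) - sin x| <= `|h|.
Proof.
wlog h0 : x h / 0 <= h => [W|].
  have [|/ltW h0] := leP 0 h; first exact: W.
  have := W (x + h) (- h); rewrite addrK distrC normrN; apply; lra.
have xh : x <= x + h by rewrite lerDl.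
have cc : {within `[x, x + h], continuous (@sin R)}.
  by apply: continuous_subspaceT; exact: continuous_sin.
have [c _ ->] := MVT_segment xh (fun y _ => is_derive_sin y) cc.
rewrite (_ : x + h - x = h); last by ring.
by rewrite normrM ler_piMl// cos_max.
Qed.

(** Mean value theorem for t -> cos(y + t) + t sin(y), whose derivative is at most |t| in absolute
    value. The constant 1 instead of 1/2 is enough. *)
Lemma cos_taylor1 y h : `|cos (y + h) - cos y + h * sin y| <= h ^+ 2.
Proof.
wlog h0 : y h / 0 <= h => [W|].
  have [|/ltW h0] := leP 0 h; first exact: W.
  have := W (- y) (- h); rewrite -opprD !cosN sinN mulrNN sqrrN; apply; lra.
pose f t := cos (y + t) + t * sin y.
pose df t := - sin (y + t) + sin y.
have fd (t : R) : is_derive t 1 f (df t).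
  rewrite /f /df; apply: is_derive_eq; rewrite /=.
  by rewrite scaler0 !add0r mulr1 /GRing.scale/= mulr1.
have fc : continuous f.
  by move=> t; apply: differentiable_continuous; apply/derivable1_diffP; exact: ex_derive.
have cc : {within `[0, h], continuous f} by exact: continuous_subspaceT.
have [c ch] := MVT_segment h0 (fun y _ => fd y) cc.
rewrite /f addr0 mul0r addr0 subr0 => fE.
rewrite (_ : _ + _ = df c * h); last by rewrite -fE; ring.
rewrite normrM expr2 (ger0_norm h0) ler_wpM2r// /df addrC distrC.
move: ch; rewrite in_itv/= => /andP[c0 ch].
by apply: le_trans (sin_lipschitz _ _) _; rewrite ger0_norm.
Qed.

(** A quadratic remainder can be summed over a series term by term, so series are differentiated
    without a theorem on uniform convergence of derivatives. *)
Lemma is_derive_quadratic (f : R -> R) x d (C : R) :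
  (forall h, `|f (x + h) - f x - h * d| <= C * h ^+ 2) -> is_derive x 1 f d.
Proof.
move=> hf.
have cv : h^-1 *: (f (h *: 1 + x) - f x) @[h --> 0^'] --> d.
  apply/cvgrPdist_le => e e0.
  near=> h.
  have h0 : h != 0 by near: h; exact: nbhs_dnbhs_neq.
  have -> : h *: 1 + x = x + h by rewrite /GRing.scale/= mulr1 addrC.
  rewrite distrC /GRing.scale/=.
  have -> : h^-1 * (f (x + h) - f x) - d = h^-1 * (f (x + h) - f x - h * d).
    by field.
  rewrite normrM normfV ler_pdivrMl ?normr_gt0//.
  apply: le_trans (hf h) _.
  have -> : h ^+ 2 = `|h| * `|h| by rewrite -expr2 real_normK// num_real.
  rewrite mulrCA ler_wpM2l//.
  have hC : `|h| <= e / (`|C| + 1).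
    near: h; apply: dnbhs0_le; rewrite divr_gt0// ltr_wpDl//.
  have C1 : 0 < `|C| + 1 by rewrite ltr_wpDl.
  move: hC; rewrite ler_pdivlMr// => hC.
  have h1 := ler_norm C.
  have h2 : 0 <= `|h| by [].
  by nra.
apply: DeriveDef; first by apply/cvg_ex; exists d.
exact: cvg_lim cv.
Unshelve. all: by end_near. Qed.

(** All moments are required, so that the class is stable under differentiation. *)
Definition rapid c := forall n, exists S, abs_bounded (fun k => k%:R ^+ n * c k) S.

Lemma rapid_abs_bounded c : rapid c -> exists S, abs_bounded c S.
Proof.
move=> /(_ 0%N)[S cS]; exists S; apply: abs_bounded_le_norm cS => n.
by rewrite expr0 mul1r.
Qed.

Lemma rapidM c n : rapid c -> rapid (fun k => k%:R ^+ n * c k).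
Proof.
move=> rc m; have [S cS] := rc (m + n)%N; exists S.
by apply: abs_bounded_le_norm cS => k; rewrite mulrA -exprD.
Qed.

(* The phase th makes the family closed under differentiation. *)
Definition cser th c x := tsum (fun k => c k * cos (k%:R * x + th)).

Lemma cser_abs_bounded th c x S : abs_bounded c S ->
  abs_bounded (fun k => c k * cos (k%:R * x + th)) S.
Proof.
move=> cS n; apply: le_trans (cS n); apply: ler_sum => i _.
by rewrite normrM ler_piMr// cos_max.
Qed.

Lemma norm_cser_le th c x S : abs_bounded c S -> `|cser th c x| <= S.
Proof. by move=> cS; apply: norm_tsum_le; exact: cser_abs_bounded. Qed.

(** The k-th remainder is at most |c k| (k h)^2, so the second moment of [c] is the constant of the
    quadratic remainder. *)
Lemma is_derive_cser th c x : rapid c ->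
  is_derive x 1 (cser th c) (cser (th + pi / 2) (fun k => k%:R * c k) x).
Proof.
move=> rc; have [S0 cS0] := rapid_abs_bounded rc.
have [S1 cS1] := rc 1%N; have [S2 cS2] := rc 2%N.
have cS1' : abs_bounded (fun k => k%:R * c k) S1.
  by apply: abs_bounded_le_norm cS1 => k; rewrite expr1.
apply: (@is_derive_quadratic _ _ _ S2) => h.
have b1 := cser_abs_bounded th (x + h) cS0.
have b2 := abs_boundedZ (-1) (cser_abs_bounded th x cS0).
have b3 := abs_boundedZ (- h) (cser_abs_bounded (th + pi / 2) x cS1').
rewrite (_ : _ - _ = cser th c (x + h) + -1 * cser th c x +
    - h * cser (th + pi / 2) (fun k => k%:R * c k) x); last by ring.
rewrite /cser -(tsumZ _ (cser_abs_bounded th x cS0)).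
rewrite -(tsumZ _ (cser_abs_bounded (th + pi / 2) x cS1')).
rewrite -(tsumD b1 b2) -(tsumD (abs_boundedD b1 b2) b3).
have -> : S2 * h ^+ 2 = `|h ^+ 2| * S2 by rewrite ger0_norm ?sqr_ge0// mulrC.
apply: norm_tsum_le; apply: abs_bounded_le_norm (abs_boundedZ (h ^+ 2) cS2) => k.
rewrite addrA cosDpihalf.
rewrite (_ : k%:R * (x + h) + th = k%:R * x + th + k%:R * h); last by ring.
set y := k%:R * x + th.
rewrite (_ : c k * _ + _ + _ =
  c k * (cos (y + k%:R * h) - cos y + k%:R * h * sin y)); last by ring.
rewrite normrM.
apply: le_trans (ler_wpM2l (normr_ge0 _) (cos_taylor1 _ _)) _.
rewrite -[X in _ * X]ger0_norm ?sqr_ge0// -normrM exprMn.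
by rewrite (_ : c k * _ = h ^+ 2 * (k%:R ^+ 2 * c k))//; ring.
Qed.

Lemma derive1_cser th c : rapid c ->
  (cser th c)^`()%classic = cser (th + pi / 2) (fun k => k%:R * c k).
Proof.
move=> rc; apply/funext => x; rewrite derive1E.
by have [] := is_derive_cser th x rc.
Qed.

Lemma derive1n_cser n th c : rapid c ->
  derive1n n (cser th c) = cser (th + n%:R * (pi / 2)) (fun k => k%:R ^+ n * c k).
Proof.
move=> rc; elim: n => [|n IH].
  by rewrite derive1n0 mul0r addr0; congr cser; apply/funext => k; rewrite expr0 mul1r.
rewrite derive1nS IH derive1_cser; last exact: rapidM.
congr cser; first by rewrite -natr1; ring.
by apply/funext => k; rewrite exprS mulrA.
Qed.

Lemma derivable_cser n th c x : rapid c -> derivable (derive1n n (cser th c)) x 1.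
Proof.
move=> rc; rewrite derive1n_cser//.
by have [] := is_derive_cser (th + n%:R * (pi / 2)) x (rapidM n rc).
Qed.

Lemma continuous_cser th c : rapid c -> continuous (cser th c).
Proof.
move=> rc x; apply: differentiable_continuous; apply/derivable1_diffP.
by have := @derivable_cser 0 th c x rc; rewrite derive1n0.
Qed.

Definition cos_series c := cser 0 c.

Lemma cos_seriesE c x : cos_series c x = tsum (fun k => c k * cos (k%:R * x)).
Proof. by apply: tsum_ext => k; rewrite addr0. Qed.

Lemma cos_series_derive2 c : rapid c ->
  derive1n 2 (cos_series c) = cos_series (fun k => - k%:R ^+ 2 * c k).
Proof.
move=> rc; rewrite derive1n_cser// add0r; apply/funext => x.
rewrite cos_seriesE; apply: tsum_ext => k.
rewrite (_ : 2%:R * (pi / 2) = pi); last by field.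
by rewrite cosDpi; ring.
Qed.

Lemma cos_series_derive4 c : rapid c ->
  derive1n 4 (cos_series c) = cos_series (fun k => k%:R ^+ 4 * c k).
Proof.
move=> rc; rewrite derive1n_cser// add0r; apply/funext => x.
rewrite cos_seriesE; apply: tsum_ext => k.
rewrite (_ : 4%:R * (pi / 2) = pi + pi); last by field.
by rewrite addrA !cosDpi opprK.
Qed.

Lemma cos_nat_period k x : cos (k%:R * (x + 2 * pi)) = cos (k%:R * x) :> R.
Proof.
rewrite mulrDr -[RHS](periodicn (@cosD2pi R) k); congr cos.
by rewrite -mulr_natl; congr (_ + _); rewrite [pi *+ 2]mulr2n; ring.
Qed.

Lemma even_periodic_cos_series c : even_periodic (cos_series c).
Proof.
split=> x; rewrite !cos_seriesE; apply: tsum_ext => k.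
  by rewrite mulrN cosN.
by rewrite cos_nat_period.
Qed.

Lemma cos_seriesD c c' x : rapid c -> rapid c' ->
  cos_series (fun k => c k + c' k) x = cos_series c x + cos_series c' x.
Proof.
move=> /rapid_abs_bounded[S cS] /rapid_abs_bounded[S' cS'].
rewrite -(tsumD (cser_abs_bounded 0 x cS) (cser_abs_bounded 0 x cS')).
by apply: tsum_ext => k; rewrite mulrDl.
Qed.

Lemma cos_seriesZ a c x : rapid c ->
  cos_series (fun k => a * c k) x = a * cos_series c x.
Proof.
move=> /rapid_abs_bounded[S cS].
rewrite -(tsumZ _ (cser_abs_bounded 0 x cS)).
by apply: tsum_ext => k; rewrite mulrA.
Qed.

Lemma rapidD c c' : rapid c -> rapid c' -> rapid (fun k => c k + c' k).
Proof.
move=> rc rc' n; have [S cS] := rc n; have [S' cS'] := rc' n.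
exists (S + S'); apply: abs_bounded_le_norm (abs_boundedD cS cS') => k.
by rewrite mulrDr.
Qed.

Lemma rapidZ a c : rapid c -> rapid (fun k => a * c k).
Proof.
move=> rc n; have [S cS] := rc n; exists (`|a| * S).
by apply: abs_bounded_le_norm (abs_boundedZ a cS) => k; rewrite mulrCA.
Qed.

(** With s the square root of t, one factor s^k absorbs 1 + k by Bernoulli's inequality and the
    other absorbs (1 + k)^n by the induction hypothesis at s. *)
Lemma poly_le_exp n (t : R) : 1 < t ->
  exists2 C : R, 0 < C & forall k, (1 + k%:R) ^+ n <= C * t ^+ k.
Proof.
elim: n t => [|n IH] t t1.
  by exists 1 => // k; rewrite expr0 mul1r exprn_ege1// ltW.
have t0 : 0 < t by exact: lt_trans t1.
pose s := Num.sqrt t.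
have s1 : 1 < s by rewrite -sqrtr1 ltr_sqrt.
have [C C0 hC] := IH _ s1.
have d0 : 0 < s - 1 by rewrite subr_gt0.
have hb k : 1 + k%:R * (s - 1) <= s ^+ k.
  elim: k => [|k IHk]; first by rewrite mul0r addr0 expr0.
  have k0 : 0 <= k%:R :> R by exact: ler0n.
  rewrite -natr1 exprS.
  have : s * (1 + k%:R * (s - 1)) <= s * s ^+ k by rewrite ler_wpM2l// ltW// (lt_trans _ s1).
  apply: le_trans; rewrite -subr_ge0 (_ : _ - _ = k%:R * (s - 1) ^+ 2); last by ring.
  by rewrite mulr_ge0// sqr_ge0.
have e0 : 0 < (s - 1)^-1 by rewrite invr_gt0.
exists (C * (1 + (s - 1)^-1)) => [|k]; first by rewrite mulr_gt0// addr_gt0.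
have sk : t ^+ k = s ^+ k * s ^+ k by rewrite -exprMn -expr2 sqr_sqrtr// ltW.
rewrite exprS sk [leRHS](_ : _ = ((1 + (s - 1)^-1) * s ^+ k) * (C * s ^+ k)); last by ring.
have sk1 : 1 <= s ^+ k by rewrite exprn_ege1// ltW.
apply: ler_pM => //.
rewrite mulrDl mul1r lerD// mulrC ler_pdivlMr//.
by apply: le_trans (hb k); rewrite lerDr.
Qed.

Lemma geometric_abs_bounded (t : R) : 0 <= t < 1 -> abs_bounded (fun k => t ^+ k) (1 - t)^-1.
Proof.
move=> /andP[t0 t1] n.
under eq_bigr do rewrite normrX (ger0_norm t0).
have h : (1 - t) * \sum_(i < n) t ^+ i = 1 - t ^+ n.
  elim: n => [|n IH]; first by rewrite big_ord0 expr0 subrr mulr0.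
  by rewrite big_ord_recr/= mulrDr IH exprS; ring.
have d0 : 0 < 1 - t by rewrite subr_gt0.
by rewrite -[leRHS]mulr1 ler_pdivlMl// h gerBl exprn_ge0.
Qed.

Lemma poly_geom_bounded n : exists2 C : R, 0 <= C &
  abs_bounded (fun k => (1 + k%:R) ^+ n / 2 ^+ k) C.
Proof.
(* Any base strictly between 1 and 2 would do; 3/2 leaves the geometric ratio 3/4. *)
have [|C C0 hC] := @poly_le_exp n (3 / 2); first by lra.
have ht : 0 <= (3 / 4 : R) < 1 by lra.
have b := abs_boundedZ C (geometric_abs_bounded ht).
exists (`|C| * (1 - 3 / 4)^-1); first by rewrite mulr_ge0// invr_ge0; lra.
apply: abs_bounded_le b => k.
rewrite ger0_norm; last by rewrite divr_ge0// exprn_ge0// addr_ge0// ler0n.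
rewrite ler_pdivrMr ?exprn_gt0// -mulrA -exprMn.
by rewrite (_ : 3 / 4 * 2 = 3 / 2) ?hC//; field.
Qed.

(** Decay at the rate dual to the weight 2^k of the mode norm; it is quantitative where [rapid] is
    only qualitative. *)
Definition geom c (M : R) := forall k, `|c k| <= M / 2 ^+ k.

Lemma geom_ge0 c M : geom c M -> 0 <= M.
Proof. by move=> /(_ 0%N); rewrite expr0 divr1; exact: le_trans. Qed.

Lemma geom_moment c M n C : abs_bounded (fun k => (1 + k%:R) ^+ n / 2 ^+ k) C ->
  geom c M -> abs_bounded (fun k => (1 + k%:R) ^+ n * c k) (M * C).
Proof.
move=> bC gc; rewrite -(ger0_norm (geom_ge0 gc)).
apply: abs_bounded_le (abs_boundedZ M bC) => k.
rewrite normrM ger0_norm ?exprn_ge0 ?addr_ge0 ?ler0n// mulrCA.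
by rewrite ler_wpM2l// exprn_ge0// addr_ge0// ler0n.
Qed.

Lemma geom_rapid c M : geom c M -> rapid c.
Proof.
move=> gc n; have [C C0 bC] := poly_geom_bounded n; exists (M * C).
have b := geom_moment bC gc; move=> N; apply: le_trans (b N).
apply: ler_sum => i _; rewrite !normrM ler_wpM2r// !normrX.
by rewrite lerXn2r// ?nnegrE// !ger0_norm ?addr_ge0 ?ler0n// lerDr.
Qed.

End CosineSeries.

(** * Integration and Fourier coefficients on the torus *)

Section TorusIntegral.
Context {R : realType}.
Implicit Types (f g h F G : R -> R) (c : nat -> R).
Local Notation mu := (@lebesgue_measure R).

Definition tint f : R := \int[mu]_(x in torus) f x.

Definition intg f := mu.-integrable torus (EFin \o f).

Lemma measurable_torus : measurable (torus : set (measurableTypeR R)).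
Proof. exact: measurable_itv. Qed.

Lemma Npi_lt_pi : - pi < pi :> R.
Proof. by have := pi_gt0 R; lra. Qed.

Lemma measure_torus : mu torus = (2 * pi)%:E.
Proof.
rewrite /torus lebesgue_measure_itv/= lte_fin Npi_lt_pi -EFinB; congr EFin; ring.
Qed.

Lemma torus_finite : (mu torus < +oo)%E.
Proof. by rewrite measure_torus ltry. Qed.

Lemma intg_bounded f (M : R) : measurable_fun setT f ->
  (forall x, torus x -> `|f x| <= M) -> intg f.
Proof.
move=> mf fM; apply: measurable_bounded_integrable.
- exact: measurable_torus.
- exact: torus_finite.
- exact: measurable_funTS.
- exists M; split; first exact: num_real.
  by move=> y My x tx; exact: le_trans (fM x tx) (ltW My).
Qed.

Lemma intg_continuous f : continuous f -> intg f.
Proof.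
move=> cf; apply: continuous_compact_integrable; first exact: segment_compact.
exact: continuous_subspaceT.
Qed.

Lemma intgD f g : intg f -> intg g -> intg (fun x => f x + g x).
Proof.
move=> fi gi; rewrite /intg (_ : EFin \o _ = ((EFin \o f) \+ (EFin \o g))%E)//.
by apply: integrableD => //; exact: measurable_torus.
Qed.

Lemma intgZ k f : intg f -> intg (fun x => k * f x).
Proof.
move=> fi; rewrite /intg (_ : EFin \o _ = (fun x => k%:E * (EFin \o f) x)%E)//.
by apply: integrableZl => //; exact: measurable_torus.
Qed.

Lemma intgMb f h (M : R) : intg f -> measurable_fun setT h ->
  (forall x, `|h x| <= M) -> intg (fun x => f x * h x).
Proof.
move=> fi mh hM; rewrite /intg (_ : EFin \o _ = ((EFin \o f) \* (EFin \o h))%E)//.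
apply: integrableMl => //; first exact: measurable_torus.
  exact: measurable_funTS.
exists M; split; first exact: num_real.
by move=> y My x _; exact: le_trans (hM x) (ltW My).
Qed.

Lemma tintD f g : intg f -> intg g -> tint (fun x => f x + g x) = tint f + tint g.
Proof. by move=> fi gi; rewrite /tint RintegralD//; exact: measurable_torus. Qed.

Lemma tintZ k f : intg f -> tint (fun x => k * f x) = k * tint f.
Proof. by move=> fi; rewrite /tint RintegralZl//; exact: measurable_torus. Qed.

Lemma eq_tint f g : f =1 g -> tint f = tint g.
Proof. by move=> /funext ->. Qed.

Lemma norm_tint_le f (M : R) : intg f -> (forall x, torus x -> `|f x| <= M) ->
  `|tint f| <= 2 * pi * M.
Proof.
move=> fi fM; rewrite /tint.
have h := le_normr_Rintegral measurable_torus fi.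
apply: (le_trans h).
have -> : 2 * pi * M = \int[mu]_(x in torus) M.
  rewrite Rintegral_cst; last exact: measurable_torus.
  rewrite (_ : fine _ = 2 * pi); first by rewrite mulrC.
  exact: (congr1 fine measure_torus).
apply: le_Rintegral => //; first exact: measurable_torus.
  exact: (integrable_norm fi).
by apply: intg_continuous => x; exact: cvg_cst.
Qed.

Lemma continuous_of_derive F f : (forall x : R, is_derive x 1 F (f x)) -> continuous F.
Proof.
move=> dF x; apply: differentiable_continuous; apply/derivable1_diffP.
by have [] := dF x.
Qed.

Lemma tint_derive F f : (forall x : R, is_derive x 1 F (f x)) -> continuous f ->
  tint f = F pi - F (- pi).
Proof.
move=> dF cf; have cF := continuous_of_derive dF.
rewrite /tint /Rintegral (@continuous_FTC2 _ f F)//.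
- exact: Npi_lt_pi.
- exact: continuous_subspaceT.
- split; first by move=> x _; have [] := dF x.
  + by apply: cvg_at_right_filter; exact: cF.
  + by apply: cvg_at_left_filter; exact: cF.
- by move=> x _; rewrite derive1E; have [] := dF x.
Qed.

Lemma tint_by_parts F f G g : (forall x : R, is_derive x 1 F (f x)) ->
  (forall x : R, is_derive x 1 G (g x)) -> continuous f -> continuous g ->
  F (- pi) = F pi -> G (- pi) = G pi ->
  tint (fun x => F x * g x) = - tint (fun x => f x * G x).
Proof.
move=> dF dG cf cg FE GE.
have cF := continuous_of_derive dF; have cG := continuous_of_derive dG.
have c1 : continuous (fun x => F x * g x).
  by move=> x; apply: cvgM; [exact: cF|exact: cg].
have c2 : continuous (fun x => f x * G x).
  by move=> x; apply: cvgM; [exact: cf|exact: cG].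
have dFG (x : R) : is_derive x 1 (fun x => F x * G x) (F x * g x + f x * G x).
  apply: (@is_derive_eq _ _ _ ((F : R -> R) * (G : R -> R)) x 1 _ _ (is_deriveM (dF x) (dG x))).
  by rewrite /GRing.scale/= [G x * _]mulrC.
have c3 : continuous (fun x => F x * g x + f x * G x).
  by move=> x; apply: cvgD; [exact: c1|exact: c2].
apply/eqP; rewrite -addr_eq0 -tintD; [|exact: intg_continuous..].
by rewrite (tint_derive dFG c3) FE GE subrr.
Qed.

Lemma continuous_cos_nat k : continuous (fun x : R => cos (k%:R * x)).
Proof.
move=> x; apply: (@continuous_comp _ _ _ (fun x : R => k%:R * x) cos).
  by apply: cvgM; [exact: cvg_cst|exact: cvg_id].
exact: continuous_cos.
Qed.

Lemma measurable_cos_nat k : measurable_fun setT (fun x : R => cos (k%:R * x)).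
Proof. exact (measurable_realfun.continuous_measurable_fun (@continuous_cos_nat k)). Qed.

Lemma sin_nat_pi k : sin (k%:R * pi) = 0 :> R.
Proof.
elim: k => [|k IH]; first by rewrite mul0r sin0.
by rewrite -natr1 mulrDl mul1r sinD IH sinpi mul0r mulr0 addr0.
Qed.

Lemma tint_cos k : tint (fun x => cos (k%:R * x)) = if k == 0%N then 2 * pi else 0.
Proof.
have [->|k0] := eqVneq k 0%N.
  rewrite (@eq_tint _ (fun=> 1)); last by move=> x; rewrite mul0r cos0.
  rewrite /tint Rintegral_cst; last exact: measurable_torus.
  by rewrite mul1r; exact: (congr1 fine measure_torus).
have k0' : k%:R != 0 :> R by rewrite pnatr_eq0.
have ds (x : R) : is_derive x 1 (fun x => k%:R^-1 * sin (k%:R * x)) (cos (k%:R * x)).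
  apply: is_derive_eq.
  by rewrite /GRing.scale/= mulr1; field.
rewrite (tint_derive ds); last exact: continuous_cos_nat.
by rewrite mulrN sinN sin_nat_pi oppr0 subrr.
Qed.

(** This is |p - q|: one of the two truncated differences is zero. *)
Definition distn' (p q : nat) : nat := (p - q + (q - p))%N.

Lemma cosM p q x : cos (p%:R * x) * cos (q%:R * x) =
  2^-1 * (cos ((p + q)%:R * x) + cos ((distn' p q)%:R * x)) :> R.
Proof.
have -> : cos ((distn' p q)%:R * x) = cos (p%:R * x - q%:R * x) :> R.
  rewrite /distn'; have [pq|/ltnW qp] := leqP p q.
    move: (pq); rewrite -subn_eq0 => /eqP ->.
    by rewrite add0n natrB// mulrBl -cosN opprB.
  move: (qp); rewrite -subn_eq0 => /eqP ->.
  by rewrite addn0 natrB// mulrBl.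
rewrite natrD mulrDl cosB cosD; by field.
Qed.

Lemma tint_cosM p q : tint (fun x => cos (p%:R * x) * cos (q%:R * x)) =
  if p == q then (if p == 0%N then 2 * pi else pi) else 0.
Proof.
rewrite (@eq_tint _ (fun x => 2^-1 * (cos ((p + q)%:R * x) + cos ((distn' p q)%:R * x)))).
  have i1 := intg_continuous (@continuous_cos_nat (p + q)).
  have i2 := intg_continuous (@continuous_cos_nat (distn' p q)).
  rewrite tintZ ?tintD//; last exact: intgD.
  rewrite !tint_cos /distn'; have [->|pq] := eqVneq p q.
    rewrite subnn addn0 addnn double_eq0 eqxx; case: ifP => _; by field.
  by rewrite !ifF ?addr0 ?mulr0//; lia.
by move=> x; exact: cosM.
Qed.

Definition fnorm (k : nat) : R := if k == 0%N then (2 * pi)^-1 else pi^-1.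

Lemma fourierE f k : fourier f k = fnorm k * tint (fun x => f x * cos (k%:R * x)).
Proof. by []. Qed.

Lemma fnorm_gt0 k : 0 < fnorm k.
Proof.
by have p0 := pi_gt0 R; rewrite /fnorm; case: ifP; rewrite invr_gt0 ?mulr_gt0.
Qed.

Lemma intg_mul_cos f k : intg f -> intg (fun x => f x * cos (k%:R * x)).
Proof.
move=> fi; apply: (@intgMb _ _ 1) => //; first exact: measurable_cos_nat.
by move=> x; exact: cos_max.
Qed.

Lemma fourierD f g k : intg f -> intg g ->
  fourier (fun x => f x + g x) k = fourier f k + fourier g k.
Proof.
move=> fi gi; rewrite !fourierE -mulrDr -(tintD (intg_mul_cos k fi) (intg_mul_cos k gi)).
by congr (_ * _); apply: eq_tint => x; rewrite mulrDl.
Qed.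

Lemma fourierZ a f k : intg f -> fourier (fun x => a * f x) k = a * fourier f k.
Proof.
move=> fi; rewrite !fourierE mulrCA -(tintZ a (intg_mul_cos k fi)).
by congr (_ * _); apply: eq_tint => x; rewrite mulrA.
Qed.

Lemma fourier_cos j k : fourier (fun x => cos (j%:R * x)) k = (j == k)%:R :> R.
Proof.
have p0 : pi != 0 :> R by rewrite gt_eqF// pi_gt0.
rewrite fourierE tint_cosM /fnorm; have [->|_] := eqVneq j k; last by rewrite mulr0.
by case: ifP => _; rewrite mulVf// mulf_neq0// pnatr_eq0.
Qed.

Lemma norm_fourier_le f k (M : R) : intg f -> (forall x, torus x -> `|f x| <= M) ->
  `|fourier f k| <= 2 * M.
Proof.
move=> fi fM; rewrite fourierE normrM (gtr0_norm (fnorm_gt0 k)).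
have p0 := pi_gt0 R.
have h : `|tint (fun x => f x * cos (k%:R * x))| <= 2 * pi * M.
  apply: norm_tint_le; first exact: intg_mul_cos.
  by move=> x tx; apply: le_trans (fM x tx); rewrite normrM ler_piMr// cos_max.
have M0 : 0 <= M.
  have t0 : torus (0 : R) by rewrite /torus/= in_itv/=; lra.
  exact: le_trans (fM _ t0).
apply: le_trans (ler_wpM2l (ltW (fnorm_gt0 k)) h) _.
have -> : fnorm k * (2 * pi * M) = (fnorm k * pi) * (2 * M) by ring.
rewrite ler_piMl// ?mulr_ge0// /fnorm; case: ifP => _; last by rewrite mulVf// gt_eqF.
by rewrite invfM -mulrA mulVf ?gt_eqF// mulr1; lra.
Qed.

Lemma fourier_sum n (f : nat -> R -> R) k : (forall i, intg (f i)) ->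
  fourier (fun x => \sum_(i < n) f i x) k = \sum_(i < n) fourier (f i) k.
Proof.
move=> fi; suff [] : intg (fun x => \sum_(i < n) f i x) /\
  fourier (fun x => \sum_(i < n) f i x) k = \sum_(i < n) fourier (f i) k by [].
elim: n => [|n [IH1 IH2]].
  rewrite big_ord0 (_ : (fun x => _) = fun x => 0 * 0); last first.
    by apply/funext => x; rewrite big_ord0 mul0r.
  have i0 : intg (fun x => (0 : R)) by apply: intg_continuous => x; exact: cvg_cst.
  by split; [exact: intgZ|rewrite fourierZ// mul0r].
rewrite big_ord_recr/= -IH2 (_ : (fun x => _) = fun x => \sum_(i < n) f i x + f n x).
  by split; [exact: intgD|rewrite fourierD].
by apply/funext => x; rewrite big_ord_recr.
Qed.

(** A partial sum with more than k terms has k-th coefficient exactly [c k], and the coefficient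
    functional is bounded by twice the supremum norm, so uniform approximation pins down the
    coefficient. *)
Lemma fourier_uniform f c k : intg f ->
  (forall e : R, 0 < e -> exists N, forall n, (N <= n)%N ->
     forall x, torus x -> `|f x - \sum_(i < n) c i * cos (i%:R * x)| <= e) ->
  fourier f k = c k.
Proof.
move=> fi unif; apply/eqP; rewrite -subr_eq0 -normr_le0; apply/ler_addgt0Pr => e e0.
rewrite add0r; have e2 : 0 < e / 2 by rewrite divr_gt0.
have [N hN] := unif _ e2.
pose n := maxn N k.+1; pose S x := \sum_(i < n) c i * cos (i%:R * x).
have ci i : intg (fun x => c i * cos (i%:R * x)).
  by apply: intgZ; exact: intg_continuous (@continuous_cos_nat i).
have cS : continuous S.
  rewrite /S; elim: (n) => [|m IH] x.
    by rewrite (_ : (fun x => _) = fun=> 0); [exact: cvg_cst|apply/funext => y; rewrite big_ord0].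
  rewrite (_ : (fun x => _) = fun x => \sum_(i < m) c i * cos (i%:R * x) + c m * cos (m%:R * x)).
    apply: cvgD; first exact: IH.
    by apply: cvgM; [exact: cvg_cst|exact: continuous_cos_nat].
  by apply/funext => y; rewrite big_ord_recr.
have Si := intg_continuous cS.
have fS : fourier S k = c k.
  rewrite /S (@fourier_sum n (fun i x => c i * cos (i%:R * x)))//.
  have kn : (k < n)%N by rewrite leq_max ltnSn orbT.
  rewrite (bigD1 (Ordinal kn))//= fourierZ; last exact: intg_continuous (@continuous_cos_nat k).
  rewrite fourier_cos eqxx mulr1 big1 ?addr0// => i.
  rewrite -val_eqE/= => /negbTE ik.
  by rewrite fourierZ; [rewrite fourier_cos ik mulr0|exact: intg_continuous (@continuous_cos_nat i)].
have -> : fourier f k - c k = fourier (fun x => f x + -1 * S x) k.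
  by rewrite fourierD//; [rewrite fourierZ// fS mulN1r|exact: intgZ].
have := @norm_fourier_le (fun x => f x + -1 * S x) k (e / 2).
rewrite (_ : 2 * (e / 2) = e); last by field.
apply; first by apply: intgD => //; exact: intgZ.
move=> x tx; rewrite mulN1r; apply: hN => //.
exact: leq_maxl.
Qed.

Lemma cos_series_tail c S (e : R) : abs_bounded c S -> 0 < e ->
  exists N, forall n, (N <= n)%N ->
    forall x, `|cos_series c x - \sum_(i < n) c i * cos (i%:R * x)| <= e.
Proof.
move=> cS e0; have [N hN] := tail_small cS e0; exists N => n Nn x.
have b1 := cser_abs_bounded 0 x cS.
(* Minus the first n terms of the series: the error becomes a single sum whose head cancels, and
   only the tail of [c] has to be estimated. *)
pose y k := if (k < n)%N then - (c k * cos (k%:R * x + 0)) else 0.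
have yS : abs_bounded y S.
  apply: abs_bounded_le_norm b1 => k; rewrite /y; case: ifP; last by rewrite normr0.
  by rewrite normrN.
have -> : \sum_(i < n) c i * cos (i%:R * x) = - tsum y.
  rewrite (@tsum_finite _ y n); last by move=> k; rewrite /y ltnNge => ->.
  rewrite -sumrN; apply: eq_bigr => i _; by rewrite /y ltn_ord opprK addr0.
rewrite opprK /cos_series /cser -(tsumD b1 yS); apply: norm_tsum_le => m.
apply: le_trans (hN m).
rewrite -(big_mkord xpredT (fun i => `|c i * cos (i%:R * x + 0) + y i|)).
have yE i : `|c i * cos (i%:R * x + 0) + y i| <= if (i < N)%N then 0 else `|c i|.
  rewrite /y; have [iN|Ni] := ltnP i N.
    by rewrite (leq_trans iN Nn) subrr normr0.
  case: ifP => _; first by rewrite subrr normr0.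
  by rewrite addr0 normrM ler_piMr// cos_max.
apply: le_trans (ler_sum _ (fun i _ => yE i)) _.
have [Nm|mN] := leqP N m.
  rewrite (@big_cat_nat _ _ _ N)//= big_nat big1 ?add0r => [|i /andP[_ ->]//].
  by rewrite big_nat [leRHS]big_nat; apply: ler_sum => i /andP[Ni _]; rewrite ltnNge Ni.
rewrite [leRHS]big_geq; last exact: ltnW.
rewrite big_nat big1// => i /andP[_ im]; by rewrite (ltn_trans im mN).
Qed.

Lemma intg_cos_series c : rapid c -> intg (cos_series c).
Proof. by move=> rc; apply: intg_continuous; exact: continuous_cser. Qed.

Lemma fourier_cos_series c k : rapid c -> fourier (cos_series c) k = c k.
Proof.
move=> rc; have [S cS] := rapid_abs_bounded rc.
apply: fourier_uniform; first exact: intg_cos_series.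
move=> e e0; have [N hN] := cos_series_tail cS e0.
by exists N => n Nn x _; exact: hN.
Qed.

Lemma L2_cos_series c : rapid c -> L2_per_even (cos_series c).
Proof.
move=> rc; have cc : continuous (cos_series c) := @continuous_cser _ 0 c rc.
split; first exact: even_periodic_cos_series.
- exact (measurable_realfun.continuous_measurable_fun cc).
- apply: (@intg_continuous (fun x => cos_series c x ^+ 2)) => x.
  by rewrite (_ : (fun x => _) = fun x => cos_series c x * cos_series c x)//; apply: cvgM; exact: cc.
Qed.

End TorusIntegral.

(** * Sobolev norms and weak derivatives of cosine series *)

Section Sobolev.
Context {R : realType}.
Implicit Types (f g v : R -> R) (c : nat -> R).

Lemma sobolev_terms_cos_series s c : rapid c ->
  sobolev_terms s (cos_series c) = fun k => (1 + k%:R ^+ 2) ^+ s * c k ^+ 2.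
Proof.
by move=> rc; apply/funext => k; rewrite /sobolev_terms fourier_cos_series.
Qed.

Lemma sobolev_weight_le s k : (1 + k%:R ^+ 2) ^+ s <= ((1 + k%:R) ^+ s) ^+ 2 :> R.
Proof.
have k0 : 0 <= k%:R :> R by exact: ler0n.
rewrite exprAC lerXn2r// ?nnegrE ?sqr_ge0// ?addr_ge0// ?sqr_ge0//.
by rewrite sqrrD expr1n mul1r; lra.
Qed.

Lemma sum_sqr_le (x : nat -> R) n : \sum_(i < n) x i ^+ 2 <= (\sum_(i < n) `|x i|) ^+ 2.
Proof.
elim: n => [|n IH]; first by rewrite !big_ord0 expr0n.
rewrite !big_ord_recr/=.
have h : 0 <= \sum_(i < n) `|x i| by exact: sumr_ge0.
have h' : 0 <= `|x n| by [].
rewrite -(real_normK (num_real (x n))).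
by nra.
Qed.

(** The l^2 norm is at most the l^1 norm, and (1 + k^2)^s <= (1 + k)^(2 s); so an l^1 bound on the
    moment of order s controls the H^s norm. *)
Lemma sobolev_cos_series_bounded s c S : rapid c ->
  abs_bounded (fun k => (1 + k%:R) ^+ s * c k) S ->
  abs_bounded (sobolev_terms s (cos_series c)) (S ^+ 2).
Proof.
move=> rc cS n; rewrite sobolev_terms_cos_series//.
have S0 := abs_bounded_ge0 cS.
pose y k := (1 + k%:R) ^+ s * c k.
apply: (@le_trans _ _ (\sum_(i < n) y i ^+ 2)).
  apply: ler_sum => k _; rewrite ger0_norm.
    by rewrite /y exprMn ler_wpM2r ?sqr_ge0// sobolev_weight_le.
  by rewrite mulr_ge0 ?sqr_ge0// exprn_ge0// addr_ge0// sqr_ge0.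
apply: le_trans (sum_sqr_le _ _) _.
by rewrite lerXn2r// ?nnegrE// ?sumr_ge0//; exact: cS.
Qed.

Lemma H_norm_cos_series_le s c S : rapid c ->
  abs_bounded (fun k => (1 + k%:R) ^+ s * c k) S -> H_norm s (cos_series c) <= S.
Proof.
move=> rc cS; have S0 := abs_bounded_ge0 cS.
rewrite /H_norm -[leRHS]ger0_norm// -sqrtr_sqr ler_wsqrtr//.
apply: le_trans (ler_norm _) _; apply: norm_tsum_le.
exact: sobolev_cos_series_bounded.
Qed.

Lemma poly_rapid_bounded n c : rapid c ->
  exists S, abs_bounded (fun k => (1 + k%:R) ^+ n * c k) S.
Proof.
move=> rc; have [S0 h0] := rc 0%N; have [Sn hn] := rc n.
exists (`|2 ^+ n| * (S0 + Sn)).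
pose a0 k : R := `|k%:R ^+ 0 * c k|; pose an k : R := `|k%:R ^+ n * c k|.
have b0 : abs_bounded a0 S0 by apply: abs_bounded_le_norm h0 => k; rewrite normr_id.
have bn : abs_bounded an Sn by apply: abs_bounded_le_norm hn => k; rewrite normr_id.
apply: abs_bounded_le (abs_boundedZ (2 ^+ n) (abs_boundedD b0 bn)) => k.
rewrite /a0 /an !normrM -mulrDl mulrA; apply: ler_wpM2r => //.
rewrite expr0 normr1 !normrX ger0_norm ?addr_ge0 ?ler0n// [`|k%:R|]ger0_norm ?ler0n//.
case: k => [|k].
  rewrite addr0 expr1n -[leLHS]mulr1; apply: ler_pM => //.
    by apply: exprn_ege1; lra.
  by rewrite lerDl exprn_ge0.
apply: (@le_trans _ _ ((2 * k.+1%:R) ^+ n)).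
  rewrite lerXn2r// ?nnegrE ?addr_ge0 ?mulr_ge0 ?ler0n//.
  have : 1 <= k.+1%:R :> R by rewrite ler1n.
  lra.
by rewrite exprMn ler_wpM2l ?exprn_ge0// lerDr.
Qed.

Lemma H_per_even_cos_series s c : rapid c -> H_per_even s (cos_series c).
Proof.
move=> rc; split; first exact: L2_cos_series.
- move=> x; rewrite (_ : (fun k => _) = fun k => c k * cos (k%:R * x + 0)); last first.
    by apply/funext => k; rewrite fourier_cos_series// addr0.
  have [S cS] := rapid_abs_bounded rc.
  exact: cvg_tsum (cser_abs_bounded 0 x cS).
- have [S cS] := poly_rapid_bounded s rc.
  exact: abs_bounded_cvg (sobolev_cos_series_bounded rc cS).
Qed.

Lemma Hinfty_cos_series c : rapid c -> Hinfty_per_even (cos_series c).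
Proof. by move=> rc s _; exact: H_per_even_cos_series. Qed.

(** A single term is below the whole series, which gives decay like k^(-4). It is weakened to 2 /
    ((k+1)(k+2)) because that majorant telescopes to the explicit sum 2. *)
Lemma fourier_le_H_norm v k : H_per_even 4 v ->
  `|fourier v k| <= H_norm 4 v * (2 / (k.+1%:R * k.+2%:R)).
Proof.
move=> [_ _ cv].
have t0 i : 0 <= sobolev_terms 4 v i.
  by rewrite mulr_ge0 ?sqr_ge0// exprn_ge0// addr_ge0// sqr_ge0.
have h : sobolev_terms 4 v k <= limn (series (sobolev_terms 4 v)).
  apply: (@le_trans _ _ (series (sobolev_terms 4 v) k.+1)).
    by rewrite /series/= big_nat_recr//= lerDr sumr_ge0.
  by apply: nondecreasing_cvgn_le => //; apply: nondecreasing_series.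
have k0 : 0 <= k%:R :> R by exact: ler0n.
have hs : (1 + k%:R ^+ 2) ^+ 2 * `|fourier v k| <= H_norm 4 v.
  rewrite /H_norm -[leLHS]ger0_norm; last first.
    by rewrite mulr_ge0// exprn_ge0// addr_ge0// sqr_ge0.
  rewrite -sqrtr_sqr ler_wsqrtr//; apply: le_trans h.
  by rewrite /sobolev_terms exprMn -exprM real_normK// num_real.
have w0 : 0 < (1 + k%:R ^+ 2) ^+ 2 :> R by rewrite exprn_gt0// ltr_wpDr// sqr_ge0.
have hk : k.+1%:R * k.+2%:R <= 2 * (1 + k%:R ^+ 2) ^+ 2 :> R.
  rewrite -(natr1 k.+1) -(natr1 k).
  have h2 : 0 <= k%:R ^+ 2 :> R by exact: sqr_ge0.
  have h3 : k%:R <= k%:R ^+ 2 :> R by rewrite -natrX ler_nat; case: (k) => // j; exact: leq_pmulr.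
  have h4 : 0 <= (k%:R ^+ 2) ^+ 2 :> R by exact: sqr_ge0.
  by nra.
have p0 : 0 < k.+1%:R * k.+2%:R :> R by rewrite mulr_gt0// ltr0n.
rewrite mulrA ler_pdivlMr//.
apply: le_trans (ler_wpM2l (normr_ge0 _) hk) _.
by move: hs; lra.
Qed.

Lemma telescoping_bounded : abs_bounded (fun k => 2 / (k.+1%:R * k.+2%:R) : R) 2.
Proof.
move=> n; apply: (@le_trans _ _ (2 - 2 / n.+1%:R)); last first.
  by rewrite gerBl divr_ge0// ler0n.
elim: n => [|n IH]; first by rewrite big_ord0 divr1 subrr.
rewrite big_ord_recr/= ger0_norm; last by rewrite divr_ge0// mulr_ge0// ler0n.
apply: le_trans (lerD IH (lexx _)) _.
rewrite le_eqVlt; apply/orP; left; apply/eqP.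
rewrite -[n.+2]addn1 natrD.
have h : n.+1%:R != 0 :> R by rewrite pnatr_eq0.
have h2 : n.+1%:R + 1 != 0 :> R by rewrite natr1 pnatr_eq0.
by move: (n.+1%:R : R) h h2 => m h h2; field; rewrite h h2.
Qed.

Lemma fourier_H4_bounded v : H_per_even 4 v ->
  abs_bounded (fourier v) (2 * H_norm 4 v).
Proof.
move=> Hv; have h0 : 0 <= H_norm 4 v by exact: sqrtr_ge0.
rewrite mulrC -(ger0_norm h0).
by apply: abs_bounded_le (abs_boundedZ (H_norm 4 v) telescoping_bounded) => k; exact: fourier_le_H_norm.
Qed.

Lemma H4_cos_series v x : H_per_even 4 v -> v x = cos_series (fourier v) x.
Proof.
move=> Hv; have [_ cv _] := Hv; symmetry.
rewrite cos_seriesE; exact: cvg_tsum_eq (cv x).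
Qed.

Lemma norm_H4_le v x : H_per_even 4 v -> `|v x| <= 2 * H_norm 4 v.
Proof.
move=> Hv; rewrite (H4_cos_series x Hv).
exact: norm_cser_le (fourier_H4_bounded Hv).
Qed.

Lemma measurable_H4 v : H_per_even 4 v -> measurable_fun setT v.
Proof. by case=> -[]. Qed.

Lemma intg_H4 v : H_per_even 4 v -> intg v.
Proof.
move=> Hv; apply: (@intg_bounded _ _ (2 * H_norm 4 v)); first exact: measurable_H4.
by move=> x _; exact: norm_H4_le.
Qed.

(** [1 + f ^+ 2] dominates |f| and is integrable, as the torus has finite measure. *)
Lemma intg_L2 f : L2_per_even f -> intg f.
Proof.
move=> [_ mf f2].
have i1 : intg (fun x => 1 + f x ^+ 2).
  by apply: (@intgD _ (fun=> 1) (fun x => f x ^+ 2)) => //; apply: intg_continuous => x; exact: cvg_cst.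
apply: (le_integrable (measurable_torus (R := R)) _ _ i1).
  by apply/measurable_realfun.measurable_EFinP; exact: measurable_funTS.
move=> x _; rewrite /= lee_fin [leRHS]ger0_norm ?addr_ge0 ?sqr_ge0//.
have := sqr_ge0 (`|f x| - 1); rewrite -[f x ^+ 2]real_normK ?num_real//.
have : 0 <= `|f x| by [].
by nra.
Qed.

Definition delta_seq (k i : nat) : R := (i == k)%:R.

Lemma rapid_finite c m : (forall k, (m <= k)%N -> c k = 0) -> rapid c.
Proof.
move=> c0 n; pose y i := `|i%:R ^+ n * c i|.
exists (\sum_(i < m) y i) => N.
have y0 i : (m <= i)%N -> y i = 0.
  by move=> mi; rewrite /y c0// mulr0 normr0.
rewrite -!(big_mkord xpredT y).
have [Nm|mN] := leqP N m.
  by rewrite [leRHS](@big_cat_nat _ _ _ N)//= lerDl sumr_ge0// => i _; exact: normr_ge0.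
rewrite (@big_cat_nat _ _ _ m)//=; last exact: ltnW.
rewrite -[leRHS]addr0 lerD2l big_nat big1// => i /andP[mi _]; exact: y0.
Qed.

Lemma rapid_delta k : rapid (delta_seq k).
Proof. by apply: (@rapid_finite _ k.+1) => i ki; rewrite /delta_seq gtn_eqF. Qed.

Lemma cos_series_finite c m x : (forall k, (m <= k)%N -> c k = 0) ->
  cos_series c x = \sum_(k < m) c k * cos (k%:R * x).
Proof.
by move=> c0; rewrite cos_seriesE (@tsum_finite _ _ m)// => k mk; rewrite c0// mul0r.
Qed.

Lemma cos_series_delta d k x :
  cos_series (fun i => d i * delta_seq k i) x = d k * cos (k%:R * x).
Proof.
rewrite cos_seriesE (@tsum_finite _ _ k.+1).
  rewrite big_ord_recr/= /delta_seq eqxx mulr1 big1 ?add0r// => i _.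
  by rewrite (ltn_eqF (ltn_ord i)) mulr0 mul0r.
by move=> n kn; rewrite /delta_seq gtn_eqF// mulr0 mul0r.
Qed.

Lemma smooth_periodic_cos k : smooth_periodic (fun x : R => cos (k%:R * x)) /\
  derive1n 2 (fun x : R => cos (k%:R * x)) = (fun x => - k%:R ^+ 2 * cos (k%:R * x)) /\
  derive1n 4 (fun x : R => cos (k%:R * x)) = (fun x => k%:R ^+ 4 * cos (k%:R * x)).
Proof.
have rc := rapid_delta k.
have -> : (fun x : R => cos (k%:R * x)) = cos_series (delta_seq k).
  apply/funext => x; have := cos_series_delta (fun=> 1) k x; rewrite mul1r => <-.
  by congr (cos_series _ x); apply/funext => i; rewrite mul1r.
split; [split|split].
- by move=> n x; exact: derivable_cser.
- by move=> x; case: (even_periodic_cos_series (delta_seq k)) => _; exact.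
- by rewrite cos_series_derive2//; apply/funext => x; rewrite cos_series_delta.
- by rewrite cos_series_derive4//; apply/funext => x; rewrite cos_series_delta.
Qed.

(** The definition of the weak derivative is tested with cos(kx), an eigenfunction of the second
    derivative. *)
Lemma fourier_weak2 v v2 k : weak_derivative 2 v v2 -> intg v ->
  fourier v2 k = - k%:R ^+ 2 * fourier v k.
Proof.
move=> wd iv; have [sc [d2 _]] := smooth_periodic_cos k.
have := wd _ sc; rewrite d2 (_ : (-1) ^+ 2 = 1) ?mul1r; last by ring.
move=> h; rewrite !fourierE [tint (fun x => v2 x * _)]/tint -h mulrCA; congr (_ * _).
rewrite -(tintZ _ (intg_mul_cos k iv)).
by apply: eq_tint => x; rewrite mulrCA.
Qed.

Lemma fourier_weak4 v v4 k : weak_derivative 4 v v4 -> intg v ->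
  fourier v4 k = k%:R ^+ 4 * fourier v k.
Proof.
move=> wd iv; have [sc [_ d4]] := smooth_periodic_cos k.
have := wd _ sc; rewrite d4 (_ : (-1) ^+ 4 = 1) ?mul1r; last by ring.
move=> h; rewrite !fourierE [tint (fun x => v4 x * _)]/tint -h mulrCA; congr (_ * _).
rewrite -(tintZ _ (intg_mul_cos k iv)).
by apply: eq_tint => x; rewrite mulrCA.
Qed.

Lemma smooth_periodic_is_derive (phi : R -> R) n (x : R) : smooth_periodic phi ->
  is_derive x 1 (derive1n n phi) (derive1n n.+1 phi x).
Proof.
move=> [d _]; apply: DeriveDef; first exact: d.
by rewrite derive1nS derive1E.
Qed.

Lemma smooth_periodic_pi (phi : R -> R) n : smooth_periodic phi ->
  derive1n n phi (- pi) = derive1n n phi pi.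
Proof.
move=> [d p]; suff H x : derive1n n phi (x + 2 * pi) = derive1n n phi x.
  by rewrite -H; congr (derive1n n phi _); ring.
elim: n x => [|n IH] x; first by rewrite !derive1n0.
rewrite !derive1nS !derive1E.
have -> : 'D_1 (derive1n n phi) x = 'D_1 (fun y => derive1n n phi (y + 2 * pi)) x.
  by congr ('D_1 _ x); apply/funext => y; rewrite IH.
rewrite /derive.
rewrite (_ : (fun h : R => _) = (fun h : R => h^-1 *:
  (((fun y => derive1n n phi (y + 2 * pi)) \o shift x) (h *: 1) -
   derive1n n phi (x + 2 * pi))))//.
by apply/funext => h /=; rewrite addrA.
Qed.

Lemma weak_derivative_cos_series n c : rapid c ->
  weak_derivative n (cos_series c) (derive1n n (cos_series c)).
Proof.
move=> rc phi sp.
have cp m : continuous (derive1n m phi).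
  by apply: continuous_of_derive => x; exact: smooth_periodic_is_derive.
have sc : smooth_periodic (cos_series c).
  split; first by move=> m x; exact: derivable_cser.
  by case: (even_periodic_cos_series c).
have cc m : continuous (derive1n m (cos_series c)).
  by apply: continuous_of_derive => x; exact: smooth_periodic_is_derive.
(* Generalized over the number m of derivatives already moved to the series, so that each
   integration by parts decreases j and increases m. *)
suff H j m : tint (fun x => derive1n m (cos_series c) x * derive1n j phi x) =
   (-1) ^+ j * tint (fun x => derive1n (m + j) (cos_series c) x * phi x).
  exact: (H n 0%N).
elim: j m => [|j IH] m; first by rewrite addn0 expr0 mul1r.
rewrite (tint_by_parts (fun x => smooth_periodic_is_derive m x sc)
  (fun x => smooth_periodic_is_derive j x sp) (cc m.+1) (cp j.+1)
  (smooth_periodic_pi m sc) (smooth_periodic_pi j sp)).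
by rewrite IH exprS mulN1r mulNr addSnnS.
Qed.

End Sobolev.

(** * The auxiliary equation mode by mode *)

Section Auxiliary.
Context {R : realType} (K : nat).
Hypothesis hK : (2 <= K)%N.
Implicit Types (f g v : R -> R) (a b c : R).

(** The symbol c_0 - k^2 + beta k^4 of c_0 + L, factored to exhibit its zeros 1 and K. *)
Definition lam (k : nat) : R := beta K * ((k%:R ^+ 2 - 1) * (k%:R ^+ 2 - K%:R ^+ 2)).

Lemma beta_gt0 : 0 < beta K :> R.
Proof. by rewrite /beta invr_gt0 ltr_wpDr// sqr_ge0. Qed.

Lemma lamE k : vel0 K + (- k%:R ^+ 2 + beta K * k%:R ^+ 4) = lam k.
Proof.
have h : 1 + K%:R ^+ 2 != 0 :> R by rewrite gt_eqF// ltr_wpDr// sqr_ge0.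
by rewrite /lam /vel0 /beta; field.
Qed.

(** The integer k^2 - K^2 is at least 1 in absolute value off the resonance, so the growth is taken
    from k^2 - 1 alone. The shape (k+1)(k+2) matches the telescoping series, and 1/4 is attained by
    k^2 - 1 at k = 2. *)
Lemma lam_lower k : k != 1%N -> k != K ->
  beta K / 4 * (k.+1%:R * k.+2%:R) <= `|lam k|.
Proof.
move=> k1 kK; rewrite /lam normrM (gtr0_norm beta_gt0) -mulrA ler_pM2l ?beta_gt0//.
rewrite normrM.
have h2 : 1 <= `|k%:R ^+ 2 - K%:R ^+ 2 : R|.
  rewrite -!natrX; have [le|lt] := leqP (k ^ 2) (K ^ 2).
    rewrite distrC -natrB// normr_nat ler1n subn_gt0 ltn_neqAle le andbT.
    by rewrite eqn_exp2r.
  by rewrite -(natrB _ (ltnW lt)) normr_nat ler1n subn_gt0.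
have h1 : 4^-1 * (k.+1%:R * k.+2%:R) <= `|k%:R ^+ 2 - 1 : R|.
  case: k k1 {kK h2} => [_|[//|k] _].
    by rewrite expr0n/= sub0r normrN normr1; lra.
  have k0 : 0 <= k%:R :> R by exact: ler0n.
  have -> : k.+2%:R = k%:R + 2 :> R by rewrite -addn2 natrD.
  have -> : k.+3%:R = k%:R + 3 :> R by rewrite -addn3 natrD.
  have -> : k.+4%:R = k%:R + 4 :> R by rewrite -addn4 natrD.
  by rewrite ger0_norm; nra.
apply: le_trans h1 _; rewrite ler_peMr//.
Qed.

Lemma intg_sqr v b : measurable_fun setT v -> (forall x, `|v x| <= b) ->
  intg (fun x => v x ^+ 2).
Proof.
move=> mv vb; apply: (@intg_bounded _ _ (b ^+ 2)).
  exact: measurable_realfun.measurable_funX.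
by move=> x _; rewrite normrX lerXn2r// nnegrE// (le_trans _ (vb x)).
Qed.

Lemma cos1E (x : R) : cos x = cos (1%:R * x). Proof. by rewrite mul1r. Qed.

Lemma intg_cos_nat k : intg (fun x : R => cos (k%:R * x)).
Proof. exact: intg_continuous (@continuous_cos_nat R k). Qed.

Lemma projQE f x : projQ K f x =
  f x + (- fourier f 1 * cos (1%:R * x) + - fourier f K * cos (K%:R * x)).
Proof. by rewrite /projQ mul1r addrA !mulNr. Qed.

Lemma intg_cos_comb a b : intg (fun x : R => a * cos (1%:R * x) + b * cos (K%:R * x)).
Proof. by apply: intgD; apply: intgZ; exact: intg_cos_nat. Qed.

Lemma fourier_cos_comb a b k :
  fourier (fun x : R => a * cos (1%:R * x) + b * cos (K%:R * x)) k =
  a * (k == 1%N)%:R + b * (k == K)%:R.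
Proof.
rewrite fourierD; [|exact: intgZ (intg_cos_nat _)..].
by rewrite !fourierZ; [rewrite !fourier_cos ![_ == k]eq_sym|exact: intg_cos_nat..].
Qed.

Lemma intg_projQ f : intg f -> intg (projQ K f).
Proof.
by move=> fi; rewrite (funext (projQE f)); apply: intgD => //; exact: intg_cos_comb.
Qed.

Lemma fourier_projQ f k : intg f -> k != 1%N -> k != K ->
  fourier (projQ K f) k = fourier f k.
Proof.
move=> fi /negbTE k1 /negbTE kK; rewrite (funext (projQE f)) fourierD//.
  by rewrite fourier_cos_comb k1 kK !mulr0 !addr0.
exact: intg_cos_comb.
Qed.

Lemma fourier_ae0 f k : intg f ->
  {ae @lebesgue_measure R, forall x, torus x -> f x = 0} -> fourier f k = 0.
Proof.
move=> fi ae0; rewrite fourierE (_ : tint _ = 0) ?mulr0//.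
have fci := intg_mul_cos k fi.
rewrite /tint /Rintegral (ae_eq_integral (fun=> 0%E))//.
- by rewrite integral0.
- exact: measurable_torus.
- exact: measurable_int fci.
- case: ae0 => N [mN N0 sN]; exists N; split => // x /= nh; apply: sN => /= h.
  by apply: nh => tx; rewrite h// mul0r.
Qed.

Lemma H_null_perp v : null_perp K v -> H_per_even 4 v.
Proof. by case. Qed.

Lemma fourier_null_perp v k : null_perp K v -> (k == 1%N) || (k == K) ->
  fourier v k = 0.
Proof.
move=> [_ h1 hk] /orP[/eqP ->|/eqP ->]; rewrite fourierE.
  rewrite (@eq_tint _ _ (fun x => v x * cos x)); last by move=> x; rewrite mul1r.
  by rewrite /tint h1 mulr0.
by rewrite /tint hk mulr0.
Qed.

Definition phi (a b : R) x : R := a * cos x + b * cos (K%:R * x).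

Lemma continuous_phi a b : continuous (phi a b).
Proof.
move=> x; apply: cvgD; apply: cvgM; try exact: cvg_cst; first exact: continuous_cos.
exact: continuous_cos_nat.
Qed.

Lemma norm_phi_le a b x : `|phi a b x| <= `|a| + `|b|.
Proof.
by apply: le_trans (ler_normD _ _) _; apply: lerD; rewrite normrM ler_piMr// cos_max.
Qed.

Lemma measurable_phiD a b v : H_per_even 4 v ->
  measurable_fun setT (fun x => phi a b x + v x).
Proof.
move=> Hv; apply: measurable_realfun.measurable_funD; last exact: measurable_H4.
exact (measurable_realfun.continuous_measurable_fun (@continuous_phi a b)).
Qed.

Lemma norm_phiD_le a b v x : H_per_even 4 v ->
  `|phi a b x + v x| <= `|a| + `|b| + 2 * H_norm 4 v.
Proof.
move=> Hv; apply: le_trans (ler_normD _ _) _; apply: lerD; first exact: norm_phi_le.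
exact: norm_H4_le.
Qed.

Lemma intg_phi_sqr a b v : H_per_even 4 v -> intg (fun x => (phi a b x + v x) ^+ 2).
Proof.
move=> Hv; apply: (@intg_sqr (fun x => phi a b x + v x)).
  exact: measurable_phiD.
by move=> x; exact: norm_phiD_le.
Qed.

(** Off the resonant modes the projection does not change Fourier coefficients, and weak derivatives
    act as multipliers, so the equation becomes an algebraic relation for each k. *)
Lemma aux_mode a b c v k : null_perp K v -> auxiliary_equation K a b c v ->
  k != 1%N -> k != K ->
  (c + lam k) * fourier v k + fourier (fun x => (phi a b x + v x) ^+ 2) k = 0.
Proof.
move=> np [v2 [v4 [L2 L4 w2 w4 ae0]]] k1 kK; have Hv := H_null_perp np.
have iv := intg_H4 Hv; have i2 := intg_L2 L2; have i4 := intg_L2 L4.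
pose f1 y := vel0 K * v y + (v2 y + beta K * v4 y).
have if1 : intg f1.
  by apply: intgD; [exact: intgZ|apply: intgD => //; exact: intgZ].
have if2 := intg_phi_sqr a b Hv.
have := @fourier_ae0 (fun x => c * v x + projQ K f1 x +
   projQ K (fun x => (phi a b x + v x) ^+ 2) x) k _ ae0.
have iq1 := intg_projQ if1; have iq2 := intg_projQ if2.
have ic := intgZ c iv.
rewrite fourierD//; last exact: intgD.
rewrite fourierD// !fourier_projQ// fourierZ//.
move=> /(_ (intgD (intgD ic iq1) iq2)) <-; congr (_ + _).
rewrite /f1 fourierD//; [|exact: intgZ|by apply: intgD => //; exact: intgZ].
rewrite fourierD//; last exact: intgZ.
rewrite !fourierZ// (fourier_weak2 _ w2 iv) (fourier_weak4 _ w4 iv) -lamE.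
ring.
Qed.

(** Since (k+1)(k+2) >= 2, a shift by at most beta/4 costs no more than half of the lower bound. *)
Lemma lam_shift_lower k c : k != 1%N -> k != K -> `|c| <= beta K / 4 ->
  beta K / 8 * (k.+1%:R * k.+2%:R) <= `|c + lam k|.
Proof.
move=> k1 kK hc; have h := lam_lower k1 kK.
have b0 := beta_gt0.
have h2 : (2 : R) <= k.+1%:R * k.+2%:R.
  by rewrite -natrM ler_nat; case: (k) => // j; rewrite !mulnS; lia.
have h3 : `|lam k| <= `|c| + `|c + lam k|.
  have := ler_normB (c + lam k) c; rewrite (_ : c + lam k - c = lam k); last by ring.
  by rewrite addrC.
have h4 := ler_wpM2l (ltW b0) h2.
move: (k.+1%:R * k.+2%:R : R) h h2 h4 => x h h2 h4; lra.
Qed.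

(** The difference [w] of two solutions contracts in the supremum norm: its modes are those of a
    difference of squares divided by the shifted symbol, and their telescoping majorant sums to half
    the previous bound. Iterating gives zero. *)
Lemma aux_unique : exists2 d : R, 0 < d & forall a b c v v',
  `|a| <= d -> `|b| <= d -> `|c| <= d -> null_perp K v -> null_perp K v' ->
  H_norm 4 v <= d -> H_norm 4 v' <= d ->
  auxiliary_equation K a b c v -> auxiliary_equation K a b c v' -> v =1 v'.
Proof.
have b0 := beta_gt0.
have b1 : beta K <= 1 :> R.
  by rewrite /beta invf_le1 ?ltr_wpDr ?sqr_ge0// lerDl sqr_ge0.
(* The radius is beta / 512. Each [phi + v] is at most 4 d, so the difference of squares is at most
   8 d S; the Fourier normalization doubles this, division by the symbol costs 8 / beta, and
   summation leaves at most S / 2. *)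
have [d d0 dE] : exists2 d : R, 0 < d & beta K = 8 * (8 * (8 * d)).
  by exists (beta K / 8 / 8 / 8); [rewrite !divr_gt0|field].
exists d => // a b c v v' ha hb hc np np' nv nv' aux aux'.
have Hv := H_null_perp np; have Hv' := H_null_perp np'.
pose w x := v x + -1 * v' x.
have iv := intg_H4 Hv; have iv' := intg_H4 Hv'.
have iw : intg w by apply: intgD => //; exact: intgZ.
have fw k : fourier w k = fourier v k + -1 * fourier v' k.
  by rewrite fourierD ?fourierZ//; exact: intgZ.
have cd : `|c| <= beta K / 4 by apply: le_trans hc _; rewrite dE; clear -d0; lra.
have step S : (forall x, `|w x| <= S) -> forall x, `|w x| <= S / 2.
  move=> wS.
  have S0 : 0 <= S by apply: le_trans (wS 0).
  have hk k : `|fourier w k| <= S / 4 * (2 / (k.+1%:R * k.+2%:R)).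
    have p0 : 0 < k.+1%:R * k.+2%:R :> R by rewrite mulr_gt0// ltr0n.
    have [kk|] := boolP ((k == 1%N) || (k == K)).
      rewrite fw !fourier_null_perp// mulr0 addr0 normr0.
      by rewrite mulr_ge0 ?divr_ge0// ltW.
    rewrite negb_or => /andP[k1 kK].
    have m1 := aux_mode np aux k1 kK; have m2 := aux_mode np' aux' k1 kK.
    pose q x := (phi a b x + v x) ^+ 2 + -1 * (phi a b x + v' x) ^+ 2.
    have i1 := intg_phi_sqr a b Hv; have i2 := intg_phi_sqr a b Hv'.
    have fq : fourier q k = - ((c + lam k) * fourier w k).
      rewrite fourierD//; last exact: intgZ.
      by rewrite fourierZ// fw; clear -m1 m2; lra.
    have iq : intg q by apply: intgD => //; exact: intgZ.
    have qle x : torus x -> `|q x| <= 8 * d * S.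
      move=> _; rewrite (_ : q x = (phi a b x + v x + (phi a b x + v' x)) * w x); last first.
        by rewrite /q /w; ring.
      rewrite normrM; apply: ler_pM => //.
      have h1 := norm_phiD_le a b x Hv; have h2 := norm_phiD_le a b x Hv'.
      apply: le_trans (ler_normD _ _) _.
      move: (H_norm 4 v) (H_norm 4 v') `|a| `|b| ha hb nv nv' h1 h2 => N N' A B.
      by clear; lra.
    have := norm_fourier_le k iq qle; rewrite fq normrN normrM => h.
    have l := lam_shift_lower k1 kK cd.
    rewrite mulrA ler_pdivlMr//.
    have w0 : 0 <= `|fourier w k| by [].
    have h4 := ler_wpM2r w0 l.
    have h5 := le_trans h4 h.
    rewrite -(ler_pM2l (divr_gt0 b0 (ltr0n _ 8))).
    have dS : 0 <= d * S by rewrite mulr_ge0// ltW.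
    by move: h5; rewrite dE; clear -dS; move: (k.+1%:R * k.+2%:R : R) `|fourier w k| => p u; lra.
  move=> x; have bw : abs_bounded (fourier w) (S / 4 * 2).
    rewrite -[S / 4]ger0_norm; last by rewrite divr_ge0.
    by apply: abs_bounded_le (abs_boundedZ (S / 4) telescoping_bounded) => k.
  have -> : S / 2 = S / 4 * 2 by field.
  have -> : w x = cos_series (fourier w) x; last exact: norm_cser_le.
  have bv := cser_abs_bounded 0 x (fourier_H4_bounded Hv).
  have bv' := cser_abs_bounded 0 x (fourier_H4_bounded Hv').
  rewrite /w (H4_cos_series x Hv) (H4_cos_series x Hv') /cos_series /cser.
  rewrite -(tsumZ _ bv') -(tsumD bv (abs_boundedZ (-1) bv')).
  by apply: tsum_ext => k; rewrite fw; ring.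
have w1 x : `|w x| <= 4 * d.
  have h1 := norm_H4_le x Hv; have h2 := norm_H4_le x Hv'.
  apply: le_trans (ler_normD _ _) _; rewrite mulN1r normrN.
  by move: (H_norm 4 v) (H_norm 4 v') nv nv' h1 h2 => N N'; clear; lra.
have wn n x : `|w x| <= 4 * d / 2 ^+ n.
  elim: n x => [|n IH] x; first by rewrite expr0 divr1.
  by apply: le_trans (step _ IH x) _; rewrite exprSr invfM mulrA.
move=> x; apply/eqP; rewrite -subr_eq0 -normr_le0.
have -> : v x - v' x = w x by rewrite /w mulN1r.
have cv : (fun n => 4 * d / 2 ^+ n) @ \oo --> 4 * d * (0 : R).
  apply: cvgM; first exact: cvg_cst.
  rewrite (_ : (fun n => _) = fun n => (2^-1) ^+ n); last first.
    by apply/funext => n; rewrite exprVn.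
  by apply: cvg_expr; rewrite gtr0_norm ?invr_gt0 ?ltr0n// invf_lt1 ?ltr0n// ltr1n.
rewrite mulr0 in cv; rewrite -(cvg_lim _ cv)//.
by apply: limr_ge; [apply/cvg_ex; eexists; exact: cv|apply: nearW => n; exact: wn].
Qed.

(** A converse to the mode relations: a residual spanned by cos(x) and cos(Kx) is exactly what the
    projection removes, whatever the coefficients [m1] and [mK] are. *)
Lemma aux_of_identity a b c (m1 mK : R) (w : nat -> R) : rapid w ->
  w 1%N = 0 -> w K = 0 ->
  (forall x, c * cos_series w x + cos_series (fun k => lam k * w k) x +
     (phi a b x + cos_series w x) ^+ 2 = m1 * cos x + mK * cos (K%:R * x)) ->
  null_perp K (cos_series w) /\ auxiliary_equation K a b c (cos_series w).
Proof.
move=> rw w1 wK idt; set v := cos_series w.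
have Hv : H_per_even 4 v by exact: H_per_even_cos_series.
have p0 k : fnorm k != 0 :> R by rewrite gt_eqF// fnorm_gt0.
have K1 : (1%N == K) = false by lia.
split.
  split => //.
    have := fourier_cos_series 1 rw; rewrite w1 fourierE => /eqP.
    rewrite mulf_eq0 (negbTE (p0 _))/= => /eqP; rewrite /tint => <-.
    by congr Rintegral; apply/funext => x; rewrite mul1r.
  have := fourier_cos_series K rw; rewrite wK fourierE => /eqP.
  by rewrite mulf_eq0 (negbTE (p0 _))/= => /eqP.
have r2 : rapid (fun k => - k%:R ^+ 2 * w k).
  by under eq_fun do rewrite mulNr -mulN1r; apply: rapidZ; exact: rapidM.
have r4 : rapid (fun k => k%:R ^+ 4 * w k) by exact: rapidM.
exists (derive1n 2 v), (derive1n 4 v); split.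
- by rewrite cos_series_derive2//; exact: L2_cos_series.
- by rewrite cos_series_derive4//; exact: L2_cos_series.
- exact: weak_derivative_cos_series.
- exact: weak_derivative_cos_series.
apply: aeW => x _.
pose f1 y := vel0 K * v y + (derive1n 2 v y + beta K * derive1n 4 v y).
pose f2 y := (phi a b y + v y) ^+ 2.
have iv : intg v by exact: intg_cos_series.
have if1 : intg f1.
  apply: intgD; first exact: intgZ.
  apply: intgD; first by rewrite cos_series_derive2//; exact: intg_cos_series.
  by apply: intgZ; rewrite cos_series_derive4//; exact: intg_cos_series.
have if2 : intg f2 by exact: intg_phi_sqr.
have f1E y : f1 y = cos_series (fun k => lam k * w k) y.
  rewrite /f1 cos_series_derive2// cos_series_derive4// /v.
  rewrite -!cos_seriesZ// -!cos_seriesD//.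
  - by congr cos_series; apply/funext => k; rewrite -lamE; ring.
  - exact: rapidZ.
  - exact: rapidD r2 (rapidZ _ r4).
  - exact: rapidZ.
have sumE y : f1 y + f2 y = (m1 * cos (1%:R * y) + mK * cos (K%:R * y)) + - c * v y.
  by rewrite f1E /f2 mul1r -idt /v; ring.
have f12 k : fourier f1 k + fourier f2 k =
    m1 * (k == 1%N)%:R + mK * (k == K)%:R - c * w k.
  rewrite -fourierD// (funext sumE) fourierD.
  - by rewrite fourier_cos_comb fourierZ// fourier_cos_series// mulNr.
  - exact: intg_cos_comb.
  - exact: intgZ.
have e1 : fourier f1 1 + fourier f2 1 = m1.
  by rewrite f12 w1 K1 eqxx !mulr0 mulr1 addr0 subr0.
have eK : fourier f1 K + fourier f2 K = mK.
  by rewrite f12 wK eqxx eq_sym K1 !mulr0 mulr1 add0r subr0.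
have := sumE x; rewrite mul1r => h.
suff : c * v x + projQ K f1 x + projQ K f2 x = 0 by [].
rewrite !projQE mul1r.
rewrite [LHS](_ : _ = (f1 x + f2 x) + c * v x -
  ((fourier f1 1 + fourier f2 1) * cos x + (fourier f1 K + fourier f2 K) * cos (K%:R * x))); last by ring.
by rewrite h e1 eK; ring.
Qed.

End Auxiliary.

(** * Series of parameter monomials times cosines *)

Section ModeSums.
Context {R : realType} (M : Type).
Variables (om : M -> R) (Z : nat -> @fsum R (M * nat)) (S : R).
Implicit Types (e : M -> R) (psi : nat -> R).

(* The pair (m, k) stands for a parameter monomial m times cos (k x). *)
Definition mweight (i : M * nat) : R := om i.1 * 2 ^+ i.2.

Hypothesis om0 : forall m, 0 <= om m.
Hypothesis ZS : abs_bounded (fun n => nrm mweight (Z n)) S.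

Lemma mweight_ge0 i : 0 <= mweight i.
Proof. by rewrite mulr_ge0// exprn_ge0. Qed.

Lemma mode_bound e psi C D i : 0 <= C -> `|e i.1| <= C * om i.1 ->
  `|psi i.2| <= D * 2 ^+ i.2 -> `|e i.1 * psi i.2| <= C * D * mweight i.
Proof.
move=> C0 eC pD; rewrite normrM.
apply: le_trans (ler_pM _ _ eC pD) _ => //.
by rewrite /mweight le_eqVlt; apply/orP; left; apply/eqP; ring.
Qed.

(** The amplitude of cos(kx) when monomial m takes the value [e m]. The values need not come from a
    parameter point: Taylor coefficients and remainders of monomials are also substituted for
    [e]. *)
Definition mcoef e k : R := levp Z (fun i => e i.1 * (i.2 == k)%:R).

(** The weighted norm of the series after substituting [e]; it is the constant in the geometric
    decay of all modes at once. *)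
Definition msize e : R := tsum (fun n => nrm (fun i => `|e i.1| * 2 ^+ i.2) (Z n)).

Lemma ind_le (k k' : nat) : `|(k' == k)%:R| <= 1 * 2 ^+ k' :> R.
Proof.
rewrite mul1r normr_nat; apply: (@le_trans _ _ 1); first by case: (_ == _).
by rewrite exprn_ege1//; lra.
Qed.

Lemma msize_term_bounded e C : 0 <= C -> (forall m, `|e m| <= C * om m) ->
  abs_bounded (fun n => nrm (fun i => `|e i.1| * 2 ^+ i.2) (Z n)) (C * S).
Proof.
move=> C0 eC; rewrite -(ger0_norm C0).
apply: abs_bounded_le (abs_boundedZ C ZS) => n.
rewrite ger0_norm -?nrmZw; last by apply: nrm_ge0 => i; rewrite mulr_ge0// exprn_ge0.
by apply: ler_nrm => i; rewrite mulrA ler_wpM2r// exprn_ge0.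
Qed.

Lemma msize_le e C : 0 <= C -> (forall m, `|e m| <= C * om m) -> msize e <= C * S.
Proof.
move=> C0 eC; apply: le_trans (ler_norm _) _; apply: norm_tsum_le.
exact: msize_term_bounded.
Qed.

Lemma mcoef_geom e C : 0 <= C -> (forall m, `|e m| <= C * om m) ->
  geom (mcoef e) (msize e).
Proof.
move=> C0 eC k; rewrite ler_pdivlMr ?exprn_gt0//.
have b1 : abs_bounded (fun n => ev (fun i => e i.1 * (i.2 == k)%:R) (Z n)) (C * 1 * S).
  apply: (lev_abs_bounded ZS) => [|i]; first by rewrite mulr1.
  by apply: (@mode_bound e (fun k' => (k' == k)%:R)) => //; exact: ind_le.
have b2 := msize_term_bounded C0 eC.
have b3 := abs_boundedZ (2 ^+ k) b1.
rewrite mulrC -[2 ^+ k]ger0_norm ?exprn_ge0// -normrM -(tsumZ _ b1).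
have b4 : abs_bounded (fun n => `|2 ^+ k * ev (fun i => e i.1 * (i.2 == k)%:R) (Z n)|) (`|2 ^+ k| * (C * 1 * S)).
  by apply: abs_bounded_le_norm b3 => n; rewrite normr_id.
apply: (@le_trans _ _ (tsum (fun n => `|2 ^+ k * ev (fun i => e i.1 * (i.2 == k)%:R) (Z n)|))).
  have := @lim_series_norm _ _ (fun n => 2 ^+ k * ev (fun i => e i.1 * (i.2 == k)%:R) (Z n)).
  by apply; exact: abs_bounded_cvg b4.
apply: (le_tsum b4 b2) => n.
rewrite -evZe -[leRHS]mul1r.
apply: (@norm_ev_le R (M * nat) (fun i => `|e i.1| * 2 ^+ i.2) _ 1) => i.
rewrite mul1r; have [->|_] := eqVneq i.2 k; last by rewrite !mulr0 normr0 mulr_ge0// exprn_ge0.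
by rewrite mulr1 normrM [leRHS]mulrC ger0_norm ?exprn_ge0.
Qed.

(** Dominated values that vanish in the limit at each monomial make the whole series small. Through
    [mcoef_geom] this gives convergence in every H^s. *)
Lemma cvg_msize0 (e : nat -> M -> R) C : 0 <= C ->
  (forall N m, `|e N m| <= C * om m) -> (forall m, e N m @[N --> \oo] --> (0 : R)) ->
  msize (e N) @[N --> \oo] --> (0 : R).
Proof.
move=> C0 eC e0.
have : (fun N => msize (e N)) @ \oo --> tsum (fun n => (0 : R)).
  apply: (@cvg_tsum_dominated _ _ _ (fun n => C * nrm mweight (Z n)) (`|C| * S)).
  - exact: abs_boundedZ.
  - move=> N n; rewrite ger0_norm -?nrmZw; last by apply: nrm_ge0 => i; rewrite mulr_ge0// exprn_ge0.
    by apply: ler_nrm => i; rewrite mulrA ler_wpM2r// exprn_ge0.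
  - move=> n; elim: (Z n) => [|t s IH].
      rewrite (_ : (fun N => _) = fun=> 0); first exact: cvg_cst.
      by apply/funext => N; rewrite nrm_nil.
    rewrite (_ : (fun N => _) = (fun N => `|t.1| * (`|e N t.2.1| * 2 ^+ t.2.2)) \+
       (fun N => nrm (fun i => `|e N i.1| * 2 ^+ i.2) s)); last first.
      by apply/funext => N; rewrite nrm_cons.
    rewrite -(addr0 0); apply: cvgD => //.
    rewrite -(mulr0 `|t.1|); apply: cvgM; first exact: cvg_cst.
    rewrite -(mul0r (2 ^+ t.2.2)); apply: cvgM; last exact: cvg_cst.
    by rewrite -(normr0 R); apply: cvg_norm.
by rewrite (@tsum_finite _ _ 0) ?big_ord0.
Qed.

(** Exchange of the sum over trees with the sum over modes: truncating [psi] at mode N gives the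
    partial sums, and dominated convergence removes the truncation. *)
Lemma mcoef_tsum e psi C D : 0 <= C -> (forall m, `|e m| <= C * om m) ->
  0 <= D -> (forall k, `|psi k| <= D * 2 ^+ k) ->
  levp Z (fun i => e i.1 * psi i.2) = tsum (fun k => mcoef e k * psi k).
Proof.
move=> C0 eC D0 pD; symmetry; apply: cvg_tsum_eq.
pose eN N (i : M * nat) := e i.1 * (psi i.2 * (i.2 < N)%:R).
have -> : series (fun k => mcoef e k * psi k) = fun N => levp Z (eN N).
  apply/funext => N; rewrite /series/= big_mkord.
  have b k i : `|e i.1 * (i.2 == k)%:R| <= C * 1 * mweight i.
    by apply: (@mode_bound e (fun k' => (k' == k)%:R)) => //; exact: ind_le.
  have -> : levp Z (eN N) = levp Z (fun i => \sum_(k < N) psi k * (e i.1 * (i.2 == k)%:R)).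
    apply: eq_lev => i; rewrite /eN.
    have [iN|Ni] := ltnP i.2 N.
      rewrite (bigD1 (Ordinal iN))//= eqxx big1 => [|j]; first by rewrite !mulr1 addr0 mulrC.
      by rewrite -val_eqE/= eq_sym => /negbTE ->; rewrite !mulr0.
    rewrite big1 => [|j _]; first by rewrite !mulr0.
    by rewrite gtn_eqF ?mulr0// (leq_trans (ltn_ord j)).
  rewrite (@lev_sum _ _ mweight _ S ZS N (fun k => `|psi k| * (C * 1))
    (fun k i => psi k * (e i.1 * (i.2 == k)%:R))).
  - apply: eq_bigr => k _; rewrite (@levZ _ _ mweight _ S ZS _ (C * 1)) ?mulr1//.
      by rewrite mulrC.
    by move=> i; have := b k i; rewrite mulr1.
  - by move=> j; rewrite mulr1 mulr_ge0.
  - by move=> j i; rewrite normrM -mulrA ler_wpM2l.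
apply: (@cvg_lev _ _ mweight _ S ZS (C * D)); first by rewrite mulr_ge0.
  move=> N i; rewrite /eN; apply: (@mode_bound e (fun k => psi k * (k < N)%:R)) => //.
  apply: le_trans (pD i.2); rewrite normrM ler_piMr// normr_nat.
  by case: (_ < _)%N.
move=> i; apply: cvg_near_cst; near=> N.
have iN : (i.2 < N)%N by near: N; exists i.2.+1.
by rewrite /eN iN mulr1.
Unshelve. all: by end_near. Qed.

(** The multiplier [d] may grow like 2^k, which leaves room for the quartic symbol. *)
Lemma mcoef_cos_series e d x C D : 0 <= C -> (forall m, `|e m| <= C * om m) ->
  0 <= D -> (forall k, `|d k| <= D * 2 ^+ k) ->
  levp Z (fun i => e i.1 * (d i.2 * cos (i.2%:R * x))) =
  cos_series (fun k => d k * mcoef e k) x.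
Proof.
move=> C0 eC D0 dD.
rewrite (@mcoef_tsum e (fun k => d k * cos (k%:R * x)) C D) => //.
  by rewrite cos_seriesE; apply: tsum_ext => k; ring.
by move=> k; apply: le_trans (dD k); rewrite normrM ler_piMr// cos_max.
Qed.

Lemma mcoef_rapid e C : 0 <= C -> (forall m, `|e m| <= C * om m) -> rapid (mcoef e).
Proof. by move=> C0 eC; exact: geom_rapid (mcoef_geom C0 eC). Qed.

End ModeSums.

(** * Products of cosines in the weighted norm *)

Section ModeProduct.
Context {R : realType} (M : Type) (addm : M -> M -> M) (om : M -> R).
Hypothesis om0 : forall m, 0 <= om m.
Hypothesis omM : forall m m', om (addm m m') = om m * om m'.

(** The formula for cos(px) cos(qx) as a sum of two cosines. Both frequencies are at most p + q and
    the halves add up to 1, so the product has norm constant 1. *)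
Definition mprod (i j : M * nat) : @fsum R (M * nat) :=
  [:: (2^-1, (addm i.1 j.1, (i.2 + j.2)%N)); (2^-1, (addm i.1 j.1, distn' i.2 j.2))].

Lemma distn_le p q : (distn' p q <= p + q)%N.
Proof. by rewrite /distn'; lia. Qed.

Lemma nrm_mprod i j : nrm (mweight om) (mprod i j) <= 1 * (mweight om i * mweight om j).
Proof.
rewrite /mprod !nrm_cons nrm_nil addr0 /mweight/= omM mul1r.
rewrite [`|_|]gtr0_norm ?invr_gt0//.
have h : 2 ^+ distn' i.2 j.2 <= 2 ^+ (i.2 + j.2) :> R.
  by rewrite ler_eXn2l ?distn_le//; lra.
rewrite [leRHS](_ : _ = om i.1 * om j.1 * 2 ^+ (i.2 + j.2)); last by rewrite exprD; ring.
have := ler_wpM2l (mulr_ge0 (om0 i.1) (om0 j.1)) h.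
by move: (om i.1 * om j.1 * 2 ^+ (i.2 + j.2)) => A; lra.
Qed.

Lemma ev_mprod (e : M -> R) x i j : (forall m m', e (addm m m') = e m * e m') ->
  ev (fun i => e i.1 * cos (i.2%:R * x)) (mprod i j) =
  (e i.1 * cos (i.2%:R * x)) * (e j.1 * cos (j.2%:R * x)).
Proof.
move=> eM; rewrite /mprod !ev_cons ev_nil addr0/= eM.
rewrite [RHS](_ : _ = e i.1 * e j.1 * (cos (i.2%:R * x) * cos (j.2%:R * x))); last by ring.
by rewrite cosM; ring.
Qed.

End ModeProduct.

(** * Construction of the small solution of the auxiliary equation *)

Section SmallSolution.
Context {R : realType} (K : nat).
Hypothesis hK : (2 <= K)%N.
Implicit Types (a b c r x : R).
Local Notation lam := (@lam R K).

Definition multidx := (nat * nat * nat)%type.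

Definition maddn (m m' : multidx) : multidx :=
  (m.1.1 + m'.1.1, m.1.2 + m'.1.2, m.2 + m'.2)%N.

Definition mwt r (m : multidx) : R := r ^+ (m.1.1 + m.1.2 + m.2).

Definition mono a b c (m : multidx) : R := a ^+ m.1.1 * b ^+ m.1.2 * c ^+ m.2.

Lemma mwt_add r m m' : mwt r (maddn m m') = mwt r m * mwt r m'.
Proof. by rewrite /mwt -exprD; congr (_ ^+ _); rewrite /=; lia. Qed.

Lemma mono_add a b c m m' : mono a b c (maddn m m') = mono a b c m * mono a b c m'.
Proof. by rewrite /mono/= !exprD; ring. Qed.

Lemma mwt_ge0 r m : 0 <= r -> 0 <= mwt r m.
Proof. exact: exprn_ge0. Qed.

Lemma norm_mono_le a b c r m : `|a| <= r -> `|b| <= r -> `|c| <= r ->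
  `|mono a b c m| <= 1 * mwt r m.
Proof.
move=> ar br cr; rewrite mul1r /mono /mwt !normrM !normrX !exprD.
have r0 : 0 <= r by apply: le_trans ar.
by apply: ler_pM => //; try apply: ler_pM => //; rewrite ?mulr_ge0// lerXn2r// nnegrE.
Qed.

Definition active (k : nat) := (k != 1%N) && (k != K).

(* The coefficients with index 1 and K are not part of the solution: they record
   the components of the equation that are removed by the projection Q. *)
Definition lamx k : R := if active k then lam k else 1.

Lemma lamx_neq0 k : lamx k != 0.
Proof.
rewrite /lamx; case: ifP => [/andP[k1 kK]|_]; last exact: oner_neq0.
rewrite -normr_gt0; apply: lt_le_trans (lam_lower k1 kK).
by rewrite !mulr_gt0 ?invr_gt0 ?ltr0n// beta_gt0.
Qed.

Lemma beta_le1 : beta K <= 1 :> R.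
Proof. by rewrite /beta invf_le1 ?ltr_wpDr ?sqr_ge0// lerDl sqr_ge0. Qed.

Lemma norm_lamx_inv k : `|(lamx k)^-1| <= 2 / beta K.
Proof.
have b0 := beta_gt0 (R := R) K; have b1 := beta_le1.
rewrite normfV; suff h : beta K / 2 <= `|lamx k|.
  have h0 : 0 < beta K / 2 :> R by rewrite divr_gt0.
  rewrite (_ : 2 / beta K = (beta K / 2)^-1); last by rewrite invf_div.
  by rewrite lef_pV2// posrE// (lt_le_trans h0).
rewrite /lamx; case: ifP => [/andP[k1 kK]|_]; last by rewrite normr1; lra.
apply: le_trans (lam_lower k1 kK).
have h2 : (2 : R) <= k.+1%:R * k.+2%:R.
  by rewrite -natrM ler_nat; case: (k) => // j; rewrite !mulnS; lia.
have := ler_wpM2l (ltW b0) h2.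
by move: (k.+1%:R * k.+2%:R : R) => y; lra.
Qed.

(** The dependence on K cancels, because beta (1 + K^2) = 1. *)
Lemma norm_lam_le k : `|lam k| <= (1 + k%:R) ^+ 4.
Proof.
rewrite /lam normrM gtr0_norm ?beta_gt0// normrM.
have k0 : 0 <= k%:R :> R by exact: ler0n.
have K0 : 0 <= K%:R ^+ 2 :> R by exact: sqr_ge0.
have kk : 0 <= k%:R ^+ 2 :> R by exact: sqr_ge0.
have h1 : `|k%:R ^+ 2 - 1 : R| <= (1 + k%:R) ^+ 2.
  by rewrite ler_norml; apply/andP; split; nra.
have h2 : `|k%:R ^+ 2 - K%:R ^+ 2 : R| <= (1 + K%:R ^+ 2) * (1 + k%:R) ^+ 2.
  by rewrite ler_norml; apply/andP; split; nra.
have := ler_pM (normr_ge0 _) (normr_ge0 _) h1 h2.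
move/(ler_wpM2l (ltW (beta_gt0 K))) => h; apply: le_trans h _.
have hb : 1 + K%:R ^+ 2 != 0 :> R by rewrite gt_eqF// ltr_wpDr.
by rewrite le_eqVlt; apply/orP; left; apply/eqP; rewrite /beta; field.
Qed.

Lemma lamx_bound : exists2 D : R, 0 <= D & forall k, `|lamx k| <= D * 2 ^+ k.
Proof.
have [D D0 hD] := @poly_le_exp R 4 2 (ltr1n _ _).
exists D; first exact: ltW.
move=> k; rewrite /lamx; case: ifP => _; first by apply: le_trans (norm_lam_le k) (hD k).
rewrite normr1; apply: le_trans (hD k).
by rewrite exprn_ege1// lerDl ler0n.
Qed.

Definition scaleinv (i : multidx * nat) : @fsum R (multidx * nat) :=
  [:: (- (lamx i.2)^-1, i)].

Definition philist : @fsum R (multidx * nat) :=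
  [:: (1, ((1%N, 0%N, 0%N), 1%N)); (1, ((0%N, 1%N, 0%N), K))].

Definition cmono : multidx := (0%N, 0%N, 1%N).

Definition mprod3 := mprod (R := R) maddn.

(** The auxiliary equation solved for its linear part: v is minus the inverse symbol applied to
    phi^2 + (c + 2 phi) v + v^2. The linear and quadratic parts vanish on modes 1 and K, so the
    projected components are recorded there without feeding back. *)
Definition ur_g := lin scaleinv (bil mprod3 philist philist).

Definition ur_l (i : multidx * nat) :=
  if active i.2 then lin scaleinv ((1, (maddn cmono i.1, i.2)) ::
    bil mprod3 philist [:: (1, i)] ++ bil mprod3 [:: (1, i)] philist) else [::].

Definition ur_B (i j : multidx * nat) :=
  if active i.2 && active j.2 then lin scaleinv (mprod3 i j) else [::].

Definition ur_Z := qsol ur_g ur_l ur_B.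

Local Notation W r := (mweight (mwt r)).

Definition cst_C : R := 2 / beta K.
Definition cst_P : R := 2 + 2 ^+ K.

Lemma cst_C0 : 0 <= cst_C.
Proof. by rewrite divr_ge0// ltW// beta_gt0. Qed.

Lemma cst_P0 : 0 <= cst_P.
Proof. by rewrite addr_ge0// exprn_ge0. Qed.

(** At radius r the linear part has norm at most r times this: 1 comes from multiplication by c, the
    rest from the two products with phi. *)
Definition cst_Q : R := cst_C * (1 + 2 * cst_P).

Definition ur_S r : R := 2 * (cst_C * (r ^+ 2 * cst_P ^+ 2)).

Section FixedRadius.
Variable r : R.
Hypothesis r0 : 0 <= r.
Hypothesis rsmall : 8 * (r * cst_Q) <= 1.

Lemma W_ge0 i : 0 <= W r i.
Proof. by apply: mweight_ge0 => m; exact: mwt_ge0. Qed.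

Lemma nrm_scaleinv s : nrm (W r) (lin scaleinv s) <= cst_C * nrm (W r) s.
Proof.
rewrite nrm_lin -nrmZw; apply: ler_nrm => i.
rewrite nrm_cons nrm_nil addr0 normrN/=.
by rewrite ler_wpM2r ?W_ge0// norm_lamx_inv.
Qed.

Lemma nrm_philist : nrm (W r) philist = r * cst_P.
Proof.
rewrite /philist !nrm_cons nrm_nil /mweight /mwt/= normr1 /cst_P.
by rewrite !add0n !addn0 !expr1; ring.
Qed.

Lemma nrm_mprod3 s s' :
  nrm (W r) (bil mprod3 s s') <= nrm (W r) s * nrm (W r) s'.
Proof.
rewrite -[leRHS]mul1r; apply: nrm_bil => i j.
apply: nrm_mprod; first by move=> m; exact: mwt_ge0.
by move=> m m'; exact: mwt_add.
Qed.

Lemma nrm_single i : nrm (W r) [:: (1, i)] = W r i.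
Proof. by rewrite nrm_cons nrm_nil addr0 normr1 mul1r. Qed.

Lemma nrm_ur_g : nrm (W r) ur_g <= cst_C * (r ^+ 2 * cst_P ^+ 2).
Proof.
apply: le_trans (nrm_scaleinv _) _; rewrite ler_wpM2l ?cst_C0//.
by apply: le_trans (nrm_mprod3 _ _) _; rewrite nrm_philist -expr2 exprMn.
Qed.

Lemma nrm_ur_l i : nrm (W r) (ur_l i) <= 4^-1 * W r i.
Proof.
have w0 := W_ge0 i; rewrite /ur_l; case: ifP => _; last by rewrite nrm_nil mulr_ge0.
apply: le_trans (nrm_scaleinv _) _.
rewrite nrm_cons nrm_cat normr1 mul1r.
have h1 := nrm_mprod3 philist [:: (1, i)]; have h2 := nrm_mprod3 [:: (1, i)] philist.
rewrite nrm_single nrm_philist in h1; rewrite nrm_single nrm_philist in h2.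
have -> : W r (maddn cmono i.1, i.2) = r * W r i.
  by rewrite /mweight/= mwt_add /mwt/= !add0n expr1; ring.
have C0 := cst_C0.
apply: (@le_trans _ _ ((r * cst_Q) * W r i)).
  rewrite /cst_Q [leRHS](_ : _ = cst_C * (r * W r i + (r * cst_P * W r i + W r i * (r * cst_P)))); last by ring.
  by rewrite ler_wpM2l// lerD2l lerD.
by rewrite ler_wpM2r//; move: rsmall; move: (r * cst_Q) => y; lra.
Qed.

Lemma nrm_ur_B i j : nrm (W r) (ur_B i j) <= cst_C * (W r i * W r j).
Proof.
rewrite /ur_B; case: ifP => _; last first.
  by rewrite nrm_nil mulr_ge0 ?cst_C0// mulr_ge0// W_ge0.
apply: le_trans (nrm_scaleinv _) _; rewrite ler_wpM2l ?cst_C0//.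
rewrite -[leRHS]mul1r; apply: nrm_mprod; first by move=> m; exact: mwt_ge0.
by move=> m m'; exact: mwt_add.
Qed.

(** The one condition on r serves both purposes: it bounds r C P by 1/16, and the left side is 8 (r
    C P)^2. *)
Lemma ur_smallness : 8 * cst_C * (cst_C * (r ^+ 2 * cst_P ^+ 2)) <= 1.
Proof.
have h' : 0 <= r * cst_C := mulr_ge0 r0 cst_C0.
have h : 0 <= r * cst_C * cst_P := mulr_ge0 h' cst_P0.
rewrite [leLHS](_ : _ = 8 * (r * cst_C * cst_P) ^+ 2); last by ring.
move: rsmall; rewrite /cst_Q (_ : r * _ = r * cst_C + 2 * (r * cst_C * cst_P)); last by ring.
move: (r * cst_C * cst_P) h => y y0; move: (r * cst_C) h' => z z0 yz.
have y8 : y <= 16^-1 by lra.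
have y2 : y ^+ 2 <= y * 16^-1 by rewrite expr2 ler_wpM2l.
lra.
Qed.

Lemma ur_Z_bounded : abs_bounded (fun n => nrm (W r) (ur_Z n)) (ur_S r).
Proof.
exact: (qsol_bounded W_ge0 nrm_ur_g nrm_ur_l nrm_ur_B cst_C0 ur_smallness).
Qed.

Definition ur_coef a b c k : R :=
  if active k then mcoef ur_Z (mono a b c) k else 0.

Definition ur_sol a b c : R -> R := cos_series (ur_coef a b c).

Section AtPoint.
Variables a b c : R.
Hypothesis ar : `|a| <= r.
Hypothesis br : `|b| <= r.
Hypothesis cr : `|c| <= r.

Let mono_le m : `|mono a b c m| <= 1 * mwt r m.
Proof. exact: norm_mono_le. Qed.

Lemma ur_coef_geom : geom (ur_coef a b c) (ur_S r).
Proof.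
have S0 := abs_bounded_ge0 ur_Z_bounded.
move=> k; rewrite /ur_coef; case: ifP => _; last by rewrite normr0 divr_ge0// exprn_ge0.
have g := mcoef_geom ur_Z_bounded ler01 mono_le.
apply: le_trans (g k) _; rewrite ler_wpM2r ?invr_ge0 ?exprn_ge0//.
by rewrite -[leRHS]mul1r; apply: (msize_le ur_Z_bounded).
Qed.

Lemma ur_coef_rapid : rapid (ur_coef a b c).
Proof. exact: geom_rapid ur_coef_geom. Qed.

(** Three evaluations at x: [f0] of all modes, [fa] of the active ones, and [E] of the modes
    multiplied by [lamx]. The last undoes the inverse symbol, so the fixed-point equation read
    through [E] is the differential equation. *)
Let f0 x (i : multidx * nat) := mono a b c i.1 * cos (i.2%:R * x).

Let fa x (i : multidx * nat) :=
  mono a b c i.1 * ((active i.2)%:R * cos (i.2%:R * x)).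

Let E x (i : multidx * nat) := mono a b c i.1 * (lamx i.2 * cos (i.2%:R * x)).

Lemma ev_E_scaleinv x s : ev (E x) (lin scaleinv s) = - ev (f0 x) s.
Proof.
rewrite ev_lin -mulN1r -evZe; apply: eq_ev => i.
rewrite /scaleinv ev_cons ev_nil addr0 /E /f0/=.
by have := lamx_neq0 i.2 => h; field.
Qed.

Lemma ev_f0_mprod3 x s s' :
  ev (f0 x) (bil mprod3 s s') = ev (f0 x) s * ev (f0 x) s'.
Proof.
rewrite ev_bil mulrC -evZe; apply: eq_ev => i; rewrite mulrC -evZe.
by apply: eq_ev => j; apply: ev_mprod => m m'; exact: mono_add.
Qed.

Lemma ev_f0_philist x : ev (f0 x) philist = phi K a b x.
Proof.
by rewrite /philist !ev_cons ev_nil /f0 /mono/= /phi !expr0 !expr1 !mul1r !mulr1 addr0.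
Qed.

Lemma ev_single (e : multidx * nat -> R) i : ev e [:: (1, i)] = e i.
Proof. by rewrite ev_cons ev_nil addr0 mul1r. Qed.

Lemma ev_E_g x : ev (E x) ur_g = - phi K a b x ^+ 2.
Proof. by rewrite /ur_g ev_E_scaleinv ev_f0_mprod3 ev_f0_philist expr2. Qed.

Lemma ev_E_l x i : ev (E x) (ur_l i) = - (c + 2 * phi K a b x) * fa x i.
Proof.
rewrite /ur_l /fa; case: ifP => _; last by rewrite ev_nil mul0r !mulr0.
rewrite ev_E_scaleinv ev_cons ev_cat !ev_f0_mprod3 ev_f0_philist ev_single.
rewrite /f0/= mono_add [mono a b c cmono](_ : _ = c); first by rewrite !mul1r; ring.
by rewrite /mono/= !expr0 !mul1r expr1.
Qed.

Lemma ev_E_B x i j : ev (E x) (ur_B i j) = - fa x i * fa x j.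
Proof.
rewrite /ur_B /fa; case: (active i.2); last by rewrite /= ev_nil mul0r mulr0 oppr0 mul0r.
case: (active j.2); last by rewrite /= ev_nil mul0r !mulr0.
rewrite /= ev_E_scaleinv /mprod3 /f0 ev_mprod; first by rewrite !mul1r mulNr.
by move=> m m'; exact: mono_add.
Qed.

Lemma ur_sol_lev x : levp ur_Z (fa x) = ur_sol a b c x.
Proof.
rewrite /fa (@mcoef_cos_series _ _ _ _ _ ur_Z_bounded _ (fun k => (active k)%:R) x 1 1) => //.
  congr (cos_series _ x); apply/funext => k; rewrite /ur_coef.
  by case: (active k); rewrite ?mul1r ?mul0r.
move=> k; rewrite mul1r normr_nat.
by apply: (@le_trans _ _ 1); [case: (active k)|rewrite exprn_ege1// ler1n].
Qed.

(** [qsol_eq] with the functional [E]. On the left [lamx] equals 1 on modes 1 and K; these two modes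
    are moved to the right as the residual. *)
Lemma ur_sol_identity x :
  c * ur_sol a b c x + cos_series (fun k => lam k * ur_coef a b c k) x +
    (phi K a b x + ur_sol a b c x) ^+ 2 =
  - mcoef ur_Z (mono a b c) 1 * cos x +
  - mcoef ur_Z (mono a b c) K * cos (K%:R * x).
Proof.
have [D D0 hD] := lamx_bound.
have h1 k : `|(active k)%:R| <= 1 * 2 ^+ k :> R.
  rewrite mul1r normr_nat.
  by apply: (@le_trans _ _ 1); [case: (active k)|rewrite exprn_ege1// ler1n].
have faD i : `|fa x i| <= (D + 1) * W r i.
  apply: (@le_trans _ _ (1 * 1 * W r i)).
    apply: (@mode_bound _ _ _ _ (fun k => (active k)%:R * cos (k%:R * x))) => //.
    by apply: le_trans (h1 i.2); rewrite normrM ler_piMr// cos_max.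
  by rewrite ler_wpM2r ?W_ge0//; lra.
have ED i : `|E x i| <= (D + 1) * W r i.
  apply: (@le_trans _ _ (1 * D * W r i)).
    apply: (@mode_bound _ _ _ _ (fun k => lamx k * cos (k%:R * x))) => //.
    by apply: le_trans (hD i.2); rewrite normrM ler_piMr// cos_max.
  by rewrite ler_wpM2r ?W_ge0//; lra.
have D1 : 0 <= D + 1 by lra.
have NfaD i : `|- fa x i| <= (D + 1) * W r i by rewrite normrN.
have := qsol_eq W_ge0 nrm_ur_g nrm_ur_l nrm_ur_B cst_C0 ur_smallness D1 ED NfaD faD (ev_E_B x).
rewrite -/ur_Z ev_E_g.
have -> : levp ur_Z (fun i => ev (E x) (ur_l i)) = - (c + 2 * phi K a b x) * ur_sol a b c x.
  rewrite -ur_sol_lev -(levZ ur_Z_bounded _ D1 faD).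
  by apply: eq_lev => i; rewrite ev_E_l.
have -> : levp ur_Z (fun i => - fa x i) = - ur_sol a b c x.
  rewrite -ur_sol_lev -mulN1r -(levZ ur_Z_bounded _ D1 faD).
  by apply: eq_lev => i; rewrite mulN1r.
rewrite ur_sol_lev /E (@mcoef_cos_series _ _ _ _ _ ur_Z_bounded _ lamx x 1 D) //.
set v := ur_sol a b c x => idt.
have rl : rapid (fun k => lam k * ur_coef a b c k).
  have -> : (fun k => lam k * ur_coef a b c k) = fun k => vel0 K * ur_coef a b c k +
     (-1 * (k%:R ^+ 2 * ur_coef a b c k) + beta K * (k%:R ^+ 4 * ur_coef a b c k)).
    by apply/funext => k; rewrite -lamE; ring.
  have rc := ur_coef_rapid.
  by apply: rapidD; [exact: rapidZ|apply: rapidD; apply: rapidZ; exact: rapidM].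
have rd k : rapid (fun i => mcoef ur_Z (mono a b c) i * delta_seq k i).
  have -> : (fun i => mcoef ur_Z (mono a b c) i * delta_seq k i) =
      (fun i => mcoef ur_Z (mono a b c) k * delta_seq k i).
    by apply/funext => i; rewrite /delta_seq; have [->|_] := eqVneq i k; rewrite ?mulr0.
  by apply: rapidZ; exact: rapid_delta.
have : cos_series (fun k => lamx k * mcoef ur_Z (mono a b c) k) x =
  cos_series (fun k => lam k * ur_coef a b c k) x +
  (mcoef ur_Z (mono a b c) 1 * cos x + mcoef ur_Z (mono a b c) K * cos (K%:R * x)).
  rewrite -[cos x]/(cos x) cos1E -!cos_series_delta -!cos_seriesD//; last exact: rapidD.
  congr (cos_series _ x); apply/funext => k.
  rewrite /lamx /ur_coef /delta_seq /active.
  have [->|k1] := eqVneq k 1%N.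
    have -> : (1%N == K) = false by lia.
    by rewrite /= !mulr0 mulr1 mul1r add0r addr0.
  by have [->|kK] := eqVneq k K; rewrite /= ?mulr0 ?addr0 ?mulr1 ?mul1r ?add0r.
move=> h; rewrite h in idt; lra.
Qed.

End AtPoint.

End FixedRadius.

End SmallSolution.

(** * Taylor expansion of monomials at a shifted point *)

Section TaylorShift.
Context {R : realType}.
Implicit Types (a x s : R) (i p N : nat).

(* The coefficient of h^p in (x + h)^i. *)
Definition taylor_coef x i p : R := 'C(i, p)%:R * x ^+ (i - p).

Lemma taylor_coef_small x i p : (i < p)%N -> taylor_coef x i p = 0.
Proof. by move=> ip; rewrite /taylor_coef bin_small// mul0r. Qed.

Lemma taylor_sum x a i N : (i < N)%N ->
  \sum_(p < N) a ^+ p * taylor_coef x i p = (x + a) ^+ i.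
Proof.
move=> iN; rewrite exprDn -(big_mkord xpredT (fun p => a ^+ p * taylor_coef x i p)).
rewrite (@big_cat_nat _ _ _ i.+1)//= [X in _ + X]big_nat [X in _ + X]big1 ?addr0; last first.
  by move=> p /andP[ip _]; rewrite taylor_coef_small// mulr0.
rewrite big_mkord; apply: eq_bigr => p _.
by rewrite /taylor_coef -mulr_natr; ring.
Qed.

(** Every truncated expansion is dominated by the complete binomial sum with absolute values,
    uniformly in N; the added [i.+1] terms ensure completeness. *)
Lemma taylor_sum_norm_le x a i N :
  \sum_(p < N) `|a ^+ p * taylor_coef x i p| <= (`|x| + `|a|) ^+ i.
Proof.
rewrite -(@taylor_sum `|x| `|a| i (N + i.+1)) ?ltn_addl//.
rewrite big_split_ord/= -[leLHS]addr0; apply: lerD.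
  apply: ler_sum => p _; rewrite normrM /taylor_coef normrM normr_nat !normrX.
  exact: lexx.
by apply: sumr_ge0 => p _; rewrite /taylor_coef !mulr_ge0 ?exprn_ge0// ler0n.
Qed.

(** A Cauchy estimate: one nonnegative summand is below the whole binomial sum. *)
Lemma taylor_coef_le x s i p : 0 <= s -> s ^+ p * `|taylor_coef x i p| <= (`|x| + s) ^+ i.
Proof.
move=> s0; have := taylor_sum_norm_le x s i p.+1.
rewrite (ger0_norm s0); apply: le_trans.
rewrite big_ord_recr/= [`|s ^+ p * _|]normrM [`|s ^+ p|]ger0_norm ?exprn_ge0// lerDr.
by apply: sumr_ge0 => i' _; exact: normr_ge0.
Qed.

End TaylorShift.

(** * Regularity, analyticity and uniqueness of the small solution *)

Section SmallSolutionProperties.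
Context {R : realType} (K : nat).
Hypothesis hK : (2 <= K)%N.
Implicit Types (a b c x : R) (e : multidx -> R).
Local Notation Z := (@ur_Z R K).

Lemma H_norm_geom s : exists2 C : R, 0 <= C &
  forall (c : nat -> R) M, geom c M -> H_norm s (cos_series c) <= C * M.
Proof.
have [C C0 bC] := @poly_geom_bounded R s; exists C => // c M gc.
rewrite mulrC; apply: H_norm_cos_series_le; first exact: geom_rapid gc.
exact: geom_moment.
Qed.

Section FixedRadius.
Variable r : R.
Hypothesis r0 : 0 < r.
Hypothesis rsmall : 8 * (r * cst_Q K) <= 1.

Let om0 m : 0 <= mwt r m. Proof. by apply: mwt_ge0; exact: ltW. Qed.
Let ZS := ur_Z_bounded hK (ltW r0) rsmall.

(** As in [ur_sol], but with arbitrary values of the monomials. The solution, its Taylor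
    coefficients, the partial sums and the remainders are then instances of one linear construction
    [usol]. *)
Definition ucoef e k : R := if active K k then mcoef Z e k else 0.

Definition usol e : R -> R := cos_series (ucoef e).

Definition acos x k : R := (active K k)%:R * cos (k%:R * x).

Lemma active_le k : `|(active K k)%:R| <= 1 * 2 ^+ k :> R.
Proof.
rewrite mul1r normr_nat.
by apply: (@le_trans _ _ 1); [case: (active K k)|rewrite exprn_ege1// ler1n].
Qed.

Lemma ucoef_geom e C : 0 <= C -> (forall m, `|e m| <= C * mwt r m) ->
  geom (ucoef e) (msize Z e).
Proof.
move=> C0 eC; have g := mcoef_geom ZS C0 eC.
move=> k; rewrite /ucoef; case: ifP => _; first exact: g.
by rewrite normr0 (le_trans _ (g k)).
Qed.

Lemma usol_lev e C x : 0 <= C -> (forall m, `|e m| <= C * mwt r m) ->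
  usol e x = levp Z (fun i => e i.1 * acos x i.2).
Proof.
move=> C0 eC; rewrite /acos (mcoef_cos_series ZS x C0 eC ler01 active_le).
congr (cos_series _ x); apply/funext => k; rewrite /ucoef.
by case: (active K k); rewrite ?mul1r ?mul0r.
Qed.

Lemma acos_bound e C x i : 0 <= C -> `|e i.1| <= C * mwt r i.1 ->
  `|e i.1 * acos x i.2| <= C * mweight (mwt r) i.
Proof.
move=> C0 eC; rewrite -[C]mulr1; apply: (@mode_bound _ _ _ _ (acos x)) => //.
by apply: le_trans (active_le i.2); rewrite normrM ler_piMr// cos_max.
Qed.

Lemma norm_sum_const_le N (f : nat -> R) (B : R) : (forall t, `|f t| <= B) ->
  `|\sum_(t < N) f t| <= N%:R * B.
Proof.
move=> fB; apply: le_trans (ler_norm_sum _ _ _) _.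
rewrite mulr_natl -[N in leRHS]card_ord -sumr_const; exact: ler_sum.
Qed.

Lemma lev_sum3 N (e : nat -> nat -> nat -> multidx * nat -> R) C : 0 <= C ->
  (forall p q t i, `|e p q t i| <= C * mweight (mwt r) i) ->
  levp Z (fun i => \sum_(p < N) \sum_(q < N) \sum_(t < N) e p q t i) =
  \sum_(p < N) \sum_(q < N) \sum_(t < N) levp Z (e p q t).
Proof.
move=> C0 eC.
have w0 i : 0 <= mweight (mwt r) i by apply: mweight_ge0.
have b1 p q i : `|\sum_(t < N) e p q t i| <= N%:R * C * mweight (mwt r) i.
  by rewrite -mulrA; apply: (@norm_sum_const_le N (fun t => e p q t i)).
have b2 p i : `|\sum_(q < N) \sum_(t < N) e p q t i| <= N%:R * (N%:R * C) * mweight (mwt r) i.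
  by rewrite -mulrA; apply: (@norm_sum_const_le N (fun q => \sum_(t < N) e p q t i)).
have c1 : 0 <= N%:R * C by rewrite mulr_ge0.
have c2 : 0 <= N%:R * (N%:R * C) by rewrite mulr_ge0.
rewrite (lev_sum ZS N (fun=> c2) b2); apply: eq_bigr => p _.
rewrite (lev_sum ZS N (fun=> c1) (b1 p)); apply: eq_bigr => q _.
by rewrite (lev_sum ZS N (fun=> C0) (eC p q)).
Qed.

Section Shift.
Variables a0 b0 c0 : R.
Let s := r / 2.
Hypothesis a0s : `|a0| <= s.
Hypothesis b0s : `|b0| <= s.
Hypothesis c0s : `|c0| <= s.

Let s0 : 0 < s. Proof. by rewrite divr_gt0. Qed.
Let ss : s + s = r. Proof. by rewrite /s; field. Qed.

(** The coefficient of a^p b^q c^t in the monomial m centred at (a0, b0, c0). The box has half-side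
    r / 2, so that centre plus increment stays within the radius r of convergence. *)
Definition shift_coef p q t (m : multidx) : R :=
  taylor_coef a0 m.1.1 p * taylor_coef b0 m.1.2 q * taylor_coef c0 m.2 t.

Lemma taylor_coef_le_r y i p : `|y| <= s -> s ^+ p * `|taylor_coef y i p| <= r ^+ i.
Proof.
move=> ys; apply: le_trans (taylor_coef_le y i p (ltW s0)) _.
by rewrite lerXn2r ?nnegrE ?addr_ge0 ?(ltW s0) ?(ltW r0)// -[leRHS]ss lerD2r.
Qed.

Lemma shift_coef_le p q t m :
  `|shift_coef p q t m| <= (s ^+ (p + q + t))^-1 * mwt r m.
Proof.
rewrite ler_pdivlMl ?exprn_gt0// /shift_coef /mwt !exprD 2!normrM.
rewrite [leLHS](_ : _ = (s ^+ p * `|taylor_coef a0 m.1.1 p|) *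
  (s ^+ q * `|taylor_coef b0 m.1.2 q|) * (s ^+ t * `|taylor_coef c0 m.2 t|)); last by ring.
have s1 := ltW s0.
by apply: ler_pM; rewrite ?mulr_ge0 ?exprn_ge0 ?normr_ge0//; [apply: ler_pM; rewrite ?mulr_ge0 ?exprn_ge0 ?normr_ge0//|]; exact: taylor_coef_le_r.
Qed.

Section Increment.
Variables a b c : R.
Hypothesis as_ : `|a| <= s.
Hypothesis bs_ : `|b| <= s.
Hypothesis cs_ : `|c| <= s.

Definition shift_sum N (m : multidx) : R :=
  \sum_(p < N) \sum_(q < N) \sum_(t < N) a ^+ p * b ^+ q * c ^+ t * shift_coef p q t m.

Lemma shift_sumE N m : shift_sum N m =
  (\sum_(p < N) a ^+ p * taylor_coef a0 m.1.1 p) *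
  ((\sum_(q < N) b ^+ q * taylor_coef b0 m.1.2 q) *
   (\sum_(t < N) c ^+ t * taylor_coef c0 m.2 t)).
Proof.
rewrite /shift_sum mulr_suml; apply: eq_bigr => p _.
rewrite mulr_suml mulr_sumr; apply: eq_bigr => q _.
rewrite !mulr_sumr; apply: eq_bigr => t _.
by rewrite /shift_coef; ring.
Qed.

Lemma taylor_sum_le_r y h i N : `|y| <= s -> `|h| <= s ->
  `|\sum_(p < N) h ^+ p * taylor_coef y i p| <= r ^+ i.
Proof.
move=> ys hs; apply: le_trans (ler_norm_sum _ _ _) _.
apply: le_trans (taylor_sum_norm_le _ _ _ _) _.
by rewrite lerXn2r ?nnegrE ?addr_ge0 ?(ltW r0)// -[leRHS]ss lerD.
Qed.

Lemma shift_sum_le N m : `|shift_sum N m| <= 1 * mwt r m.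
Proof.
rewrite mul1r shift_sumE !normrM /mwt !exprD -mulrA.
by apply: ler_pM; rewrite ?mulr_ge0//; [exact: taylor_sum_le_r|apply: ler_pM => //; exact: taylor_sum_le_r].
Qed.

Lemma norm_shift_le (y h : R) : `|y| <= s -> `|h| <= s -> `|y + h| <= r.
Proof. by move=> ys hs; apply: le_trans (ler_normD _ _) _; rewrite -[leRHS]ss lerD. Qed.

Lemma mono_shift_le m : `|mono (a0 + a) (b0 + b) (c0 + c) m| <= 1 * mwt r m.
Proof. by apply: norm_mono_le; exact: norm_shift_le. Qed.

Definition shift_rest N m : R := mono (a0 + a) (b0 + b) (c0 + c) m + -1 * shift_sum N m.

Lemma shift_rest_le N m : `|shift_rest N m| <= 2 * mwt r m.
Proof.
apply: le_trans (ler_normD _ _) _; rewrite mulN1r normrN.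
by have := shift_sum_le N m; have := mono_shift_le m; lra.
Qed.

(** For a fixed monomial the remainder is exactly zero once N exceeds the three exponents; only
    uniformity over monomials is at stake, and [shift_rest_le] supplies the domination. *)
Lemma shift_rest_cvg m : shift_rest N m @[N --> \oo] --> (0 : R).
Proof.
apply: cvg_near_cst; near=> N.
have h1 : (m.1.1 < N)%N by near: N; exists m.1.1.+1.
have h2 : (m.1.2 < N)%N by near: N; exists m.1.2.+1.
have h3 : (m.2 < N)%N by near: N; exists m.2.+1.
by rewrite /shift_rest shift_sumE !taylor_sum// /mono; ring.
Unshelve. all: by end_near. Qed.

Lemma shift_partial_sum N x :
  usol (mono (a0 + a) (b0 + b) (c0 + c)) x -
    partial_sum3 (fun p q t => usol (shift_coef p q t)) a b c N x =
  usol (shift_rest N) x.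
Proof.
have D0 p q t : 0 <= (s ^+ (p + q + t))^-1 by rewrite invr_ge0 exprn_ge0// ltW.
have two0 : 0 <= 2 :> R by [].
rewrite (usol_lev x ler01 mono_shift_le) (usol_lev x two0 (shift_rest_le N)).
have -> : partial_sum3 (fun p q t => usol (shift_coef p q t)) a b c N x =
    levp Z (fun i => shift_sum N i.1 * acos x i.2).
  have -> : (fun i : multidx * nat => shift_sum N i.1 * acos x i.2) =
      fun i => \sum_(p < N) \sum_(q < N) \sum_(t < N)
        (a ^+ p * b ^+ q * c ^+ t * shift_coef p q t i.1) * acos x i.2.
    apply/funext => i; rewrite /shift_sum mulr_suml; apply: eq_bigr => p _.
    by rewrite mulr_suml; apply: eq_bigr => q _; rewrite mulr_suml.
  rewrite (@lev_sum3 N (fun p q t i =>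
    (a ^+ p * b ^+ q * c ^+ t * shift_coef p q t i.1) * acos x i.2) 1)//.
    apply: eq_bigr => p _; apply: eq_bigr => q _; apply: eq_bigr => t _.
    rewrite (usol_lev x (D0 p q t) (shift_coef_le p q t)).
    rewrite -(levZ ZS _ (D0 p q t)) => [|i]; last first.
      by apply: acos_bound => //; exact: shift_coef_le.
    by apply: eq_lev => i; rewrite mulrA.
  move=> p q t i; apply: (@acos_bound (fun m => a ^+ p * b ^+ q * c ^+ t * shift_coef p q t m)) => //.
  rewrite mul1r normrM.
  have := shift_coef_le p q t i.1; rewrite ler_pdivlMl ?exprn_gt0//; apply: le_trans.
  rewrite ler_wpM2r// !normrM !normrX !exprD.
  have s1 := ltW s0.
  by apply: ler_pM; rewrite ?mulr_ge0 ?exprn_ge0//; [apply: ler_pM; rewrite ?exprn_ge0//|]; rewrite lerXn2r// nnegrE.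
have b1 i : `|mono (a0 + a) (b0 + b) (c0 + c) i.1 * acos x i.2| <= 1 * mweight (mwt r) i.
  by apply: acos_bound => //; exact: mono_shift_le.
have b2 i : `|shift_sum N i.1 * acos x i.2| <= 1 * mweight (mwt r) i.
  by apply: acos_bound => //; exact: shift_sum_le.
have b3 i : `|-1 * (shift_sum N i.1 * acos x i.2)| <= 1 * mweight (mwt r) i.
  by rewrite mulN1r normrN.
rewrite -mulN1r -(levZ ZS (-1) ler01 b2) -(levD ZS ler01 b1 ler01 b3).
by apply: eq_lev => i; rewrite /shift_rest; ring.
Qed.

Lemma cvg_H_norm_shift :
  H_norm 4 (fun x => usol (mono (a0 + a) (b0 + b) (c0 + c)) x -
    partial_sum3 (fun p q t => usol (shift_coef p q t)) a b c N x)
  @[N --> \oo] --> (0 : R).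
Proof.
have [C C0 hC] := H_norm_geom 4.
have two0 : 0 <= 2 :> R by [].
have cv := cvg_msize0 ZS two0 shift_rest_le shift_rest_cvg.
have cv2 : (fun N => C * msize Z (shift_rest N)) @ \oo --> (0 : R).
  by rewrite -(mulr0 C); apply: cvgM => //; exact: cvg_cst.
apply: (squeeze_cvgr _ (cvg_cst 0) cv2); near=> N.
apply/andP; split; first exact: sqrtr_ge0.
rewrite (funext (shift_partial_sum N)).
exact: hC (ucoef_geom two0 (shift_rest_le N)).
Unshelve. all: by end_near. Qed.

End Increment.

Lemma ur_sol_analytic : analytic3_at 4 (ur_sol K) a0 b0 c0.
Proof.
have [C C0 hC] := H_norm_geom 4.
have D0 p q t : 0 <= (s ^+ (p + q + t))^-1 by rewrite invr_ge0 exprn_ge0// ltW.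
have S0 := abs_bounded_ge0 ZS.
exists (fun p q t => usol (shift_coef p q t)), s, (C * ur_S K r); split.
- exact: s0.
- move=> p q t; apply: H_per_even_cos_series.
  exact: geom_rapid (ucoef_geom (D0 p q t) (shift_coef_le p q t)).
- move=> p q t.
  have h1 := hC _ _ (ucoef_geom (D0 p q t) (shift_coef_le p q t)).
  have h2 := msize_le ZS (D0 p q t) (shift_coef_le p q t).
  rewrite -ler_pdivlMr ?exprn_gt0//; apply: le_trans h1 _.
  by rewrite -mulrA ler_wpM2l// mulrC.
- move=> a b c /ltW sa /ltW sb /ltW sc; split; last exact: cvg_H_norm_shift.
  apply: H_per_even_cos_series; apply: (ur_coef_rapid hK (ltW r0) rsmall);
    exact: norm_shift_le.
Qed.

End Shift.

End FixedRadius.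

Lemma cst_Q_gt0 : 0 < cst_Q K :> R.
Proof.
rewrite /cst_Q mulr_gt0// ?ltr_wpDr ?mulr_ge0 ?cst_P0//.
by rewrite divr_gt0// beta_gt0.
Qed.

Lemma small_radius (d : R) : 0 < d -> exists r : R,
  [/\ 0 < r, r <= d, 8 * (r * cst_Q K) <= 1 &
   forall a b c, `|a| < r -> `|b| < r -> `|c| < r -> H_norm 4 (ur_sol K a b c) < d].
Proof.
move=> d0; have [C C0 hC] := H_norm_geom 4.
pose T : R := C * (2 * (cst_C K * cst_P K ^+ 2)) + 1.
have T1 : 0 <= T - 1.
  rewrite /T addrK mulr_ge0// mulr_ge0// mulr_ge0 ?cst_C0//.
  by apply: exprn_ge0; exact: cst_P0.
have T0 : 0 < T by lra.
have Q0 := cst_Q_gt0.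
(* The four bounds keep the parameters within d, give r^2 <= r, meet the smallness condition of the
   solver, and make the H^4 norm, at most (T - 1) r^2, smaller than d. *)
pose r := Num.min (Num.min d 1) (Num.min ((8 * cst_Q K)^-1) (d / (2 * T))).
have h1 : 0 < (8 * cst_Q K)^-1 :> R by rewrite invr_gt0 mulr_gt0.
have h2 : 0 < d / (2 * T) by rewrite divr_gt0// mulr_gt0.
have r0 : 0 < r by rewrite !lt_min d0 ltr01 h1 h2.
have rd : r <= d by rewrite !ge_min lexx.
have r1 : r <= 1 by rewrite !ge_min lexx orbT.
have rQ : 8 * (r * cst_Q K) <= 1.
  have : r <= (8 * cst_Q K)^-1 by rewrite !ge_min lexx !orbT.
  move=> h; have -> : 8 * (r * cst_Q K) = r * (8 * cst_Q K) by ring.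
  have q0 : 0 < 8 * cst_Q K :> R by rewrite mulr_gt0.
  by rewrite -[leRHS](mulVf (lt0r_neq0 q0)) ler_pM2r.
have rT : r <= d / (2 * T) by rewrite !ge_min lexx !orbT.
exists r; split => // a b c /ltW ar /ltW br /ltW cr.
have g := ur_coef_geom hK (ltW r0) rQ ar br cr.
apply: le_lt_trans (hC _ _ g) _.
rewrite ler_pdivlMr ?mulr_gt0// in rT.
have -> : C * ur_S K r = (T - 1) * r ^+ 2 by rewrite /T /ur_S; ring.
have rr : r ^+ 2 <= r by rewrite expr2 ler_piMl// ltW.
apply: (@le_lt_trans _ _ ((T - 1) * r)); first exact: ler_wpM2l.
have : (T - 1) * r <= T * r by rewrite ler_wpM2r ?ltW//; lra.
have h : r * (2 * T) = 2 * (T * r) by ring.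
by rewrite h in rT; move: (T * r) rT => z; lra.
Qed.

Lemma ur_sol_solves r a b c : 0 < r -> 8 * (r * cst_Q K) <= 1 ->
  `|a| < r -> `|b| < r -> `|c| < r ->
  null_perp K (ur_sol K a b c) /\ auxiliary_equation K a b c (ur_sol K a b c).
Proof.
move=> r0 rQ /ltW ar /ltW br /ltW cr.
apply: (aux_of_identity hK (ur_coef_rapid hK (ltW r0) rQ ar br cr)).
- by rewrite /ur_coef /active eqxx.
- by rewrite /ur_coef /active eqxx andbF.
- exact: (ur_sol_identity hK (ltW r0) rQ ar br cr).
Qed.

Lemma zero_solves :
  null_perp K (fun=> 0 : R) /\ auxiliary_equation K 0 0 0 (fun=> 0 : R).
Proof.
pose z : nat -> R := fun=> 0.
have zE : cos_series z = fun=> 0.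
  apply/funext => x; rewrite cos_seriesE (@tsum_finite _ _ 0) ?big_ord0// => n _.
  by rewrite mul0r.
have rz : rapid z.
  by move=> n; exists 0 => m; rewrite big1// => i _; rewrite mulr0 normr0.
rewrite -zE; apply: (@aux_of_identity _ _ hK 0 0 0 0 0 z) => // x.
have -> : (fun k => lam K k * z k) = z by apply/funext => k; rewrite mulr0.
by rewrite zE /phi; ring.
Qed.

Lemma exists_is_ur : is_ur K (@ur_sol R K).
Proof.
have [d d0 uniq] := aux_unique (R := R) K.
have [r [r0 rd rQ hr]] := small_radius d0.
have h0 : `|0 : R| < r by rewrite normr0.
have sol a b c ar br cr := @ur_sol_solves r a b c r0 rQ ar br cr.
have le a : `|a| < r -> `|a| <= d by move=> ar; exact: le_trans (ltW ar) rd.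
split; last first.
  exists r, d; split => // a b c ar br cr.
  have [np aux] := sol _ _ _ ar br cr.
  split => //; first exact: hr.
  move=> v npv nv auxv.
  exact: (uniq a b c v _ (le _ ar) (le _ br) (le _ cr) npv np (ltW nv)
    (ltW (hr _ _ _ ar br cr)) auxv aux).
(* At the origin the zero function also solves the equation, so uniqueness gives the required value
   there. *)
have [np0 aux0] := zero_solves.
have [np aux] := sol _ _ _ h0 h0 h0.
apply: (uniq 0 0 0) => //; rewrite ?normr0 ?(ltW d0)//.
  by apply: ltW; exact: hr.
rewrite /H_norm (_ : limn _ = 0) ?sqrtr0 ?(ltW d0)//.
apply: cvg_tsum_eq; apply: cvg_near_cst; apply: nearW => n.
rewrite /series/= big1// => k _; rewrite /sobolev_terms.
have -> : fourier (fun=> 0 : R) k = 0; last by rewrite expr0n mulr0.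
have i0 : intg (fun=> 0 : R) by apply: intg_continuous => x; exact: cvg_cst.
rewrite -[RHS](mul0r (fourier (fun=> 0 : R) k)) -(fourierZ 0 k i0).
by congr (fourier _ k); apply/funext => x; rewrite mul0r.
Qed.

(* The two uniqueness clauses concern balls of different radii: the clause of the
   larger ball applies to both functions. *)
Lemma is_ur_unique (u1 u2 : R -> R -> R -> R -> R) : is_ur K u1 -> is_ur K u2 ->
  exists2 eps : R, 0 < eps & forall a b c, `|a| < eps -> `|b| < eps -> `|c| < eps ->
    u1 a b c = u2 a b c.
Proof.
move=> [_ [e1 [d1 [e10 d10 h1]]]] [_ [e2 [d2 [e20 d20 h2]]]].
exists (Num.min e1 e2) => [|a b c]; first by rewrite lt_min e10.
rewrite !lt_min => /andP[a1 a2] /andP[b1 b2] /andP[c1 c2].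
have [np1 n1 aux1 u1u] := h1 _ _ _ a1 b1 c1.
have [np2 n2 aux2 u2u] := h2 _ _ _ a2 b2 c2.
apply/funext => x; have [d12|/ltW d21] := leP d1 d2.
  exact: (u2u _ np1 (lt_le_trans n1 d12) aux1 x).
exact: (esym (u1u _ np2 (lt_le_trans n2 d21) aux2 x)).
Qed.

Lemma analytic3_at_eq_near (F G : R -> R -> R -> R -> R) (eps a0 b0 c0 : R) :
  (forall a b c, `|a| < eps -> `|b| < eps -> `|c| < eps -> F a b c = G a b c) ->
  `|a0| < eps -> `|b0| < eps -> `|c0| < eps ->
  analytic3_at 4 F a0 b0 c0 -> analytic3_at 4 G a0 b0 c0.
Proof.
move=> FG ha hb hc [A [r [M [r0 HA AM cv]]]].
(* The box is shrunk until it lies inside the region where both functions agree. *)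
pose s := Num.min r (Num.min (eps - `|a0|) (Num.min (eps - `|b0|) (eps - `|c0|))).
have s0 : 0 < s by rewrite !lt_min r0 !subr_gt0 ha hb hc.
have sr : s <= r by rewrite ge_min lexx.
exists A, s, M; split => //.
  move=> i j l; apply: le_trans (AM i j l); rewrite ler_wpM2l ?sqrtr_ge0//.
  by rewrite lerXn2r ?nnegrE// ltW.
move=> a b c; rewrite !lt_min => /and4P[ar a1 _ _] /and4P[br _ b1 _] /and4P[cr _ _ c1].
have [hF cF] := cv _ _ _ ar br cr.
have ls x y : `|y| < eps - `|x| -> `|x + y| < eps.
  by move=> h; apply: le_lt_trans (ler_normD _ _) _; lra.
have E : F (a0 + a) (b0 + b) (c0 + c) = G (a0 + a) (b0 + b) (c0 + c).
  by apply: FG; exact: ls.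
by rewrite -E.
Qed.

Lemma is_ur_regular (ur : R -> R -> R -> R -> R) : is_ur K ur ->
  exists eps : R, 0 < eps /\
    forall a b c : R, `|a| < eps -> `|b| < eps -> `|c| < eps ->
      Hinfty_per_even (ur a b c) /\ analytic3_at 4 ur a b c.
Proof.
move=> hur; have [e e0 E] := is_ur_unique exists_is_ur hur.
have [r [r0 _ rQ _]] := small_radius ltr01.
exists (Num.min e (r / 2)); split; first by rewrite lt_min e0 divr_gt0.
move=> a b c; rewrite !lt_min => /andP[ae ar] /andP[be br] /andP[ce cr].
have rr x : `|x| < r / 2 -> `|x| <= r by move=> h; apply: le_trans (ltW h) _; lra.
split; first rewrite -E//.
  apply: Hinfty_cos_series.
  by apply: (ur_coef_rapid hK (ltW r0) rQ); exact: rr.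
apply: analytic3_at_eq_near E _ _ _ _ => //.
by apply: (ur_sol_analytic r0 rQ); exact: ltW.
Qed.

End SmallSolutionProperties.

(** * Inverting an operator made of a finite block and a diagonal *)

Section FiniteInverse.
Context {R : realType}.

Local Notation w2 := (fun k : nat => 2 ^+ k : R).

(** Subtracting from [phi] its truncation below n leaves a functional that vanishes on the support
    of [T]. *)
Lemma ev_delta_expand (T : @fsum R nat) (n : nat) (phi : nat -> R) :
  (forall psi : nat -> R, (forall k, (k < n)%N -> psi k = 0) -> ev psi T = 0) ->
  ev phi T = \sum_(k < n) ev (delta_seq k) T * phi k.
Proof.
move=> supT.
pose psi j := phi j + -1 * \sum_(k < n) phi k * delta_seq k j.
have := supT psi; rewrite /psi evDe evZe mulN1r.
have -> : ev (fun j => \sum_(k < n) phi k * delta_seq k j) T =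
    \sum_(k < n) ev (delta_seq k) T * phi k.
  rewrite (ev_sume n (fun k j => phi k * delta_seq k j)).
  by apply: eq_bigr => k _; rewrite evZe mulrC.
move=> h; apply/eqP; rewrite -subr_eq0 h// => k kn.
rewrite (bigD1 (Ordinal kn))//= /delta_seq eqxx mulr1 big1 ?addr0 ?mulN1r ?subrr// => i.
by rewrite -val_eqE/= eq_sym => /negbTE ->; rewrite mulr0.
Qed.

(** Injectivity makes the square block below n row-free, hence invertible; from n on the table is
    diagonal with bounded inverses. The sum of the entries of the inverse block, with their weights,
    is absorbed into the bound [D]. *)
Lemma table_right_inverse (n : nat) (T : nat -> @fsum R nat) (lamv : nat -> R) (C : R) :
  0 <= C ->
  (forall q, (n <= q)%N -> forall phi, ev phi (T q) = lamv q * phi q) ->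
  (forall q, (n <= q)%N -> lamv q != 0 /\ `|(lamv q)^-1| <= C) ->
  (forall q, (q < n)%N -> forall phi : nat -> R,
     (forall k, (k < n)%N -> phi k = 0) -> ev phi (T q) = 0) ->
  (forall z : nat -> R, (forall k, (k < n)%N ->
      \sum_(q < n) z q * ev (delta_seq k) (T q) = 0) ->
     forall q, (q < n)%N -> z q = 0) ->
  exists (linv : nat -> @fsum R nat) (D : R), 0 <= D /\ forall k,
    nrm w2 (linv k) <= D * 2 ^+ k /\ forall phi, ev phi (lin T (linv k)) = phi k.
Proof.
move=> C0 Tdiag lamC Tsup inj.
pose A : 'M[R]_n := \matrix_(q < n, k < n) ev (delta_seq k) (T q).
have Aunit : A \in unitmx.
  rewrite -row_free_unit; apply: inj_row_free => v vA.
  pose z q : R := if insub q is Some i then v 0 (i : 'I_n) else 0.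
  have zE (i : 'I_n) : z i = v 0 i by rewrite /z valK.
  have z0 : forall q, (q < n)%N -> z q = 0.
    apply: inj => k kn; have := congr1 (fun M : 'rV_n => M 0 (Ordinal kn)) vA.
    rewrite !mxE => h; rewrite -[RHS]h; apply: eq_bigr => q _.
    by rewrite zE mxE.
  by apply/rowP => i; rewrite mxE -zE z0.
pose B := invmx A.
pose linv k : @fsum R nat := if insub k is Some i
  then [seq (B i q, val q) | q <- enum 'I_n] else [:: ((lamv k)^-1, k)].
pose D : R := C + \sum_(i < n) \sum_(q < n) `|B i q| * 2 ^+ q.
have D0 : 0 <= \sum_(i < n) \sum_(q < n) `|B i q| * 2 ^+ q.
  by apply: sumr_ge0 => i _; apply: sumr_ge0 => q _; rewrite mulr_ge0// exprn_ge0.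
exists linv, D; split; first by rewrite addr_ge0.
move=> k; rewrite /linv; case: insubP => [i _ ik|]; last first.
  rewrite -leqNgt => nk; have [l0 lC] := lamC k nk; split.
    rewrite nrm_cons nrm_nil addr0/= ler_wpM2r ?exprn_ge0//.
    by apply: le_trans lC _; rewrite lerDl.
  by move=> phi; rewrite ev_lin ev_cons ev_nil addr0/= Tdiag// mulKf.
split.
  rewrite /nrm big_map big_enum/= /D.
  apply: (@le_trans _ _ (C + \sum_(i < n) \sum_(q < n) `|B i q| * 2 ^+ q)).
    apply: (@le_trans _ _ (\sum_(i < n) \sum_(q < n) `|B i q| * 2 ^+ q)); last by rewrite lerDr.
    rewrite [leRHS](bigD1 i)//= lerDl.
    by apply: sumr_ge0 => j _; apply: sumr_ge0 => q _; rewrite mulr_ge0// exprn_ge0.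
  rewrite ler_peMr ?addr_ge0//; first by rewrite exprn_ege1// ler1n.
move=> phi; rewrite ev_lin /ev big_map big_enum/=.
under eq_bigr => q _ do rewrite -/(ev phi (T q)) (ev_delta_expand _ (Tsup q (ltn_ord q))) mulr_sumr.
rewrite exchange_big/=.
have BA : B *m A = 1%:M by rewrite mulVmx.
transitivity (\sum_(j < n) (B *m A) i j * phi j).
  apply: eq_bigr => j _; rewrite mxE mulr_suml; apply: eq_bigr => q _.
  by rewrite mxE mulrA.
rewrite BA (bigD1 i)//= mxE eqxx mul1r big1 ?addr0 ?ik// => j ji.
by rewrite mxE eq_sym (negbTE ji) mul0r.
Qed.

End FiniteInverse.

(** * Restriction of a formal combination to selected indices *)

Section Keep.
Context {R : realType} (I : Type).
Implicit Types (P : I -> bool) (s : @fsum R I).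

Definition keep P s : @fsum R I := [seq t <- s | P t.2].

Lemma ev_keep (e : I -> R) P s : ev e (keep P s) = ev (fun i => (P i)%:R * e i) s.
Proof.
rewrite /ev big_filter big_mkcond; apply: eq_bigr => t _.
by case: (P t.2); rewrite ?mul1r ?mul0r ?mulr0.
Qed.

Lemma supp_keep P s : supp P (keep P s).
Proof. exact: filter_all. Qed.

End Keep.

(** * The rescaled equation along a branch *)

Section Branch.
Context {R : realType} (K : nat).
Hypothesis hK : (2 <= K)%N.
Local Notation lam := (@lam R K).

(* Mode k of the profile is a^(d k) times the k-th unknown, mode 1 is a itself,
   and the velocity is c_0 + a^e times the unknown of index 1; the sequence w0
   holds the unknowns at a = 0.  Mode k of the equation is divisible by a^(E k). *)
Variables (d : nat -> nat) (e n : nat) (w0 : nat -> R).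

(** On modes 1 and K the symbol vanishes, so the lowest term is the velocity correction times the
    mode itself, which carries the extra power a^e. *)
Definition eorder k := (d k + (if (k == 1%N) || (k == K) then e else 0))%N.

(** Slot 1 of [w0] holds the velocity, because the amplitude of cos(x) is the parameter itself; the
    profile has amplitude 1 there. *)
Definition uhat k : R := if k == 1%N then 1 else w0 k.

Hypothesis e0 : (0 < e)%N.
Hypothesis hn : (K < n)%N.
Hypothesis w0n : forall k, (n <= k)%N -> w0 k = 0.
Hypothesis dS : forall p q, (eorder (p + q) <= d p + d q)%N.
Hypothesis dD : forall p q, (eorder (distn' p q) <= d p + d q)%N.

Local Notation idx := (nat * nat)%type.

(** The product of two modes after division of mode k of the equation by a^(E k). The leftover
    exponents are true differences by [dS] and [dD]. *)
Definition ptab (i j : idx) : @fsum R idx :=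
  [:: (2^-1, ((i.1 + j.1 + (d i.2 + d j.2 - eorder (i.2 + j.2)))%N, (i.2 + j.2)%N));
      (2^-1, ((i.1 + j.1 + (d i.2 + d j.2 - eorder (distn' i.2 j.2)))%N, distn' i.2 j.2))].

Definition ctab (m : nat) (j : idx) : @fsum R idx :=
  [:: (1, ((m + j.1 + (e + d j.2 - eorder j.2))%N, j.2))].

Definition lamtab (i : idx) : @fsum R idx := [:: (lam i.2, i)].

Definition ulist : @fsum R idx := [seq (uhat p, (0%N, p)) | p <- iota 0 n].

Definition restab : @fsum R idx :=
  lin lamtab ulist ++ scl (w0 1) (lin (ctab 0) ulist) ++ bil ptab ulist ulist.

Definition dtab (i : idx) : @fsum R idx :=
  if i.2 == 1%N then lin (ctab i.1) ulist
  else scl (w0 1) (ctab 0 i) ++ lin (ptab i) ulist ++ lin (ptab^~ i) ulist.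

(** The product of a velocity increment with a mode increment is counted only with the velocity in
    the first slot, whence the zero when the second slot is 1. *)
Definition btab (i j : idx) : @fsum R idx :=
  if j.2 == 1%N then [::] else if i.2 == 1%N then ctab i.1 j else ptab i j.

(* The part of the linearization that survives at a = 0. *)
Definition theta (phi : nat -> R) p q : R :=
  2^-1 * ((d p + d q == eorder (p + q))%N%:R * phi (p + q)%N +
          (d p + d q == eorder (distn' p q))%N%:R * phi (distn' p q)).

(** Written dually: [phi] tests the modes of the equation and q is the unknown being varied. The
    case q = 1 varies the velocity, which multiplies the amplitudes 1 of cos(x) and [w0 K] of
    cos(Kx). *)
Definition lead_lin (phi : nat -> R) q : R :=
  if q == 1%N then phi 1%N + w0 K * phi K
  else lam q * phi q + (if q == K then w0 1 * phi K else 0) +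
       2 * \sum_(p < n) uhat p * theta phi p q.

Definition lead_res (phi : nat -> R) : R :=
  \sum_(p < n) uhat p * (lam p * phi p) + w0 1 * (phi 1%N + w0 K * phi K) +
  \sum_(p < n) uhat p * \sum_(q < n) uhat q * theta phi p q.

Hypothesis lead_res0 : forall phi, lead_res phi = 0.

Variables (linv : nat -> @fsum R nat) (D : R).
Hypothesis D0 : 0 <= D.
Hypothesis linvD : forall k, nrm (fun k => 2 ^+ k) (linv k) <= D * 2 ^+ k.
Hypothesis linvK : forall phi k,
  ev (fun q => lead_lin phi q) (linv k) = phi k.

Definition linvtab (i : idx) : @fsum R idx :=
  [seq (- t.1, (i.1, t.2)) | t <- linv i.2].

(** The terms surviving at a = 0 are filtered out: in the residual they cancel by [lead_res0], in
    the linearization they are what [linv] inverts. Everything kept carries an extra factor of a,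
    which makes the map small. *)
Definition w_g := lin linvtab (keep (fun i => i.1 != 0%N) restab).
Definition w_l (i : idx) := lin linvtab (keep (fun j => j.1 != i.1) (dtab i)).
Definition w_B (i j : idx) := lin linvtab (btab i j).
Definition w_Z := qsol w_g w_l w_B.

Lemma eorder_active k : active K k -> eorder k = d k.
Proof. by rewrite /eorder /active -negb_or => /negbTE ->; rewrite addn0. Qed.

Lemma eorder_le k : (eorder k <= e + d k)%N.
Proof. by rewrite /eorder; case: ifP => _; lia. Qed.

Lemma lam_inactive k : ~~ active K k -> lam k = 0.
Proof.
by rewrite /active negb_and !negbK => /orP[] /eqP ->; rewrite /lam ?expr1n ?subrr ?mul0r !mulr0.
Qed.

Lemma distnC p q : distn' p q = distn' q p.
Proof. by rewrite /distn' addnC. Qed.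

Lemma thetaC phi p q : theta phi p q = theta phi q p.
Proof. by rewrite /theta [(q + p)%N]addnC [(d q + d p)%N]addnC [distn' q p]distnC. Qed.

Lemma ev_ulist (f : idx -> R) : ev f ulist = \sum_(p < n) uhat p * f (0%N, p : nat).
Proof.
rewrite /ev big_map (_ : iota 0 n = index_iota 0 n) ?big_mkord//.
by rewrite /index_iota subn0.
Qed.

Section Evaluation.
Variables a x : R.

(** [evE] restores the powers divided out of the equation, [evU] those divided out of the
    profile. *)
Definition evE (i : idx) : R := a ^+ (i.1 + eorder i.2) * cos (i.2%:R * x).
Definition evU (i : idx) : R := a ^+ (i.1 + d i.2) * cos (i.2%:R * x).

Lemma ev_ptab i j : ev evE (ptab i j) = evU i * evU j.
Proof.
rewrite /ptab !ev_cons ev_nil addr0 /evE /evU/=.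
have h1 := dS i.2 j.2; have h2 := dD i.2 j.2.
have -> : (i.1 + j.1 + (d i.2 + d j.2 - eorder (i.2 + j.2)) + eorder (i.2 + j.2) =
  (i.1 + d i.2) + (j.1 + d j.2))%N by lia.
have -> : (i.1 + j.1 + (d i.2 + d j.2 - eorder (distn' i.2 j.2)) + eorder (distn' i.2 j.2) =
  (i.1 + d i.2) + (j.1 + d j.2))%N by lia.
rewrite exprD [RHS](_ : _ = a ^+ (i.1 + d i.2) * a ^+ (j.1 + d j.2) *
  (cos (i.2%:R * x) * cos (j.2%:R * x))); last by ring.
by rewrite cosM; ring.
Qed.

Lemma ev_ctab m j : ev evE (ctab m j) = a ^+ (m + e) * evU j.
Proof.
rewrite /ctab ev_cons ev_nil addr0 mul1r /evE /evU/=.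
have h := eorder_le j.2.
have -> : (m + j.1 + (e + d j.2 - eorder j.2) + eorder j.2 = (m + e) + (j.1 + d j.2))%N by lia.
by rewrite exprD mulrA.
Qed.

Lemma ev_lamtab i : ev evE (lamtab i) = lam i.2 * evU i.
Proof.
rewrite /lamtab ev_cons ev_nil addr0/= /evE /evU.
have [/eorder_active ->//|/lam_inactive ->] := boolP (active K i.2).
by rewrite !mul0r.
Qed.

Definition Ulead : R := ev evU ulist.
Definition chi (i : idx) : R := if i.2 == 1%N then a ^+ (i.1 + e) else 0.
Definition evV (i : idx) : R := if i.2 == 1%N then 0 else evU i.

Lemma ev_restab : ev evE restab =
  ev (fun i => lam i.2 * evU i) ulist + w0 1 * (a ^+ e * Ulead) + Ulead ^+ 2.
Proof.
rewrite /restab !ev_cat ev_scl ev_bil !ev_lin.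
rewrite (eq_ev _ ev_lamtab) (eq_ev _ (ev_ctab 0)) add0n evZe addrA; congr (_ + _).
rewrite (_ : (fun i => _) = fun i => Ulead * evU i); first by rewrite evZe expr2.
by apply/funext => i; rewrite (eq_ev _ (ev_ptab i)) evZe mulrC.
Qed.

Lemma ev_dtab i : ev evE (dtab i) =
  chi i * Ulead + (w0 1 * a ^+ e + 2 * Ulead) * evV i.
Proof.
rewrite /dtab /chi /evV; case: ifP => _.
  by rewrite ev_lin (eq_ev _ (ev_ctab i.1)) evZe mulr0 addr0.
rewrite !ev_cat ev_scl ev_ctab add0n !ev_lin (eq_ev _ (ev_ptab i)) evZe.
have h j : ev evE (ptab j i) = evU i * evU j by rewrite ev_ptab mulrC.
by rewrite (eq_ev _ h) evZe -/Ulead; ring.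
Qed.

Lemma ev_btab i j : ev evE (btab i j) = (chi i + evV i) * evV j.
Proof.
rewrite /btab /chi /evV; case: ifP => _; first by rewrite ev_nil mulr0.
case: ifP => _; first by rewrite ev_ctab addr0.
by rewrite ev_ptab add0r.
Qed.

(** The leading linearization followed by evaluation. It undoes [linvtab] up to sign, so it is the
    functional through which the fixed-point equation becomes the Kawahara equation at x. *)
Definition evF (i : idx) : R :=
  a ^+ i.1 * lead_lin (fun k => evE (0%N, k)) i.2.

Lemma ev_evF_linvtab s : ev evF (lin linvtab s) = - ev evE s.
Proof.
rewrite ev_lin -mulN1r -evZe; apply: eq_ev => i.
rewrite /linvtab /ev big_map/= /evF.
have -> : \sum_(t <- linv i.2) - t.1 * (a ^+ i.1 * lead_lin (fun k => evE (0%N, k)) t.2) =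
    (- a ^+ i.1) * ev (fun q => lead_lin (fun k => evE (0%N, k)) q) (linv i.2).
  by rewrite /ev mulr_sumr; apply: eq_bigr => t _; ring.
by rewrite linvK /evE/= add0n exprD; ring.
Qed.

Lemma exp_keep0 (m k l : nat) : (l <= k)%N ->
  ((m + (k - l))%N == m)%:R * a ^+ (m + (k - l) + l) = (k == l)%:R * (a ^+ m * a ^+ l) :> R.
Proof.
move=> lk; have -> : ((m + (k - l))%N == m) = (k == l) by lia.
by have [->|_] := eqVneq k l; rewrite ?mul0r// subnn addn0 exprD.
Qed.

Lemma lead_ptab m p q :
  ev (fun i => (i.1 == m)%:R * evE i) (ptab (m, p) (0%N, q)) =
  a ^+ m * theta (fun k => evE (0%N, k)) p q.
Proof.
rewrite /ptab !ev_cons ev_nil addr0 /theta/= /evE/= addn0 !add0n.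
by rewrite !mulrA -![2^-1 * _ * _]mulrA !exp_keep0//; ring.
Qed.

Lemma lead_ptabC m p q :
  ev (fun i => (i.1 == m)%:R * evE i) (ptab (0%N, q) (m, p)) =
  a ^+ m * theta (fun k => evE (0%N, k)) p q.
Proof.
rewrite thetaC /ptab !ev_cons ev_nil addr0 /theta/= /evE/= !add0n.
by rewrite !mulrA -![2^-1 * _ * _]mulrA !exp_keep0//; ring.
Qed.

Lemma eorder_eq k : (e + d k == eorder k)%N = (k == 1%N) || (k == K).
Proof. by rewrite /eorder; case: ifP => _; lia. Qed.

Lemma lead_ctab m q :
  ev (fun i => (i.1 == m)%:R * evE i) (ctab m (0%N, q)) =
  a ^+ m * (((q == 1%N) || (q == K))%:R * evE (0%N, q)).
Proof.
rewrite /ctab ev_cons ev_nil addr0 mul1r /evE/= addn0 add0n mulrA.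
rewrite exp_keep0 ?eorder_le// eorder_eq; ring.
Qed.

Lemma lead_ctabC m q :
  ev (fun i => (i.1 == m)%:R * evE i) (ctab 0%N (m, q)) =
  a ^+ m * (((q == 1%N) || (q == K))%:R * evE (0%N, q)).
Proof. by rewrite -lead_ctab /ctab/= addn0 add0n. Qed.

Lemma sum_velocity (phi : nat -> R) :
  \sum_(p < n) uhat p * (((p == 1%N :> nat) || (p == K :> nat))%:R * phi p) =
  phi 1%N + w0 K * phi K.
Proof.
have n1 : (1 < n)%N by exact: leq_ltn_trans (ltnW hK) hn.
rewrite (bigD1 (Ordinal n1))//= /uhat eqxx/= !mul1r; congr (_ + _).
have hKn1 : Ordinal hn != Ordinal n1 by rewrite -val_eqE/=; lia.
rewrite (bigD1 (Ordinal hn))//= eqxx orbT mul1r gtn_eqF// big1 ?addr0// => i.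
rewrite -!val_eqE/= => /andP[/negbTE -> /negbTE ->].
by rewrite mul0r mulr0.
Qed.

(** [dtab] does not contain the diagonal symbol, which scales exactly and is added here; together
    they give the full leading linearization. *)
Lemma lead_dtab m q :
  ev (fun i => (i.1 == m)%:R * evE i) (dtab (m, q)) + lam q * evV (m, q) = evF (m, q).
Proof.
rewrite /dtab /evF /lead_lin /evV [(m, q).2]/= [(m, q).1]/=.
have [->|/negbTE q1] := eqVneq q 1%N.
  rewrite mulr0 addr0 ev_lin ev_ulist.
  under eq_bigr do rewrite lead_ctab mulrCA.
  by rewrite -mulr_sumr (sum_velocity (fun k => evE (0%N, k))).
rewrite !ev_cat ev_scl lead_ctabC q1/= !ev_lin !ev_ulist.
have h1 : \sum_(p < n) uhat p * ev (fun i => (i.1 == m)%:R * evE i) (ptab (m, q) (0%N, p : nat)) =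
    a ^+ m * \sum_(p < n) uhat p * theta (fun k => evE (0%N, k)) p q.
  by rewrite mulr_sumr; apply: eq_bigr => p _; rewrite lead_ptab thetaC mulrCA.
have h2 : \sum_(p < n) uhat p * ev (fun i => (i.1 == m)%:R * evE i) (ptab (0%N, p : nat) (m, q)) =
    a ^+ m * \sum_(p < n) uhat p * theta (fun k => evE (0%N, k)) p q.
  by rewrite mulr_sumr; apply: eq_bigr => p _; rewrite lead_ptabC thetaC mulrCA.
rewrite h1 h2.
have -> : lam q * evU (m, q) = a ^+ m * (lam q * evE (0%N, q)).
  rewrite /evU /evE/= add0n exprD.
  have [/eorder_active ->|/lam_inactive ->] := boolP (active K q); last by rewrite !mul0r mulr0.
  ring.
have [->|_] := eqVneq q K; rewrite ?mul1r ?mul0r ?mulr0; ring.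
Qed.

Lemma lead_restab : ev (fun i => (i.1 == 0%N)%:R * evE i) restab = 0.
Proof.
rewrite -(lead_res0 (fun k => evE (0%N, k))) /restab !ev_cat ev_scl ev_bil !ev_lin.
rewrite /lead_res !ev_ulist addrA; congr (_ + _ + _).
- apply: eq_bigr => p _; congr (_ * _).
  by rewrite /lamtab ev_cons ev_nil addr0/= mul1r.
- congr (_ * _); rewrite -(sum_velocity (fun k => evE (0%N, k))); apply: eq_bigr => p _; congr (_ * _).
  by rewrite lead_ctab expr0 mul1r.
- apply: eq_bigr => p _; congr (_ * _); rewrite ev_ulist.
  by apply: eq_bigr => q _; rewrite lead_ptab expr0 mul1r.
Qed.

Lemma ev_evF_g : ev evF w_g = - ev evE restab.
Proof.
rewrite /w_g ev_evF_linvtab ev_keep; congr (- _).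
rewrite -[LHS]add0r -lead_restab -evDe; apply: eq_ev => i.
by case: (i.1 == 0%N); rewrite ?mul1r ?mul0r ?addr0 ?add0r.
Qed.

(** The filtered linearization is the full one minus its leading part. The summand [evF i] cancels
    against the left side of the fixed-point equation and leaves the symbol applied to the
    increment. *)
Lemma ev_evF_l i : ev evF (w_l i) = - ev evE (dtab i) + (evF i + -1 * (lam i.2 * evV i)).
Proof.
rewrite /w_l ev_evF_linvtab ev_keep.
case: i => m q; rewrite -lead_dtab /=.
have -> : ev evE (dtab (m, q)) = ev (fun i => (i.1 != m)%:R * evE i) (dtab (m, q)) +
    ev (fun i => (i.1 == m)%:R * evE i) (dtab (m, q)).
  rewrite -evDe; apply: eq_ev => i.
  by case: (i.1 == m); rewrite ?mul1r ?mul0r ?addr0 ?add0r.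
by ring.
Qed.

Lemma ev_evF_B i j : ev evF (w_B i j) = - (chi i + evV i) * evV j.
Proof. by rewrite /w_B ev_evF_linvtab ev_btab mulNr. Qed.

End Evaluation.

Definition rweight (r : R) := mweight (fun m => r ^+ m).

Definition unorm : R := \sum_(p < n) `|uhat p| * 2 ^+ p.

Definition dcst : R := `|w0 1| + 3 * unorm.

Lemma unorm_ge0 : 0 <= unorm.
Proof. by apply: sumr_ge0 => p _; rewrite mulr_ge0// exprn_ge0. Qed.

Section Bounds.
Variable r : R.
Hypothesis r0 : 0 < r.
Hypothesis r1 : r <= 1.

Lemma rweight_ge0 i : 0 <= rweight r i.
Proof. by apply: mweight_ge0 => m; rewrite exprn_ge0// ltW. Qed.

Lemma nrm_ulist : nrm (rweight r) ulist = unorm.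
Proof.
rewrite /nrm big_map (_ : iota 0 n = index_iota 0 n) ?big_mkord; last first.
  by rewrite /index_iota subn0.
by apply: eq_bigr => p _; rewrite /rweight /mweight/= expr0 mul1r.
Qed.

Lemma exp_le_r (m k : nat) : (m <= k)%N -> r ^+ k <= r ^+ m.
Proof. by move=> mk; rewrite ler_wiXn2l// ltW. Qed.

Lemma nrm_ptab i j : nrm (rweight r) (ptab i j) <= 1 * (rweight r i * rweight r j).
Proof.
rewrite /ptab !nrm_cons nrm_nil addr0 /rweight /mweight/= mul1r.
rewrite [`|_|]gtr0_norm ?invr_gt0//.
have h k : (k <= i.2 + j.2)%N -> forall l, r ^+ (i.1 + j.1 + l) * 2 ^+ k <=
    r ^+ i.1 * 2 ^+ i.2 * (r ^+ j.1 * 2 ^+ j.2).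
  move=> kij l; rewrite [leRHS](_ : _ = r ^+ (i.1 + j.1) * 2 ^+ (i.2 + j.2)); last first.
    by rewrite !exprD; ring.
  apply: ler_pM; rewrite ?exprn_ge0 ?(ltW r0)//; first by apply: exp_le_r; exact: leq_addr.
  by rewrite ler_eXn2l// ltr1n.
have h1 := h _ (leqnn _) (d i.2 + d j.2 - eorder (i.2 + j.2))%N.
have h2 := h _ (distn_le i.2 j.2) (d i.2 + d j.2 - eorder (distn' i.2 j.2))%N.
by move: h1 h2; lra.
Qed.

Lemma nrm_ctab m j : nrm (rweight r) (ctab m j) <= r ^+ m * rweight r j.
Proof.
rewrite /ctab nrm_cons nrm_nil addr0 normr1 mul1r /rweight /mweight/= mulrA -exprD.
by rewrite ler_wpM2r ?exprn_ge0//; apply: exp_le_r; exact: leq_addr.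
Qed.

Lemma nrm_linvtab s : nrm (rweight r) (lin linvtab s) <= D * nrm (rweight r) s.
Proof.
rewrite nrm_lin -nrmZw; apply: ler_nrm => i.
rewrite /linvtab /nrm big_map/= /rweight /mweight/=.
have -> : \sum_(t <- linv i.2) `|- t.1| * (r ^+ i.1 * 2 ^+ t.2) =
    r ^+ i.1 * nrm (fun k => 2 ^+ k) (linv i.2).
  by rewrite /nrm mulr_sumr; apply: eq_bigr => t _; rewrite normrN; ring.
rewrite mulrCA; apply: ler_wpM2l; first by rewrite exprn_ge0// ltW.
exact: linvD.
Qed.

Lemma nrm_dtab i : nrm (rweight r) (dtab i) <= dcst * rweight r i.
Proof.
have u0 := unorm_ge0; have wi := rweight_ge0 i.
have uw : 0 <= unorm * rweight r i by rewrite mulr_ge0.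
have nw : 0 <= `|w0 1| * rweight r i by rewrite mulr_ge0.
rewrite /dtab /dcst; case: ifP => [/eqP i1|_].
  have h : nrm (rweight r) (lin (ctab i.1) ulist) <= r ^+ i.1 * unorm.
    by rewrite nrm_lin -nrm_ulist -nrmZw; apply: ler_nrm => j; exact: nrm_ctab.
  apply: le_trans h _.
  have h2 : r ^+ i.1 * unorm <= unorm * rweight r i.
    rewrite mulrC ler_wpM2l// /rweight /mweight i1 expr1.
    by rewrite ler_peMr ?exprn_ge0 ?(ltW r0)//; lra.
  by apply: le_trans h2 _; rewrite mulrDl -mulrA; move: uw nw; lra.
have h1 : nrm (rweight r) (ctab 0 i) <= rweight r i.
  by have := nrm_ctab 0 i; rewrite expr0 mul1r.
have h2 : nrm (rweight r) (lin (ptab i) ulist) <= rweight r i * unorm.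
  rewrite nrm_lin -nrm_ulist -nrmZw; apply: ler_nrm => j.
  by have := nrm_ptab i j; rewrite mul1r.
have h3 : nrm (rweight r) (lin (ptab^~ i) ulist) <= rweight r i * unorm.
  rewrite nrm_lin -nrm_ulist -nrmZw; apply: ler_nrm => j.
  by have := nrm_ptab j i; rewrite mul1r mulrC.
rewrite !nrm_cat nrm_scl.
have h4 := ler_wpM2l (normr_ge0 (w0 1)) h1.
by rewrite mulrDl -mulrA; move: h4 h2 h3 nw uw; rewrite [rweight r i * unorm]mulrC; lra.
Qed.

Lemma nrm_btab i j : nrm (rweight r) (btab i j) <= 1 * (rweight r i * rweight r j).
Proof.
have wi := rweight_ge0 i; have wj := rweight_ge0 j.
rewrite /btab; case: ifP => _; first by rewrite nrm_nil mul1r mulr_ge0.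
case: ifP => [/eqP i1|_]; last exact: nrm_ptab.
apply: le_trans (nrm_ctab _ _) _; rewrite mul1r ler_wpM2r// /rweight /mweight i1 expr1.
by rewrite ler_peMr ?exprn_ge0 ?(ltW r0)//; lra.
Qed.

(** The source of smallness: once exponent m is discarded, every remaining exponent is at least m +
    1, which gains a factor r over the weight r^m of the argument. *)
Lemma nrm_keep_gt m s : supp (fun i : idx => (m <= i.1)%N) s ->
  nrm (rweight r) (keep (fun i => i.1 != m) s) <= r ^+ m.+1 * nrm (rweight 1) s.
Proof.
elim: s => [|t s IH] /=; first by rewrite !nrm_nil mulr0.
move=> /andP[mt ss]; have h := IH ss.
rewrite nrm_cons mulrDr; case: ifP => mt'.
  rewrite nrm_cons; apply: lerD => //; rewrite [leRHS]mulrCA ler_wpM2l//.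
  rewrite /rweight /mweight expr1n mul1r ler_wpM2r ?exprn_ge0//.
  by apply: exp_le_r; rewrite ltn_neqAle eq_sym mt'.
apply: le_trans h _; rewrite lerDr mulr_ge0 ?exprn_ge0 ?(ltW r0)//.
by rewrite mulr_ge0// /rweight /mweight mulr_ge0// exprn_ge0.
Qed.

End Bounds.

Lemma supp_dtab i : supp (fun j : idx => (i.1 <= j.1)%N) (dtab i).
Proof.
have U0 : supp (fun j : idx => true) ulist by rewrite /supp; elim: ulist.
rewrite /dtab; case: ifP => _.
  by apply: supp_lin U0 _ => j _; rewrite /supp/= andbT -addnA leq_addr.
rewrite !supp_cat; apply/and3P; split.
- by rewrite /supp/= add0n leq_addr.
- by apply: supp_lin U0 _ => j _; rewrite /supp/= andbT -!addnA !leq_addr.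
- apply: supp_lin U0 _ => j _; rewrite /supp/= andbT.
  by rewrite [(j.1 + i.1)%N]addnC -!addnA !leq_addr.
Qed.

Definition rescst : R := nrm (rweight 1) restab.

Lemma rescst_ge0 : 0 <= rescst.
Proof. by apply: nrm_ge0 => i; exact: rweight_ge0. Qed.

Section Solution.
Variable r : R.
Hypothesis r0 : 0 < r.
Hypothesis r1 : r <= 1.
Hypothesis rl : r * (D * dcst) <= 4^-1.
Hypothesis rg : 8 * D * (D * (r * rescst)) <= 1.

Local Notation W := (rweight r).

Lemma nrm_w_g : nrm W w_g <= D * (r * rescst).
Proof.
apply: le_trans (nrm_linvtab r0 _) _; rewrite ler_wpM2l//.
have := @nrm_keep_gt r r0 r1 0 restab; rewrite expr1; apply.
by rewrite /supp; elim: restab.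
Qed.

Lemma nrm_w_l i : nrm W (w_l i) <= 4^-1 * W i.
Proof.
apply: le_trans (nrm_linvtab r0 _) _.
apply: (@le_trans _ _ (r * (D * dcst) * W i)); last by rewrite ler_wpM2r// rweight_ge0.
have h := nrm_keep_gt r0 r1 (supp_dtab i).
have h2 := nrm_dtab ltr01 (lexx 1) i.
apply: le_trans (ler_wpM2l D0 h) _.
rewrite [leRHS](_ : _ = D * (r ^+ i.1.+1 * (dcst * 2 ^+ i.2))); last first.
  by rewrite /rweight /mweight exprS; ring.
rewrite ler_wpM2l// ler_wpM2l ?exprn_ge0 ?(ltW r0)//.
by apply: le_trans h2 _; rewrite /rweight /mweight expr1n mul1r.
Qed.

Lemma nrm_w_B i j : nrm W (w_B i j) <= D * (W i * W j).
Proof.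
apply: le_trans (nrm_linvtab r0 _) _; rewrite ler_wpM2l//.
by have := nrm_btab r0 r1 i j; rewrite mul1r.
Qed.

Let W0 := rweight_ge0 r0.

Lemma w_Z_bounded : abs_bounded (fun n => nrm W (w_Z n)) (2 * (D * (r * rescst))).
Proof. exact: (qsol_bounded W0 nrm_w_g nrm_w_l nrm_w_B D0 rg). Qed.

(** No term of the expansion has exponent 0 in a, so at a = 0 the unknowns take their prescribed
    values. *)
Lemma w_Z_supp m : supp (fun i : idx => i.1 != 0%N) (w_Z m).
Proof.
pose P (i : idx) := i.1 != 0%N.
have linvP s : supp P s -> supp P (lin linvtab s).
  move=> sP; apply: supp_lin sP _ => i Pi; rewrite /supp /linvtab all_map.
  by apply/allP => t _.
apply: qsol_supp.
- by apply: linvP; exact: supp_keep.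
- move=> i Pi; apply: linvP; rewrite /supp all_filter.
  have := supp_dtab i; rewrite /supp; apply: sub_all => t it; apply/implyP => _.
  by rewrite /P -lt0n; apply: leq_trans it; rewrite lt0n.
- move=> i j Pi Pj; apply: linvP; rewrite /btab; case: ifP => _ //.
  have ij : (0 < i.1 + j.1)%N by rewrite addn_gt0 lt0n Pi.
  by case: ifP => _; rewrite /supp/= /P/= andbT -!lt0n ?andbT !addn_gt0 -addn_gt0 ij.
Qed.

Definition bw (a : R) k : R := w0 k + mcoef w_Z (fun m => a ^+ m) k.

Definition bcoef (a : R) k : R := a ^+ d k * (if k == 1%N then 1 else bw a k).

Lemma bw0 k : bw 0 k = w0 k.
Proof.
rewrite /bw /mcoef (lev_supp0 w_Z_supp) ?addr0// => i i0.
by rewrite expr0n (negbTE i0) mul0r.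
Qed.

Section AtAmplitude.
Variable a : R.
Hypothesis ar : `|a| <= r.

Let pow_le m : `|a ^+ m| <= 1 * r ^+ m.
Proof. by rewrite mul1r normrX lerXn2r ?nnegrE// ltW. Qed.

Let a_le1 k : `|a ^+ k| <= 1.
Proof. by rewrite normrX exprn_ile1// (le_trans ar). Qed.

Let pow_add_le m k : `|a ^+ (m + k)| <= r ^+ m.
Proof.
rewrite exprD normrM; apply: le_trans (ler_wpM2l (normr_ge0 _) (a_le1 k)) _.
by rewrite mulr1; have := pow_le m; rewrite mul1r.
Qed.

Lemma evE_le x i : `|evE a x i| <= 1 * W i.
Proof.
rewrite mul1r /evE normrM /rweight /mweight/=; apply: ler_pM => //.
by apply: le_trans (cos_max _) _; rewrite exprn_ege1// ler1n.
Qed.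

Lemma evV_le x i : `|evV a x i| <= W i.
Proof.
rewrite /evV; case: ifP => _; first by rewrite normr0.
rewrite /evU normrM /rweight /mweight/=; apply: ler_pM => //.
by apply: le_trans (cos_max _) _; rewrite exprn_ege1// ler1n.
Qed.

Lemma chi_le i : `|chi a i| <= W i.
Proof.
rewrite /chi; case: ifP => _; last by rewrite normr0.
apply: le_trans (pow_add_le _ _) _; rewrite /rweight /mweight/=.
by rewrite ler_peMr ?exprn_ge0 ?(ltW r0)// exprn_ege1// ler1n.
Qed.

Definition dfac k : R := (k != 1%N)%:R * a ^+ d k.

Lemma dfac_le1 k : `|dfac k| <= 1.
Proof.
by rewrite /dfac normrM normr_nat; case: (k != 1%N); rewrite ?mul1r ?mul0r.
Qed.

Lemma dfac_le k : `|dfac k| <= 1 * 2 ^+ k.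
Proof.
rewrite mul1r; apply: (le_trans (dfac_le1 k)).
by rewrite exprn_ege1// ler1n.
Qed.

Lemma evVE x i : evV a x i = a ^+ i.1 * (dfac i.2 * cos (i.2%:R * x)).
Proof.
rewrite /evV /dfac; case: (i.2 == 1%N); rewrite /= ?mul0r ?mulr0// mul1r /evU exprD.
by rewrite mulrA.
Qed.

Lemma lev_evV x : levp w_Z (evV a x) =
  cos_series (fun k => dfac k * mcoef w_Z (fun m => a ^+ m) k) x.
Proof.
rewrite (eq_lev _ (evVE x)).
exact: (mcoef_cos_series w_Z_bounded x ler01 pow_le ler01 dfac_le).
Qed.

Lemma lev_lam_evV x : levp w_Z (fun i => lam i.2 * evV a x i) =
  cos_series (fun k => lam k * (dfac k * mcoef w_Z (fun m => a ^+ m) k)) x.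
Proof.
have [C C0 hC] := @poly_le_exp R 4 2 (ltr1n _ _).
have h k : `|lam k * dfac k| <= C * 2 ^+ k.
  rewrite normrM; apply: le_trans (le_trans (norm_lam_le K k) (hC k)).
  by rewrite ler_piMr// dfac_le1.
have := mcoef_cos_series w_Z_bounded x ler01 pow_le (ltW C0) h.
have -> : (fun k => lam k * dfac k * mcoef w_Z (fun m => a ^+ m) k) =
  (fun k => lam k * (dfac k * mcoef w_Z (fun m => a ^+ m) k)).
  by apply/funext => k; rewrite mulrA.
by move=> <-; apply: eq_lev => i; rewrite evVE; ring.
Qed.

Lemma lev_chi : levp w_Z (chi a) = a ^+ e * mcoef w_Z (fun m => a ^+ m) 1.
Proof.
have h (i : idx) : `|a ^+ i.1 * (i.2 == 1%N)%:R| <= 1 * 1 * W i.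
  apply: (@mode_bound _ _ _ (fun m => a ^+ m) (fun k' => (k' == 1%N)%:R)) => //.
  exact: ind_le.
have D1 : (0 : R) <= 1 * 1 by rewrite mul1r.
rewrite /mcoef -(levZ w_Z_bounded _ D1 h); apply: eq_lev => i.
by rewrite /chi; case: (i.2 == 1%N); rewrite ?mulr1 ?mulr0// exprD mulrC.
Qed.

(** [qsol_eq] read through [evF]: residual, linearization and quadratic part recombine into the
    Kawahara equation for the leading profile plus the increment, with the velocity increment in
    [chi]. *)
Lemma branch_identity0 x :
  ev (fun i => lam i.2 * evU a x i) ulist + levp w_Z (fun i => lam i.2 * evV a x i) +
  (w0 1 * a ^+ e + levp w_Z (chi a)) * (Ulead a x + levp w_Z (evV a x)) +
  (Ulead a x + levp w_Z (evV a x)) ^+ 2 = 0.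
Proof.
have [C C0 hC] := @poly_le_exp R 4 2 (ltr1n _ _).
(* One constant dominating every functional involved, since [qsol_eq] takes a single bound. *)
pose G : R := dcst + C + 3 + `|Ulead a x| + `|w0 1 * a ^+ e + 2 * Ulead a x|.
have c0 : 0 <= dcst by rewrite addr_ge0// mulr_ge0// unorm_ge0.
have nU := normr_ge0 (Ulead a x); have nV := normr_ge0 (w0 1 * a ^+ e + 2 * Ulead a x).
have G0 : 0 <= G by move: nU nV (ltW C0) c0; rewrite /G; lra.
have le1 (f : idx -> R) B : B <= G -> (forall i, `|f i| <= B * W i) ->
    forall i, `|f i| <= G * W i.
  by move=> BG h i; apply: le_trans (h i) _; rewrite ler_wpM2r// W0.
have lamV i : `|lam i.2 * evV a x i| <= C * W i.
  rewrite evVE mulrCA normrM.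
  apply: le_trans (ler_pM _ _ (pow_le i.1) (_ : _ <= C * 2 ^+ i.2)) _ => //.
    rewrite normrM; apply: le_trans (le_trans (norm_lam_le K i.2) (hC i.2)).
    by rewrite ler_piMr// normrM mulr_ile1// ?cos_max ?dfac_le1.
  by rewrite /rweight /mweight le_eqVlt; apply/orP; left; apply/eqP; ring.
have FC i : `|evF a x i| <= (dcst + C) * W i.
  case: i => m q; rewrite -lead_dtab mulrDl.
  apply: le_trans (ler_normD _ _) _; apply: lerD; last exact: (lamV (m, q)).
  apply: le_trans (_ : _ <= 1 * nrm W (dtab (m, q))) _.
    apply: norm_ev_le => i; rewrite normrM normr_nat.
    apply: le_trans (evE_le x i); rewrite ler_piMl//.
    by case: (_ == _).
  by rewrite mul1r; exact: nrm_dtab.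
have F2 i : `|- (chi a i + evV a x i)| <= 2 * W i.
  rewrite normrN; apply: le_trans (ler_normD _ _) _.
  by have := chi_le i; have := evV_le x i; lra.
have V1 i : `|evV a x i| <= 1 * W i by rewrite mul1r; exact: evV_le.
have X1 i : `|chi a i| <= 1 * W i by rewrite mul1r; exact: chi_le.
have b1 : dcst + C <= G by rewrite /G; lra.
have b2 : C <= G by rewrite /G; lra.
have b3 : 2 <= G by rewrite /G; lra.
have b4 : 1 <= G by rewrite /G; lra.
have FG := le1 _ _ b1 FC.
have LG := le1 _ _ b2 lamV.
have NG := le1 _ _ b3 F2.
have VG := le1 _ _ b4 V1.
have XG := le1 _ _ b4 X1.
have := qsol_eq W0 nrm_w_g nrm_w_l nrm_w_B D0 rg G0 FG NG VG
   (fun i j => ev_evF_B a x i j).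
rewrite -/w_Z (ev_evF_g a x) ev_restab.
pose q1 (i : idx) := Ulead a x * chi a i.
pose q2 (i : idx) := (w0 1 * a ^+ e + 2 * Ulead a x) * evV a x i.
have Q1 i : `|q1 i| <= `|Ulead a x| * G * W i.
  by rewrite normrM -mulrA ler_wpM2l//; exact: XG.
have Q2 i : `|q2 i| <= `|w0 1 * a ^+ e + 2 * Ulead a x| * G * W i.
  by rewrite normrM -mulrA ler_wpM2l//; exact: VG.
have Q10 : 0 <= `|Ulead a x| * G by rewrite mulr_ge0.
have Q20 : 0 <= `|w0 1 * a ^+ e + 2 * Ulead a x| * G by rewrite mulr_ge0.
pose q12 i := q1 i + q2 i.
have Q12 i : `|q12 i| <= (`|Ulead a x| * G + `|w0 1 * a ^+ e + 2 * Ulead a x| * G) * W i.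
  by rewrite mulrDl; apply: le_trans (ler_normD _ _) _; exact: lerD.
have Q120 := addr_ge0 Q10 Q20.
pose q3 i := q12 i + lam i.2 * evV a x i.
have Q3 i : `|q3 i| <= (`|Ulead a x| * G + `|w0 1 * a ^+ e + 2 * Ulead a x| * G + G) * W i.
  by rewrite mulrDl; apply: le_trans (ler_normD _ _) _; apply: lerD; [exact: Q12|exact: LG].
have Q30 := addr_ge0 Q120 G0.
have NQ3 i : `|-1 * q3 i| <= (`|Ulead a x| * G + `|w0 1 * a ^+ e + 2 * Ulead a x| * G + G) * W i.
  by rewrite mulN1r normrN.
have -> : levp w_Z (fun i => ev (evF a x) (w_l i)) =
    levp w_Z (evF a x) - levp w_Z q3.
  rewrite -mulN1r -(levZ w_Z_bounded _ Q30 Q3).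
  rewrite -(levD w_Z_bounded G0 FG Q30 NQ3).
  by apply: eq_lev => i; rewrite ev_evF_l ev_dtab /q3 /q12 /q1 /q2; ring.
have -> : levp w_Z q3 = levp w_Z q12 + levp w_Z (fun i => lam i.2 * evV a x i).
  exact: (levD w_Z_bounded Q120 Q12 G0 LG).
have -> : levp w_Z q12 = levp w_Z q1 + levp w_Z q2.
  exact: (levD w_Z_bounded Q10 Q1 Q20 Q2).
have -> : levp w_Z q1 = Ulead a x * levp w_Z (chi a).
  exact: (levZ w_Z_bounded _ G0 XG).
have -> : levp w_Z q2 = (w0 1 * a ^+ e + 2 * Ulead a x) * levp w_Z (evV a x).
  exact: (levZ w_Z_bounded _ G0 VG).
have -> : levp w_Z (fun i => - (chi a i + evV a x i)) =
    - (levp w_Z (chi a) + levp w_Z (evV a x)).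
  rewrite -(levD w_Z_bounded G0 XG G0 VG) -mulN1r.
  have h i : `|chi a i + evV a x i| <= G * W i by rewrite -normrN; exact: NG.
  by rewrite -(levZ w_Z_bounded _ G0 h); apply: eq_lev => i; rewrite mulN1r.
by move=> /eqP; rewrite -subr_eq0 => /eqP h; rewrite -[RHS]h; ring.
Qed.

Lemma bcoefE k : bcoef a k = a ^+ d k * uhat k +
  dfac k * mcoef w_Z (fun m => a ^+ m) k.
Proof.
rewrite /bcoef /bw /uhat /dfac; case: (k == 1%N); first by rewrite /= !mul0r addr0.
by rewrite /= mul1r mulrDr.
Qed.

Lemma uhat0 k : (n <= k)%N -> uhat k = 0.
Proof.
move=> nk; rewrite /uhat w0n// gtn_eqF//.
by apply: leq_trans nk; exact: leq_ltn_trans (ltnW hK) hn.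
Qed.

Lemma rapid_mcoef : rapid (fun k => dfac k * mcoef w_Z (fun m => a ^+ m) k).
Proof.
have rm := mcoef_rapid w_Z_bounded ler01 pow_le.
move=> j; have [S hS] := rm j; exists S; apply: abs_bounded_le_norm hS => k.
by rewrite mulrCA normrM ler_piMl// dfac_le1.
Qed.

Lemma rapid_lam c : rapid c -> rapid (fun k => lam k * c k).
Proof.
move=> rc; have -> : (fun k => lam k * c k) = fun k => vel0 K * c k +
   (-1 * (k%:R ^+ 2 * c k) + beta K * (k%:R ^+ 4 * c k)).
  by apply/funext => k; rewrite -lamE; ring.
by apply: rapidD; [exact: rapidZ|apply: rapidD; apply: rapidZ; exact: rapidM].
Qed.

Lemma branch_identity x :
  cos_series (fun k => lam k * bcoef a k) x +
  a ^+ e * bw a 1 * cos_series (bcoef a) x + cos_series (bcoef a) x ^+ 2 = 0.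
Proof.
have z k : (n <= k)%N -> a ^+ d k * uhat k = 0 by move=> nk; rewrite uhat0// mulr0.
have lz k : (n <= k)%N -> lam k * (a ^+ d k * uhat k) = 0 by move=> nk; rewrite z// mulr0.
have E1 : cos_series (bcoef a) x = Ulead a x + levp w_Z (evV a x).
  rewrite (funext bcoefE) cos_seriesD; [|exact: rapid_finite z|exact: rapid_mcoef].
  rewrite lev_evV (cos_series_finite _ z) /Ulead ev_ulist; congr (_ + _).
  by apply: eq_bigr => p _; rewrite /evU/= add0n; ring.
have E2 : cos_series (fun k => lam k * bcoef a k) x =
    ev (fun i => lam i.2 * evU a x i) ulist + levp w_Z (fun i => lam i.2 * evV a x i).
  have -> : (fun k => lam k * bcoef a k) = fun k => lam k * (a ^+ d k * uhat k) +
     lam k * (dfac k * mcoef w_Z (fun m => a ^+ m) k).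
    by apply/funext => k; rewrite bcoefE mulrDr.
  rewrite cos_seriesD; [|exact: rapid_finite lz|exact: rapid_lam rapid_mcoef].
  rewrite lev_lam_evV (cos_series_finite _ lz) ev_ulist; congr (_ + _).
  by apply: eq_bigr => p _; rewrite /evU/= add0n; ring.
rewrite -[RHS](branch_identity0 x) E1 E2 lev_chi /bw; ring.
Qed.

Definition wcst : R := \sum_(k < n) `|w0 k| * 2 ^+ k.

Lemma bw_geom : geom (bw a) (wcst + 2 * (D * (r * rescst))).
Proof.
have S0 := abs_bounded_ge0 w_Z_bounded.
move=> k; rewrite /bw mulrDl; apply: le_trans (ler_normD _ _) _; apply: lerD.
  rewrite ler_pdivlMr ?exprn_gt0//; have [nk|kn] := leqP n k.
    rewrite w0n// normr0 mul0r; apply: sumr_ge0 => j _.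
    by rewrite mulr_ge0// exprn_ge0.
  rewrite /wcst (bigD1 (Ordinal kn))//= lerDl; apply: sumr_ge0 => j _.
  by rewrite mulr_ge0// exprn_ge0.
have g := mcoef_geom w_Z_bounded ler01 pow_le.
apply: le_trans (g k) _; rewrite ler_wpM2r ?invr_ge0 ?exprn_ge0//.
by rewrite -[leRHS]mul1r; apply: (msize_le w_Z_bounded).
Qed.

End AtAmplitude.

(** Each monomial a^m is expanded at x. The truncated expansions are bounded by r^m when x and h are
    within r / 2, and are eventually exact, so dominated convergence sums them to a power series in
    h. *)
Lemma bw_analytic k (x : R) : `|x| < r / 2 -> analytic_at (bw^~ k) x.
Proof.
move=> /ltW xr; pose s := r / 2.
have s0 : 0 < s by rewrite divr_gt0.
have ss : s + s = r by rewrite /s; field.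
pose tc j m := taylor_coef x m j.
exists (fun j => (j == 0%N)%:R * w0 k + mcoef w_Z (tc j) k), s; split => // h /ltW hs.
have hr m N : `|\sum_(j < N) h ^+ j * tc j m| <= 1 * r ^+ m.
  rewrite mul1r; apply: le_trans (ler_norm_sum _ _ _) _.
  apply: le_trans (taylor_sum_norm_le _ _ _ _) _.
  by rewrite lerXn2r ?nnegrE ?addr_ge0 ?(ltW r0)// -ss lerD.
have tcr j m : `|h ^+ j * tc j m| <= 1 * r ^+ m.
  rewrite mul1r; apply: le_trans (_ : _ <= (`|x| + `|h|) ^+ m) _; last first.
    by rewrite lerXn2r ?nnegrE ?addr_ge0 ?(ltW r0)// -ss lerD.
  apply: le_trans (taylor_sum_norm_le x h m j.+1).
  by rewrite big_ord_recr/= lerDr; apply: sumr_ge0 => i _; exact: normr_ge0.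
have tcs j m : `|tc j m| <= (s ^+ j)^-1 * r ^+ m.
  rewrite ler_pdivlMl ?exprn_gt0//; apply: le_trans (taylor_coef_le x m j (ltW s0)) _.
  by rewrite lerXn2r ?nnegrE ?addr_ge0 ?(ltW r0) ?(ltW s0)// -ss lerD2r.
have sj j : 0 <= (s ^+ j)^-1 by rewrite invr_ge0 exprn_ge0// ltW.
have bnd (f : nat -> R) B : 0 <= B -> (forall m, `|f m| <= B * r ^+ m) ->
    forall i : idx, `|f i.1 * (i.2 == k)%:R| <= B * W i.
  move=> B0 fB i; rewrite -[B]mulr1.
  by apply: (@mode_bound _ _ _ f (fun k' => (k' == k)%:R)) => //; exact: ind_le.
pose P N m := \sum_(j < N) h ^+ j * tc j m.
have cv : levp w_Z (fun i => P N i.1 * (i.2 == k)%:R) @[N --> \oo] -->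
    mcoef w_Z (fun m => (x + h) ^+ m) k.
  apply: (cvg_lev w_Z_bounded ler01) => [N|i].
    exact: (bnd (P N) 1 ler01 (fun m => hr m N)).
  apply: cvg_near_cst; near=> N.
  by rewrite /P taylor_sum//; near: N; exists i.1.+1.
have cv2 : (fun N => w0 k + levp w_Z (fun i => P N i.1 * (i.2 == k)%:R)) @ \oo -->
    bw (x + h) k.
  by apply: cvgD => //; exact: cvg_cst.
apply: cvg_trans cv2; apply: near_eq_cvg; near=> N.
rewrite /pseries /series/= big_mkord.
have N0 : (0 < N)%N by near: N; exists 1%N.
have -> : \sum_(j < N) ((j == 0%N :> nat)%:R * w0 k + mcoef w_Z (tc j) k) * h ^+ j =
   \sum_(j < N) (j == 0%N :> nat)%:R * w0 k * h ^+ j + \sum_(j < N) mcoef w_Z (tc j) k * h ^+ j.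
  by rewrite -big_split/=; apply: eq_bigr => j _; rewrite mulrDl.
congr (_ + _).
  rewrite (bigD1 (Ordinal N0))//= mul1r expr0 mulr1 big1 ?addr0// => j.
  by rewrite -val_eqE/= => /negbTE ->; rewrite !mul0r.
have -> : levp w_Z (fun i => P N i.1 * (i.2 == k)%:R) =
    levp w_Z (fun i => \sum_(j < N) h ^+ j * tc j i.1 * (i.2 == k)%:R).
  by apply: eq_lev => i; rewrite /P mulr_suml.
rewrite (@lev_sum _ _ W _ _ w_Z_bounded N (fun=> 1)
  (fun j i => h ^+ j * tc j i.1 * (i.2 == k)%:R)) => [|//|j]; last exact: (bnd _ 1 ler01 (tcr j)).
apply: eq_bigr => j _; rewrite mulrC /mcoef -(levZ w_Z_bounded _ (sj j) (bnd _ _ (sj j) (tcs j))).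
by apply: eq_lev => i; rewrite -mulrA.
Unshelve. all: by end_near. Qed.

End Solution.

End Branch.

(** * Operations preserving analyticity *)

Section AnalyticClosure.
Context {R : realType}.
Implicit Types (f g : R -> R) (x a : R).

Lemma analytic_atZ f a x : analytic_at f x -> analytic_at (fun y => a * f y) x.
Proof.
move=> [c [r [r0 h]]]; exists (fun n => a * c n), r; split => // y yr.
have cv : (fun N => a * pseries c y N) @ \oo --> a * f (x + y).
  by apply: cvgM; [exact: cvg_cst|exact: h].
apply: cvg_trans cv; apply: near_eq_cvg; apply: nearW => N.
by rewrite /pseries /series/= mulr_sumr; apply: eq_bigr => i _; rewrite mulrA.
Qed.

Lemma analytic_atX f x : analytic_at f x -> analytic_at (fun y => y * f y) x.
Proof.
move=> [c [r [r0 h]]].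
(* The factor is x + h in the local variable h: x multiplies each coefficient and h shifts the
   sequence by one. *)
exists (fun n => x * c n + (if n is n'.+1 then c n' else 0)), r; split => // y yr.
have cv : (fun N => x * pseries c y N.+1 + y * pseries c y N) @ \oo --> (x + y) * f (x + y).
  rewrite mulrDl; apply: cvgD; apply: cvgM; try exact: cvg_cst; last exact: h.
  by have := h y yr; rewrite -cvg_shiftS.
rewrite -cvg_shiftS; apply: cvg_trans cv; apply: near_eq_cvg; apply: nearW => N.
rewrite /pseries /series/= !mulr_sumr.
under [RHS]eq_bigr do rewrite mulrDl.
rewrite big_split/=; congr (_ + _); first by apply: eq_bigr => i _; rewrite mulrA.
rewrite [RHS]big_nat_recl//= mul0r add0r; apply: eq_bigr => i _.
by rewrite exprS; ring.
Qed.

Lemma analytic_atXn f x n : analytic_at f x -> analytic_at (fun y => y ^+ n * f y) x.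
Proof.
move=> af; elim: n => [|n IH].
  by under eq_fun do rewrite expr0 mul1r.
by under eq_fun do rewrite exprS -mulrA; exact: analytic_atX IH.
Qed.

End AnalyticClosure.

(** * From leading-order data to a Wilton branch *)

Section Wilton.
Context {R : realType} (K : nat).
Hypothesis hK : (2 <= K)%N.
Variables (d : nat -> nat) (e n : nat) (w0 : nat -> R).
Hypothesis e0 : (0 < e)%N.
Hypothesis hn : (K < n)%N.
Hypothesis w0n : forall k, (n <= k)%N -> w0 k = 0.
Hypothesis dS : forall p q, (eorder K d e (p + q) <= d p + d q)%N.
Hypothesis dD : forall p q, (eorder K d e (distn' p q) <= d p + d q)%N.
Hypothesis d_gt0 : forall k, (0 < d k)%N.
Hypothesis d1 : d 1%N = 1%N.
Hypothesis lead_res0 : forall phi, lead_res K d e n w0 phi = 0.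

Hypothesis lead_diag : forall q, (n <= q)%N -> forall phi,
  lead_lin K d e n w0 phi q = lam K q * phi q.
Hypothesis lead_supp : forall q, (q < n)%N -> forall phi : nat -> R,
  (forall k, (k < n)%N -> phi k = 0) -> lead_lin K d e n w0 phi q = 0.
Hypothesis lead_inj : forall z : nat -> R,
  (forall k, (k < n)%N ->
     \sum_(q < n) z q * lead_lin K d e n w0 (delta_seq k) q = 0) ->
  forall q, (q < n)%N -> z q = 0.

Definition profile (b : nat -> R) (a : R) k : R :=
  a ^+ d k * (if k == 1%N then 1 else b k).

(** [lead_lin] as an explicit formal combination, the form in which the operator can be inverted. *)
Definition lead_table q : @fsum R nat :=
  (if q == 1%N then [:: (1, 1%N); (w0 K, K)]
   else [:: (lam K q, q); (if q == K then w0 1 else 0, K)] ++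
     scl 2 (flatten [seq [:: (uhat w0 p * (2^-1 * (d p + d q == eorder K d e (p + q))%N%:R), (p + q)%N);
        (uhat w0 p * (2^-1 * (d p + d q == eorder K d e (distn' p q))%N%:R), distn' p q)]
       | p <- iota 0 n])).

Lemma ev_lead_table phi q : ev phi (lead_table q) = lead_lin K d e n w0 phi q.
Proof.
rewrite /lead_table /lead_lin; case: ifP => _.
  by rewrite !ev_cons ev_nil/= mul1r addr0.
rewrite ev_cat ev_scl !ev_cons ev_nil/= addr0 ev_flatten big_map.
rewrite (_ : iota 0 n = index_iota 0 n) ?big_mkord; last by rewrite /index_iota subn0.
congr (_ + _ + 2 * _); first by case: (q == K); rewrite ?mul0r.
by apply: eq_bigr => p _; rewrite !ev_cons ev_nil/= addr0 /theta; ring.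
Qed.

Lemma lead_inverse : exists (linv : nat -> @fsum R nat) (D : R), 0 <= D /\ forall k,
    nrm (fun k => 2 ^+ k) (linv k) <= D * 2 ^+ k /\
    forall phi, ev (fun q => lead_lin K d e n w0 phi q) (linv k) = phi k.
Proof.
have [|q nq|q nq|q qn phi h|z h|linv [D [D0 hD]]] :=
  @table_right_inverse R n lead_table (lam K) (2 / beta K).
- by rewrite divr_ge0// ltW// beta_gt0.
- by move=> phi; rewrite ev_lead_table lead_diag.
- have qa : active K q.
    by rewrite /active; move: hn nq hK; lia.
  have := lamx_neq0 (R := R) K q; have := norm_lamx_inv (R := R) K q.
  by rewrite /lamx qa.
- by rewrite ev_lead_table; exact: lead_supp.
- apply: lead_inj => k kn; rewrite -[RHS](h k kn).
  by apply: eq_bigr => q _; rewrite ev_lead_table.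
exists linv, D; split => // k; have [h1 h2] := hD k; split => // phi.
rewrite -[RHS]h2 ev_lin; apply: eq_ev => q; by rewrite ev_lead_table.
Qed.

Lemma branch_exists : exists (r M : R) (b : R -> nat -> R),
  [/\ 0 < r, r <= 1,
      (forall k (x : R), `|x| < r / 2 -> analytic_at (b^~ k) x),
      (forall k, b 0 k = w0 k) &
      forall a, `|a| <= r -> geom (b a) M /\
        forall x, cos_series (fun k => lam K k * profile (b a) a k) x +
          a ^+ e * b a 1%N * cos_series (profile (b a) a) x +
          cos_series (profile (b a) a) x ^+ 2 = 0].
Proof.
have [linv [D [D0 hD]]] := lead_inverse.
have linvD k := (hD k).1; have linvK phi k := (hD k).2 phi.
pose X := D * dcst n w0; pose Y := 8 * D * (D * rescst K d e n w0).
have X0 : 0 <= X by rewrite mulr_ge0// addr_ge0// mulr_ge0// unorm_ge0.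
have Y0 : 0 <= Y by rewrite !mulr_ge0// rescst_ge0.
(* One value meeting all three conditions r <= 1, r X <= 1/4 and r Y <= 1. *)
pose r := (1 + 4 * X + Y)^-1.
have den : 0 < 1 + 4 * X + Y by lra.
have r0 : 0 < r by rewrite invr_gt0.
have rden : r * (1 + 4 * X + Y) = 1 by rewrite /r mulVf// gt_eqF.
have rX : 0 <= r * X by rewrite mulr_ge0// ltW.
have rY : 0 <= r * Y by rewrite mulr_ge0// ltW.
have rE : r + 4 * (r * X) + r * Y = 1 by rewrite -[RHS]rden; ring.
have r1 : r <= 1 by lra.
have rl : r * (D * dcst n w0) <= 4^-1 by rewrite -/X; lra.
have rg : 8 * D * (D * (r * rescst K d e n w0)) <= 1.
  by rewrite [leLHS](_ : _ = r * Y); [lra|rewrite /Y; ring].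
exists r, (wcst n w0 + 2 * (D * (r * rescst K d e n w0))), (bw K d e n w0 linv).
split => //.
- move=> k x xr; exact: (bw_analytic D0 linvD r0 r1 rl rg).
- by move=> k; exact: bw0.
- move=> a ar; split; first exact: (bw_geom w0n D0 linvD r0 r1 rl rg ar).
  move=> x; exact: (branch_identity hK e0 hn w0n dS dD lead_res0 D0 linvD linvK r0 r1 rl rg ar).
Qed.

Variable ur : R -> R -> R -> R -> R.
Hypothesis hur : is_ur K ur.

Lemma wilton_branch : exists (b : R -> nat -> R) (eps M : R),
  [/\ 0 < eps,
      (forall k (x : R), `|x| < eps -> analytic_at (b^~ k) x),
      (forall k, b 0 k = w0 k),
      (forall a, `|a| < eps -> geom (b a) M) &
      forall a, `|a| < eps ->
        kawahara K (vel0 K + a ^+ e * b a 1%N) (cos_series (profile (b a) a)) /\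
        forall x, cos_series (profile (b a) a) x =
          a * cos x + a ^+ d K * b a K * cos (K%:R * x) +
          ur a (a ^+ d K * b a K) (a ^+ e * b a 1%N) x].
Proof.
have [r [M [b [r0 r1 ban b0 hb]]]] := branch_exists.
have [_ [eu [du [eu0 du0 hu]]]] := hur.
have [C C0 hC] := H_norm_geom (R := R) 4.
have h00 : `|0 : R| <= r by rewrite normr0 ltW.
have M0 : 0 <= M := geom_ge0 (hb 0 h00).1.
have Mu : 0 < (M + 1)^-1 by rewrite invr_gt0; lra.
have CM0 : 0 <= C * M by rewrite mulr_ge0.
(* The bounds secure analyticity of the unknowns, place the arguments of [ur] in its neighbourhood,
   and keep the H^4 norm of the nonresonant part below its uniqueness radius. *)
pose eps := Num.min (r / 2) (Num.min (eu / (M + 1)) (du / (C * M + 1))).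
have eps0 : 0 < eps by rewrite !lt_min !divr_gt0//; lra.
have K1 : (K == 1%N) = false by rewrite gtn_eqF.
exists b, eps, M; split => //.
- by move=> k x; rewrite lt_min => /andP[+ _]; exact: ban.
- move=> a; rewrite lt_min => /andP[ar _]; apply: (hb a _).1.
  by apply: le_trans (ltW ar) _; lra.
move=> a; rewrite !lt_min => /and3P[ar au ad].
have ar' : `|a| <= r by apply: le_trans (ltW ar) _; lra.
have [g idt] := hb a ar'.
have a1 : `|a| <= 1 by exact: le_trans ar' r1.
rewrite ltr_pdivlMr ?ltr_wpDl// in au; rewrite ltr_pdivlMr ?ltr_wpDl// in ad.
have aM : `|a| * M <= `|a| * (M + 1) by rewrite ler_wpM2l// lerDl.
have a_eu : `|a| < eu.
  by apply: le_lt_trans au; rewrite ler_peMr//; lra.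
have pow_le k : (0 < k)%N -> `|a ^+ k| <= `|a|.
  by case: k => // k _; rewrite normrX exprS ler_piMr// exprn_ile1.
have small j k : (0 < j)%N -> `|a ^+ j * b a k| < eu.
  move=> j0; rewrite normrM; apply: le_lt_trans au; apply: le_trans aM.
  apply: ler_pM => //; first exact: pow_le.
  by apply: le_trans (g k) _; rewrite ler_pdivrMr ?exprn_gt0// ler_peMr// exprn_ege1// ler1n.
set u := cos_series (profile (b a) a).
have rp : rapid (profile (b a) a).
  have rb := geom_rapid g.
  have -> : profile (b a) a = fun k =>
      a ^+ d k * b a k + (a - a * b a 1%N) * delta_seq 1 k.
    apply/funext => k; rewrite /profile /delta_seq; have [->|_] := eqVneq k 1%N.
      by rewrite d1 expr1 /= !mulr1; ring.
    by rewrite mulr0 addr0.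
  apply: rapidD; last by apply: rapidZ; exact: rapid_delta.
  move=> j; have [S hS] := rb j; exists S; apply: abs_bounded_le_norm hS => k.
  by rewrite mulrCA normrM ler_piMl// normrX exprn_ile1.
pose w k := if active K k then profile (b a) a k else 0.
have rw : rapid w.
  move=> j; have [S hS] := rp j; exists S; apply: abs_bounded_le_norm hS => k.
  by rewrite /w; case: ifP => _; rewrite ?mulr0 ?normr0.
have w1 : w 1%N = 0 by rewrite /w /active eqxx.
have wK : w K = 0 by rewrite /w /active eqxx andbF.
(* Every exponent [d k] is positive, so the nonresonant part carries a factor |a|. *)
have gw : geom w (`|a| * M).
  move=> k; rewrite /w; case: ifP => [/andP[k1 _]|_].
    rewrite /profile (negbTE k1) normrM -mulrA; apply: ler_pM => //; exact: pow_le.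
  by rewrite normr0 divr_ge0 ?exprn_ge0// mulr_ge0.
have uE x : u x = phi K a (a ^+ d K * b a K) x + cos_series w x.
  rewrite /u; have -> : profile (b a) a = fun k => w k +
     (a * delta_seq 1 k + a ^+ d K * b a K * delta_seq K k).
    apply/funext => k; rewrite /w /profile /active /delta_seq.
    have [->|k1] := eqVneq k 1%N.
      by rewrite eq_sym K1 d1 expr1 /= !mulr1 mulr0 add0r addr0.
    have [->|kK] := eqVneq k K; rewrite /= ?mulr0 ?addr0 ?add0r ?mulr1//.
  have rd j y : rapid (fun k => y * delta_seq j k).
    by apply: rapidZ; exact: rapid_delta.
  rewrite cos_seriesD//; last exact: rapidD.
  rewrite cos_seriesD// (cos_series_delta (fun=> a)).
  by rewrite (cos_series_delta (fun=> a ^+ d K * b a K)) mul1r /phi addrC.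
have lw : (fun k => lam K k * w k) = fun k => lam K k * profile (b a) a k.
  apply/funext => k; rewrite /w; case: ifP => // /negbT ka.
  by rewrite lam_inactive// !mul0r.
have [np aux] : null_perp K (cos_series w) /\
    auxiliary_equation K a (a ^+ d K * b a K) (a ^+ e * b a 1%N) (cos_series w).
  (* The residual is minus the velocity correction times the resonant part of the profile: the
     auxiliary equation applies that correction to the nonresonant part only. *)
  apply: (@aux_of_identity _ _ hK _ _ _ (- (a ^+ e * b a 1%N * a))
     (- (a ^+ e * b a 1%N * (a ^+ d K * b a K))) w rw w1 wK) => x.
  have h := idt x; rewrite -/u in h.
  have wE : cos_series w x = u x - phi K a (a ^+ d K * b a K) x by rewrite uE; ring.
  by rewrite lw -uE wE /phi -[RHS]addr0 -[X in _ = _ + X]h; ring.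
have [_ _ _ uniq] := hu a (a ^+ d K * b a K) (a ^+ e * b a 1%N) a_eu
  (small _ _ (d_gt0 K)) (small _ _ e0).
have nw : H_norm 4 (cos_series w) < du.
  apply: le_lt_trans (hC _ _ gw) _; apply: le_lt_trans ad.
  by rewrite mulrCA ler_wpM2l// lerDl.
split; last by move=> x; rewrite uE /phi (uniq _ np nw aux).
split; first exact: even_periodic_cos_series.
  by move=> j x _; exact: derivable_cser.
move=> x; rewrite cos_series_derive2// cos_series_derive4//.
have := idt x; rewrite -/u.
have r2 : rapid (fun k => - k%:R ^+ 2 * profile (b a) a k).
  by under eq_fun do rewrite mulNr -mulN1r; apply: rapidZ; exact: rapidM.
have r4 : rapid (fun k => k%:R ^+ 4 * profile (b a) a k) by exact: rapidM.
have -> : cos_series (fun k => lam K k * profile (b a) a k) x =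
    vel0 K * u x + (cos_series (fun k => - k%:R ^+ 2 * profile (b a) a k) x +
      beta K * cos_series (fun k => k%:R ^+ 4 * profile (b a) a k) x).
  rewrite -!cos_seriesZ// -!cos_seriesD//.
  - by congr (cos_series _ x); apply/funext => k; rewrite -lamE; ring.
  - exact: rapidZ.
  - exact: rapidD r2 (rapidZ _ r4).
  - exact: rapidZ.
by move=> h; rewrite -[RHS]h; ring.
Qed.

End Wilton.

Ltac expand_lead :=
  rewrite /lead_lin ?/lead_res /theta /eorder /distn' /uhat /delta_seq
    !big_ord_recr !big_ord0 /= ?(mul0r, mulr0, add0r, addr0, mul1r) /addn /subn /=.

(** * Leading-order data for K = 2 *)

Section KTwo.
Context {R : realType}.
Variable b : R.
Hypothesis b2 : b ^+ 2 = 2^-1.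

Definition d2 k : nat := if (k == 1%N) || (k == 2%N) then 1%N else 2%N.

(** Mode 1 of the equation forces velocity -b, and mode 2 then gives b^2 = 1/2. Modes 0, 3, 4 are
    minus the quadratic terms divided by the symbols 4/5, 8, 36. *)
Definition w2 k : R :=
  nth 0 [:: - (15 / 16); - b; b; - b / 8; - (1 / 144)] k.

Lemma lam2E k : lam 2 k = 5^-1 * ((k%:R ^+ 2 - 1) * (k%:R ^+ 2 - 4)) :> R.
Proof. by rewrite /lam /beta; congr (_ * _); [congr (_^-1)|]; ring. Qed.

Lemma d2_order p q k : (eorder 2 d2 1 k <= d2 p + d2 q)%N.
Proof. by rewrite /eorder /d2; do ![case: ifP => ?]; lia. Qed.

Lemma lead_res2 phi : lead_res 2 d2 1 5 w2 phi = 0.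
Proof.
expand_lead; rewrite !lam2E /w2 /=.
transitivity (phi 2%N * (2^-1 - b ^+ 2) + phi 0%N * (2^-1 * (b ^+ 2 - 2^-1)) +
  phi 4%N * (2^-1 * (b ^+ 2 - 2^-1))); first by field.
by rewrite b2; ring.
Qed.

Lemma lead_diag2 q : (5 <= q)%N -> forall phi,
  lead_lin 2 d2 1 5 w2 phi q = lam 2 q * phi q.
Proof.
move=> q5 phi; rewrite /lead_lin gtn_eqF ?gtn_eqF ?(leq_trans _ q5)//.
rewrite big1 ?mulr0 ?addr0// => p _.
have h k : (d2 p + d2 q == eorder 2 d2 1 k)%N = false.
  by rewrite /eorder /d2; do ![case: ifP => ?]; lia.
by rewrite /theta !h !mul0r addr0 !mulr0.
Qed.

Lemma lead_lin2E phi : [/\ lead_lin 2 d2 1 5 w2 phi 0 = 4 / 5 * phi 0%N,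
  lead_lin 2 d2 1 5 w2 phi 1 = phi 1%N + b * phi 2%N,
  lead_lin 2 d2 1 5 w2 phi 2 =
    b * phi 0%N + phi 1%N - b * phi 2%N + phi 3%N + b * phi 4%N,
  lead_lin 2 d2 1 5 w2 phi 3 = 8 * phi 3%N &
  lead_lin 2 d2 1 5 w2 phi 4 = 36 * phi 4%N].
Proof. by split; expand_lead; rewrite ?lam2E /w2 /=; field. Qed.

Lemma lead_supp2 q : (q < 5)%N -> forall phi : nat -> R,
  (forall k, (k < 5)%N -> phi k = 0) -> lead_lin 2 d2 1 5 w2 phi q = 0.
Proof.
move=> q5 phi h; have [E0 E1 E2 E3 E4] := lead_lin2E phi.
have h0 := h 0%N isT; have h1 := h 1%N isT; have h2 := h 2%N isT.
have h3 := h 3%N isT; have h4 := h 4%N isT.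
case: q q5 => [|[|[|[|[|//]]]]] _; rewrite ?E0 ?E1 ?E2 ?E3 ?E4 ?h0 ?h1 ?h2 ?h3 ?h4; ring.
Qed.

(** The nonresonant diagonal entries are nonzero, and the block of velocity and second amplitude has
    determinant -2 b. *)
Lemma lead_inj2 (z : nat -> R) :
  (forall k, (k < 5)%N -> \sum_(q < 5) z q * lead_lin 2 d2 1 5 w2 (delta_seq k) q = 0) ->
  forall q, (q < 5)%N -> z q = 0.
Proof.
move=> h.
have E (k : nat) : (k < 5)%N -> z 0%N * (4 / 5 * delta_seq k 0) +
    z 1%N * (delta_seq k 1 + b * delta_seq k 2) +
    z 2%N * (b * delta_seq k 0 + delta_seq k 1 - b * delta_seq k 2 + delta_seq k 3 +
             b * delta_seq k 4) +
    z 3%N * (8 * delta_seq k 3) + z 4%N * (36 * delta_seq k 4) = 0.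
  move=> /h; have [E0 E1 E2 E3 E4] := lead_lin2E (delta_seq k).
  by rewrite !big_ord_recr big_ord0 /= E0 E1 E2 E3 E4 add0r.
have e0 := E 0%N isT; have e1 := E 1%N isT; have e2 := E 2%N isT.
have e3 := E 3%N isT; have e4 := E 4%N isT.
move: e0 e1 e2 e3 e4; rewrite /delta_seq /= => e0 e1 e2 e3 e4.
have b0 : b != 0.
  by apply/eqP => b0; move: b2; rewrite b0 expr0n /=; lra.
have z12 : z 1%N = - z 2%N by move: e1; lra.
have z2 : z 2%N = 0.
  apply/eqP; rewrite -(mulrI_eq0 _ (mulfI b0)); apply/eqP.
  by move: e2; rewrite z12; lra.
rewrite z2 in z12 e0 e3 e4.
by case=> [|[|[|[|[|//]]]]] _; lra.
Qed.

End KTwo.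

(** * Leading-order data for K = 3 *)

Section KThree.
Context {R : realType}.
Variable b : R.

(* The bifurcation equation for the limit b of the second amplitude. *)
Definition cubic3 : R := - (109 / 189) * b ^+ 3 - b ^+ 2 + 5 / 21 * b + 1 / 3.
Definition dcubic3 : R := - (109 / 63) * b ^+ 2 - 2 * b + 5 / 21.

(** The limit velocity that balances mode 1, with the slaved amplitudes of modes 0, 2 and 4
    inserted. Mode 3 then becomes the cubic. *)
Definition tau3 : R :=
  10 / 9 * (1 + b ^+ 2) - (1 + b) * (1 + 2 * b) / 3 + 2 / 21 * b ^+ 2.

Definition d3 k : nat := if (k == 1%N) || (k == 3%N) then 1%N else 2%N.

Definition w3 k : R :=
  nth 0 [:: - (5 / 9) * (1 + b ^+ 2); tau3; (1 + 2 * b) / 3; b; - (2 / 21) * b; 0;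
            - b ^+ 2 / 189] k.

Lemma lam3E k : lam 3 k = 10^-1 * ((k%:R ^+ 2 - 1) * (k%:R ^+ 2 - 9)) :> R.
Proof. by rewrite /lam /beta; congr (_ * _); [congr (_^-1)|]; ring. Qed.

Lemma d3_orderS p q : (eorder 3 d3 2 (p + q) <= d3 p + d3 q)%N.
Proof. by rewrite /eorder /d3; do ![case: ifP => ?]; lia. Qed.

Lemma d3_orderD p q : (eorder 3 d3 2 (distn' p q) <= d3 p + d3 q)%N.
Proof. by rewrite /eorder /d3 /distn'; do ![case: ifP => ?]; lia. Qed.

(** For q >= 7 the orders tie only if p is 1 or 3 and the product lands on mode 1 or 3, but |p - q|
    is then at least 4. *)
Lemma lead_diag3 q : (7 <= q)%N -> forall phi,
  lead_lin 3 d3 2 7 w3 phi q = lam 3 q * phi q.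
Proof.
move=> q7 phi; rewrite /lead_lin gtn_eqF ?gtn_eqF ?(leq_trans _ q7)//.
rewrite big1 ?mulr0 ?addr0// => -[p p7] _ /=.
have hS : (d3 p + d3 q == eorder 3 d3 2 (p + q))%N = false.
  by rewrite /eorder /d3; do ![case: ifP => ?]; lia.
have hD : (d3 p + d3 q == eorder 3 d3 2 (distn' p q))%N = false.
  by rewrite /eorder /d3 /distn'; do ![case: ifP => ?]; lia.
by rewrite /theta hS hD !mul0r addr0 !mulr0.
Qed.

Hypothesis b_root : cubic3 = 0.

Lemma lead_res3 phi : lead_res 3 d3 2 7 w3 phi = 0.
Proof.
expand_lead; rewrite !lam3E /w3 /=.
transitivity (phi 3%N * cubic3); last by rewrite b_root mulr0.
by rewrite /cubic3 /tau3; field.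
Qed.

Lemma lead_lin3E phi : [/\
  [/\ lead_lin 3 d3 2 7 w3 phi 0 = 9 / 10 * phi 0%N + 2 * phi 1%N + 2 * b * phi 3%N,
  lead_lin 3 d3 2 7 w3 phi 1 = phi 1%N + b * phi 3%N &
  lead_lin 3 d3 2 7 w3 phi 2 = - (3 / 2) * phi 2%N + (1 + b) * phi 1%N + phi 3%N],
  lead_lin 3 d3 2 7 w3 phi 3 = tau3 * phi 3%N + b * phi 0%N + phi 2%N + phi 4%N +
    b * phi 6%N + ((1 + 2 * b) / 3 - (2 / 21) * b) * phi 1%N +
    (- (10 / 9) * (1 + b ^+ 2) - b ^+ 2 / 189) * phi 3%N,
  lead_lin 3 d3 2 7 w3 phi 4 = 21 / 2 * phi 4%N + b * phi 1%N + phi 3%N,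
  lead_lin 3 d3 2 7 w3 phi 5 = 192 / 5 * phi 5%N &
  lead_lin 3 d3 2 7 w3 phi 6 = 189 / 2 * phi 6%N + b * phi 3%N].
Proof. by do ?split; expand_lead; rewrite ?lam3E /w3 /=; field. Qed.

Lemma lead_supp3 q : (q < 7)%N -> forall phi : nat -> R,
  (forall k, (k < 7)%N -> phi k = 0) -> lead_lin 3 d3 2 7 w3 phi q = 0.
Proof.
move=> q7 phi h; have [[E0 E1 E2] E3 E4 E5 E6] := lead_lin3E phi.
have h0 := h 0%N isT; have h1 := h 1%N isT; have h2 := h 2%N isT.
have h3 := h 3%N isT; have h4 := h 4%N isT; have h5 := h 5%N isT; have h6 := h 6%N isT.
case: q q7 => [|[|[|[|[|[|[|//]]]]]]] _;
  rewrite ?E0 ?E1 ?E2 ?E3 ?E4 ?E5 ?E6 ?h0 ?h1 ?h2 ?h3 ?h4 ?h5 ?h6; ring.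
Qed.

Hypothesis b_simple : dcubic3 != 0.

(** Eliminating every unknown except the second amplitude leaves the derivative of the bifurcation
    cubic as its coefficient, so simplicity of the root is what is needed. *)
Lemma lead_inj3 (z : nat -> R) :
  (forall k, (k < 7)%N -> \sum_(q < 7) z q * lead_lin 3 d3 2 7 w3 (delta_seq k) q = 0) ->
  forall q, (q < 7)%N -> z q = 0.
Proof.
move=> h.
have E (k : nat) : (k < 7)%N ->
    z 0%N * (9 / 10 * delta_seq k 0 + 2 * delta_seq k 1 + 2 * b * delta_seq k 3) +
    z 1%N * (delta_seq k 1 + b * delta_seq k 3) +
    z 2%N * (- (3 / 2) * delta_seq k 2 + (1 + b) * delta_seq k 1 + delta_seq k 3) +
    z 3%N * (tau3 * delta_seq k 3 + b * delta_seq k 0 + delta_seq k 2 + delta_seq k 4 +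
      b * delta_seq k 6 + ((1 + 2 * b) / 3 - (2 / 21) * b) * delta_seq k 1 +
      (- (10 / 9) * (1 + b ^+ 2) - b ^+ 2 / 189) * delta_seq k 3) +
    z 4%N * (21 / 2 * delta_seq k 4 + b * delta_seq k 1 + delta_seq k 3) +
    z 5%N * (192 / 5 * delta_seq k 5) +
    z 6%N * (189 / 2 * delta_seq k 6 + b * delta_seq k 3) = 0.
  move=> /h; have [[E0 E1 E2] E3 E4 E5 E6] := lead_lin3E (delta_seq k).
  by rewrite !big_ord_recr big_ord0 /= E0 E1 E2 E3 E4 E5 E6 add0r.
have e0 := E 0%N isT; have e1 := E 1%N isT; have e2 := E 2%N isT.
have e3 := E 3%N isT; have e4 := E 4%N isT; have e5 := E 5%N isT; have e6 := E 6%N isT.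
move: e0 e1 e2 e3 e4 e5 e6; rewrite /delta_seq /= => e0 e1 e2 e3 e4 e5 e6.
have z0 : z 0%N = - (10 / 9) * b * z 3%N by move: e0; lra.
have z2 : z 2%N = 2 / 3 * z 3%N by move: e2; lra.
have z4 : z 4%N = - (2 / 21) * z 3%N by move: e4; lra.
have z5 : z 5%N = 0 by move: e5; lra.
have z6 : z 6%N = - (2 / 189) * b * z 3%N by move: e6; lra.
have z1 : z 1%N = - (2 * z 0%N + (1 + b) * z 2%N +
    ((1 + 2 * b) / 3 - (2 / 21) * b) * z 3%N + b * z 4%N) by move: e1; lra.
have z3 : z 3%N = 0.
  apply/eqP; rewrite -(mulrI_eq0 _ (mulfI b_simple)); apply/eqP.
  by rewrite -[RHS]e3 z1 z0 z2 z4 z6 /dcubic3 /tau3; field.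
rewrite z3 in z0 z1 z2 z4 z6; rewrite z0 z2 z4 in z1.
case=> [|[|[|[|[|[|[|//]]]]]]] _ //; by rewrite ?z0 ?z1 ?z2 ?z3 ?z4 ?z6; ring.
Qed.

End KThree.

(** * Isolation of the three roots of the cubic *)

Section CubicRoots.
Context {R : realType}.

(** The sign [s] treats increasing and decreasing crossings together. *)
Lemma cubic3_root (s l r : R) : l <= r -> s != 0 -> s * cubic3 l <= 0 -> 0 <= s * cubic3 r ->
  exists b, [/\ cubic3 b = 0, l <= b & b <= r].
Proof.
move=> lr s0 hl hr.
pose p : {poly R} := s *: (- (109 / 189) *: 'X^3 - 'X^2 + (5 / 21) *: 'X + (1 / 3)%:P).
have pE x : p.[x] = s * cubic3 x by rewrite /p !(hornerE, hornerXn) /cubic3 /=; field.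
have [|x /andP[lx xr] /rootP] := @poly_ivt _ p l r lr; first by rewrite !pE hl hr.
rewrite pE => /eqP; rewrite mulf_eq0 (negbTE s0) => /eqP h.
by exists x.
Qed.

Definition root_data (b x t : R) := [/\ cubic3 b = 0, dcubic3 b != 0, approx5 b x & approx5 (tau3 b) t].

(* The third pair of decimals is correct with a margin of only 10^-7, hence the
   length of the isolating intervals. *)
Lemma cubic3_root_data (s l x t : R) : s != 0 -> s * cubic3 l <= 0 -> 0 <= s * cubic3 (l + 10 ^- 7) ->
  (forall h, 0 <= h -> h <= 10 ^- 7 -> [/\ s * dcubic3 (l + h) > 0,
     approx5 (l + h) x & approx5 (tau3 (l + h)) t]) ->
  exists b, root_data b x t.
Proof.
move=> s0 hl hr H.
have [|b [b0 lb br]] := @cubic3_root s l (l + 10 ^- 7) _ s0 hl hr; first by lra.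
have t0 : 0 <= b - l by lra.
have t1 : b - l <= 10 ^- 7 by lra.
have := H _ t0 t1; rewrite addrC subrK => -[hd hb ht]; exists b; split => //.
by apply/eqP => d0; move: hd; rewrite d0 mulr0 ltxx.
Qed.

Lemma cubic3_root1 : exists b, root_data b (- (1 + 783 / 10 ^+ 3 + 74 / 10 ^+ 5))
  (4 + 278 / 10 ^+ 3 + 63 / 10 ^+ 5).
Proof.
(* The left endpoint is -1.7837368, where the cubic decreases. *)
apply: (@cubic3_root_data (-1)
  (- (1 + 78 / 10 ^+ 2 + 37 / 10 ^+ 4 + 36 / 10 ^+ 6 + 8 / 10 ^+ 7))).
- by rewrite ?oppr_eq0 oner_eq0.
- by rewrite /cubic3; lra.
- by rewrite /cubic3; lra.
move=> h h0 h1; have h2 : 0 <= h ^+ 2 by exact: sqr_ge0.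
have h3 : h ^+ 2 <= 10 ^- 7 by rewrite expr2; nra.
rewrite /approx5 !ler_norml /dcubic3 /tau3.
by split; [lra|apply/andP; split; lra|apply/andP; split; lra].
Qed.

Lemma cubic3_root2 : exists b, root_data b (- (544 / 10 ^+ 3 + 88 / 10 ^+ 5))
  (1 + 482 / 10 ^+ 3 + 89 / 10 ^+ 5).
Proof.
(* The left endpoint is -0.5448834, where the cubic increases. *)
apply: (@cubic3_root_data 1
  (- (54 / 10 ^+ 2 + 48 / 10 ^+ 4 + 83 / 10 ^+ 6 + 4 / 10 ^+ 7))).
- by rewrite ?oppr_eq0 oner_eq0.
- by rewrite /cubic3; lra.
- by rewrite /cubic3; lra.
move=> h h0 h1; have h2 : 0 <= h ^+ 2 by exact: sqr_ge0.
have h3 : h ^+ 2 <= 10 ^- 7 by rewrite expr2; nra.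
rewrite /approx5 !ler_norml /dcubic3 /tau3.
by split; [lra|apply/andP; split; lra|apply/andP; split; lra].
Qed.

Lemma cubic3_root3 : exists b, root_data b (594 / 10 ^+ 3 + 68 / 10 ^+ 5)
  (373 / 10 ^+ 3 + 96 / 10 ^+ 5).
Proof.
(* The left endpoint 0.5946751 lies just above the rounding boundary 0.594675; the cubic decreases
   there. *)
apply: (@cubic3_root_data (-1)
  (59 / 10 ^+ 2 + 46 / 10 ^+ 4 + 75 / 10 ^+ 6 + 1 / 10 ^+ 7)).
- by rewrite ?oppr_eq0 oner_eq0.
- by rewrite /cubic3; lra.
- by rewrite /cubic3; lra.
move=> h h0 h1; have h2 : 0 <= h ^+ 2 by exact: sqr_ge0.
have h3 : h ^+ 2 <= 10 ^- 7 by rewrite expr2; nra.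
rewrite /approx5 !ler_norml /dcubic3 /tau3.
by split; [lra|apply/andP; split; lra|apply/andP; split; lra].
Qed.

End CubicRoots.

(** * Orders of the mode interactions for K >= 4 *)

Section KLarge.
Context {R : realType} (K : nat).
Hypothesis hK : (4 <= K)%N.

Local Notation n := K.+2.
Local Notation lam := (@lam R K).

(* Mode k is generated by the k-th power of a cos(x); the amplitude of cos(Kx) is
   of order a^(K-2), and its product with a cos(x) has order a^(K-1). *)
Definition dL k : nat :=
  if k == 0%N then 2%N else if k == K then (K - 2)%N else if (k < K)%N then k else K.-1.

Lemma dL_gt0 k : (0 < dL k)%N.
Proof. by rewrite /dL; do ![case: ifP => ?]; lia. Qed.

Lemma dL_orderS p q : (eorder K dL 2 (p + q) <= dL p + dL q)%N.
Proof. by rewrite /eorder /dL; do ![case: ifP => ?]; lia. Qed.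

Lemma dL_orderD p q : (eorder K dL 2 (distn' p q) <= dL p + dL q)%N.
Proof. by rewrite /eorder /dL /distn'; do ![case: ifP => ?]; lia. Qed.

Lemma lead_diagL w0 q : (n <= q)%N -> forall phi,
  lead_lin K dL 2 n w0 phi q = lam q * phi q.
Proof.
move=> qn phi; rewrite /lead_lin !ifF; try lia.
rewrite big1 ?mulr0 ?addr0// => -[p pn] _ /=.
have hS : (dL p + dL q == eorder K dL 2 (p + q))%N = false.
  by rewrite /eorder /dL; do ![case: ifP => ?]; lia.
have hD : (dL p + dL q == eorder K dL 2 (distn' p q))%N = false.
  by rewrite /eorder /dL /distn'; do ![case: ifP => ?]; lia.
by rewrite /theta hS hD !mul0r addr0 !mulr0.
Qed.

(** Valued in the naturals, so that a list of interacting pairs is a sum of indicators. *)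
Definition is_pair (i j p q : nat) : nat := (p == i) && (q == j).

Lemma is_pairC i j p q : is_pair i j p q = is_pair j i q p.
Proof. by rewrite /is_pair andbC. Qed.

(** All interactions with frequency p + q at leading order: the upward cascade up to mode K, the
    mean with a resonant mode, and cos(x) with cos(Kx). *)
Lemma orderS_eq p q : (p < n)%N -> (q < n)%N ->
  ((dL p + dL q == eorder K dL 2 (p + q)) =
   [&& 0 < p, 0 < q & p + q <= K] + (is_pair 0 1 p q + is_pair 1 0 p q) +
   (is_pair 0 K p q + is_pair K 0 p q) + (is_pair 1 K p q + is_pair K 1 p q) :> nat)%N.
Proof.
by move=> pn qn; rewrite /eorder /dL /is_pair; do ![case: ifP => ?]; lia.
Qed.

(** Frequency |p - q| matters only for finitely many pairs, since a downward interaction of two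
    cascade modes wastes powers of a unless it returns to the mean or to mode 1. *)
Lemma orderD_eq p q : (p < n)%N -> (q < n)%N ->
  ((dL p + dL q == eorder K dL 2 (distn' p q)) =
   is_pair 1 1 p q + (is_pair 0 1 p q + is_pair 1 0 p q) + (is_pair 1 2 p q + is_pair 2 1 p q) +
   (is_pair 0 K p q + is_pair K 0 p q) + (is_pair 1 K p q + is_pair K 1 p q) +
   (is_pair 1 K.+1 p q + is_pair K.+1 1 p q) :> nat)%N.
Proof.
wlog qp : p q / (q <= p)%N => [h pn qn|].
  have [/h->//|/ltnW/h] := leqP q p.
  by rewrite distnC [(dL q + _)%N]addnC => ->//; rewrite !(is_pairC _ _ q); lia.
move=> pn qn; have -> : distn' p q = (p - q)%N by rewrite /distn'; lia.
case: q qp qn => [|[|q]] qp qn; rewrite /is_pair /eorder /dL /= ?andbF ?subn0 ?addn0.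
- by do ![case: ifP => ?]; lia.
- by do ![case: ifP => ?]; lia.
have p0 : (p == 0%N) = false by lia.
have p1 : (p == 1%N) = false by lia.
by rewrite p0 p1 /=; do ![case: ifP => ?]; lia.
Qed.
End KLarge.

(** * The leading quadratic form for K >= 4 *)

Section KLargeForm.
Context {R : realType} (K : nat).
Hypothesis hK : (4 <= K)%N.

Local Notation n := K.+2.
Local Notation lam := (@lam R K).
Implicit Types (x y phi s : nat -> R) (F G : nat -> nat -> R).

Definition dsum F : R := \sum_(p < n) \sum_(q < n) F p q.

Lemma dsumD F G : dsum (fun p q => F p q + G p q) = dsum F + dsum G.
Proof. by rewrite /dsum -big_split/=; apply: eq_bigr => p _; rewrite -big_split. Qed.

Lemma eq_dsum F G : (forall p q, (p < n)%N -> (q < n)%N -> F p q = G p q) ->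
  dsum F = dsum G.
Proof.
move=> h; apply: eq_bigr => -[p pn] _; apply: eq_bigr => -[q qn] _; exact: h.
Qed.

Lemma sum_pick i phi : (i < n)%N -> \sum_(k < n) (k == i :> nat)%:R * phi k = phi i.
Proof.
move=> hi; rewrite (bigD1 (Ordinal hi))//= eqxx mul1r big1 ?addr0// => k.
by rewrite -val_eqE /= => /negbTE ->; rewrite mul0r.
Qed.

Lemma dsum_on i j F : (i < n)%N -> (j < n)%N ->
  dsum (fun p q => (is_pair i j p q)%:R * F p q) = F i j.
Proof.
move=> hi hj; rewrite -(sum_pick (fun p => F p j) hi); apply: eq_bigr => p _.
rewrite -(sum_pick (F p) hj) mulr_sumr; apply: eq_bigr => q _.
by rewrite /is_pair -mulnb natrM mulrA.
Qed.

Definition mode_conv x y k : R :=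
  dsum (fun p q => [&& 0 < p, 0 < q & p + q == k]%N%:R * (x p * y q)).

Lemma eq_conv x x' y y' k :
  (forall i, (0 < i < k)%N -> x i = x' i) -> (forall i, (0 < i < k)%N -> y i = y' i) ->
  mode_conv x y k = mode_conv x' y' k.
Proof.
move=> hx hy; apply: eq_dsum => p q _ _.
have [/and3P[p0 q0 /eqP pq]|_] := boolP [&& _, _ & _]; last by rewrite !mul0r.
by rewrite hx ?hy//; lia.
Qed.

Lemma conv_sum x y phi :
  dsum (fun p q => [&& 0 < p, 0 < q & p + q <= K]%N%:R * (x p * y q * phi (p + q)%N)) =
  \sum_(k < n) (k <= K)%N%:R * mode_conv x y k * phi k.
Proof.
under [RHS]eq_bigr => k _.
  rewrite /mode_conv /dsum mulr_sumr mulr_suml.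
  under eq_bigr do rewrite mulr_sumr mulr_suml.
  over.
rewrite exchange_big/=; apply: eq_bigr => p _.
rewrite exchange_big/=; apply: eq_bigr => q _.
have [/and3P[p0 q0 pq]|h] := boolP [&& _, _ & _].
  have hn : (p + q < n)%N by lia.
  rewrite mul1r -[LHS]mul1r -(sum_pick (fun k => 1 * (x p * y q * phi k)) hn).
  apply: eq_bigr => -[k kn] _ /=; rewrite p0 q0 /= [k == _]eq_sym.
  by have [<-|_] := eqVneq; rewrite ?pq !(mul0r, mulr0, mul1r).
rewrite mul0r big1// => k _; have [kK|_] := leqP k K; last by rewrite !mul0r.
rewrite (_ : [&& _, _ & _] = false) ?(mul0r, mulr0)//; apply: contraNF h; lia.
Qed.

(** The two order tables turn the leading bilinear form into the convolution along the cascade plus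
    explicit corrections at modes 0, 1, K-1, K, K+1. *)
Lemma sum_theta x y phi : dsum (fun p q => x p * y q * theta K (dL K) 2 phi p q) =
  2^-1 * \sum_(k < n) (k <= K)%N%:R * mode_conv x y k * phi k +
  2^-1 * (x 1%N * y 1%N) * phi 0%N +
  (x 0%N * y 1%N + x 1%N * y 0%N + 2^-1 * (x 1%N * y 2%N + x 2%N * y 1%N)) * phi 1%N +
  2^-1 * (x 1%N * y K + x K * y 1%N) * (phi K.-1 + phi K.+1) +
  (x 0%N * y K + x K * y 0%N + 2^-1 * (x 1%N * y K.+1 + x K.+1 * y 1%N)) * phi K.
Proof.
pose A p q : R := 2^-1 * (x p * y q * phi (p + q)%N).
pose B p q : R := 2^-1 * (x p * y q * phi (distn' p q)).
pose o i j p q : R := (is_pair i j p q)%:R.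
have E p q : (p < n)%N -> (q < n)%N -> x p * y q * theta K (dL K) 2 phi p q =
   2^-1 * ([&& 0 < p, 0 < q & p + q <= K]%N%:R * (x p * y q * phi (p + q)%N)) +
   (o 0 1 p q * A p q + o 1 0 p q * A p q + (o 0 K p q * A p q + o K 0 p q * A p q) +
    (o 1 K p q * A p q + o K 1 p q * A p q)) +
   (o 1 1 p q * B p q + (o 0 1 p q * B p q + o 1 0 p q * B p q) +
    (o 1%N 2%N p q * B p q + o 2%N 1%N p q * B p q) + (o 0 K p q * B p q + o K 0 p q * B p q) +
    (o 1 K p q * B p q + o K 1 p q * B p q) +
    (o 1 K.+1 p q * B p q + o K.+1 1 p q * B p q)).
  move=> pn qn; rewrite /theta orderS_eq// orderD_eq// !natrD /A /B /o; ring.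
rewrite (eq_dsum E) !dsumD !dsum_on; try lia.
rewrite -conv_sum.
have -> : dsum (fun p q => 2^-1 * ([&& 0 < p, 0 < q & p + q <= K]%N%:R *
    (x p * y q * phi (p + q)%N))) = 2^-1 * dsum (fun p q =>
    [&& 0 < p, 0 < q & p + q <= K]%N%:R * (x p * y q * phi (p + q)%N)).
  by rewrite /dsum mulr_sumr; apply: eq_bigr => p _; rewrite mulr_sumr.
have dK : (distn' 1 K = K.-1) * (distn' K 1 = K.-1) by split; rewrite /distn'; lia.
have dK1 : (distn' 1 K.+1 = K) * (distn' K.+1 1 = K) by split; rewrite /distn'; lia.
have d0K : (distn' 0 K = K) * (distn' K 0 = K) by split; rewrite /distn'; lia.
have d01 : (distn' 0 1 = 1%N) * (distn' 1 0 = 1%N) by [].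
have d12 : (distn' 1 2 = 1%N) * (distn' 2 1 = 1%N) by [].
rewrite /A /B !(dK, dK1, d0K, d01, d12) (_ : distn' 1 1 = 0%N)//.
rewrite !addn0 !add0n addn1 add1n.
by field.
Qed.

(* The leading amplitudes generated by cos(x) alone: each mode is obtained from
   the lower ones until lam K vanishes. *)
Definition sstep s k : R :=
  if (k <= 1)%N then (k == 1%N)%:R else - (2 * lam k)^-1 * mode_conv s s k.

Definition sK : nat -> R := iter K sstep (delta_seq 1).

(** Entry k of a step uses only entries below k, so m iterations settle all entries up to m + 1. *)
Lemma iter_sstep m k : (k <= m.+1)%N ->
  sstep (iter m sstep (delta_seq 1)) k = iter m sstep (delta_seq 1) k.
Proof.
elim: m k => [|m IH] k hk; first by rewrite /sstep hk.
rewrite /= {1}/sstep [RHS]/sstep; case: ifP => // _; congr (_ * _).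
by apply: eq_conv => i hi; apply: IH; lia.
Qed.

Lemma sK_rec k : (1 < k <= K.+1)%N -> lam k != 0 -> lam k * sK k + 2^-1 * mode_conv sK sK k = 0.
Proof.
move=> /andP[k1 kK] lk; rewrite {1}/sK -iter_sstep// /sstep leqNgt k1 /=.
by rewrite -/sK; field.
Qed.

Lemma sK1 : sK 1 = 1.
Proof. by rewrite /sK -iter_sstep. Qed.

Lemma lam_lt0 k : (1 < k < K)%N -> lam k < 0.
Proof.
move=> /andP[k1 kK]; rewrite /lam pmulr_rlt0 ?beta_gt0// pmulr_rlt0.
  by rewrite subr_lt0 -!natrX ltr_nat ltn_exp2r.
by rewrite subr_gt0 -natrX ltr1n; nia.
Qed.

Lemma conv_gt0 x y k : (1 < k <= K)%N -> (forall i, (0 < i < k)%N -> 0 < x i) ->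
  (forall i, (0 < i < k)%N -> 0 < y i) -> 0 < mode_conv x y k.
Proof.
move=> hk hx hy.
have ge0 p q : 0 <= [&& 0 < p, 0 < q & p + q == k]%N%:R * (x p * y q).
  have [/and3P[p0 q0 /eqP pq]|_] := boolP [&& _, _ & _]; last by rewrite mul0r.
  by rewrite mul1r mulr_ge0// ltW// (hx, hy); lia.
have h1 : (1 < n)%N by lia.
have hk1 : (k.-1 < n)%N by lia.
rewrite /mode_conv /dsum (bigD1 (Ordinal h1))//= ltr_wpDr//.
  by apply: sumr_ge0 => p _; apply: sumr_ge0 => q _.
rewrite (bigD1 (Ordinal hk1))//= ltr_wpDr//; first by apply: sumr_ge0 => q _; exact: (ge0 1%N q).
have -> : (0 < k.-1)%N && (1 + k.-1 == k)%N by lia.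
by rewrite mul1r mulr_gt0// (hx, hy); lia.
Qed.

(** The symbol is negative strictly between the resonances, so every cascade amplitude is a positive
    convolution over a positive number. Positivity later makes the forcing of mode K, hence the
    second amplitude, nonzero. *)
Lemma sK_gt0 k : (0 < k < K)%N -> 0 < sK k.
Proof.
elim/ltn_ind: k => k IH /andP[k0 kK].
have [k1|k1] := leqP k 1; first by rewrite (_ : k = 1%N) ?sK1//; lia.
have lk : lam k < 0 by apply: lam_lt0; lia.
have pos i : (0 < i < k)%N -> 0 < sK i by move=> hi; apply: IH; lia.
have c0 : 0 < mode_conv sK sK k by apply: conv_gt0 => //; lia.
have k2 : (1 < k <= K.+1)%N by lia.
have h := sK_rec k2 (ltr0_neq0 lk).
have {}h : lam k * sK k < 0 by lra.
by rewrite nmulr_rlt0 in h.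
Qed.

End KLargeForm.

(** * Leading-order data for K >= 4 *)

Section KLargeBranch.
Context {R : realType} (K : nat).
Hypothesis hK : (4 <= K)%N.

Local Notation n := K.+2.
Local Notation lam := (@lam R K).
Local Notation sK := (@sK R K).
Local Notation conv := (@mode_conv R K).

(** The limit velocity balancing mode 1 against the mean and the second harmonic. *)
Definition tauL : R := (lam 0)^-1 + (2 * lam 2)^-1.

(* Coefficient of the second amplitude in mode K of the equation. *)
Definition detL : R := (2 * lam 2)^-1 - (lam K.-1)^-1 - (lam K.+1)^-1.

(** The limit second amplitude: it balances the cascade forcing of mode K. *)
Definition gL : R := - (2^-1 * conv sK sK K) / detL.

(** Besides the cascade, cos(Kx) interacts with cos(x) at leading order and adds -gL / lam to modes
    K-1 and K+1. *)
Definition wL k : R :=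
  if k == 0%N then - (2 * lam 0)^-1 else if k == 1%N then tauL else
  if k == K.-1 then sK k - gL / lam k else if k == K then gL else
  if k == K.+1 then - gL / lam k else if (k < K)%N then sK k else 0.

Lemma wL_ge k : (n <= k)%N -> wL k = 0.
Proof. by move=> hk; rewrite /wL !ifF//; lia. Qed.

Lemma lam_neq0 k : k != 1%N -> k != K -> lam k != 0.
Proof.
move=> k1 kK; have := @lam_lower R _ _ k1 kK.
by apply: contraTneq => ->; rewrite normr0 -ltNge mulr_gt0 ?divr_gt0 ?beta_gt0.
Qed.

Lemma lam1 : lam 1 = 0.
Proof. by rewrite /lam expr1n subrr mul0r mulr0. Qed.

Lemma lamK : lam K = 0.
Proof. by rewrite /lam subrr !mulr0. Qed.

(** Multiplying by the three symbols gives -beta^2 K^2 (K^2 - 4) (4 K^2 - 61) / 2, and 4 K^2 > 61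
    from K = 4 on. *)
Lemma detL_neq0 : detL != 0.
Proof.
have k4 : 4 <= K%:R :> R by rewrite ler_nat.
have h0 := @lam_neq0 2; have h1 := @lam_neq0 K.-1; have h2 := @lam_neq0 K.+1.
have h : lam K.+1 * lam K.-1 * lam 2 * detL < 0.
  have -> : lam K.+1 * lam K.-1 * lam 2 * detL =
    2^-1 * (lam K.+1 * lam K.-1) - (lam K.+1 + lam K.-1) * lam 2.
    by rewrite /detL; field; rewrite h0 ?h1 ?h2//; lia.
  rewrite /lam (_ : K.-1%:R = K%:R - 1); last by rewrite -subn1 natrB//; lia.
  rewrite -[K.+1%:R]natr1.
  have b0 := @beta_gt0 R K.
  have -> : 2^-1 * (beta K * (((K%:R + 1) ^+ 2 - 1) * ((K%:R + 1) ^+ 2 - K%:R ^+ 2)) *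
     (beta K * (((K%:R - 1) ^+ 2 - 1) * ((K%:R - 1) ^+ 2 - K%:R ^+ 2)))) -
    (beta K * (((K%:R + 1) ^+ 2 - 1) * ((K%:R + 1) ^+ 2 - K%:R ^+ 2)) +
     beta K * (((K%:R - 1) ^+ 2 - 1) * ((K%:R - 1) ^+ 2 - K%:R ^+ 2))) *
     (beta K * ((2 ^+ 2 - 1) * (2 ^+ 2 - K%:R ^+ 2))) =
    - (beta K ^+ 2 * K%:R ^+ 2 * (K%:R ^+ 2 - 4) * ((4 * K%:R ^+ 2 - 61) / 2)) :> R.
    by field.
  rewrite oppr_lt0 !mulr_gt0 ?exprn_gt0//; nra.
by apply: contraTneq h => ->; rewrite mulr0 ltxx.
Qed.

Local Notation u := (uhat wL).

Lemma u_sK k : (0 < k < K.-1)%N -> u k = sK k.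
Proof.
move=> hk; rewrite /uhat /wL; case: eqP => [->|k1]; first by rewrite sK1.
have [h0 h1 h2 h3] : [/\ k == 0%N = false, k == K.-1 = false, k == K = false &
  k == K.+1 = false] by split; lia.
by rewrite h0 h1 h2 h3 ifT//; lia.
Qed.

Lemma uhatL_0 : u 0%N = - (2 * lam 0)^-1.
Proof. by []. Qed.

Lemma uhatL_1 : u 1%N = 1.
Proof. by []. Qed.

Lemma uhatL_predK : u K.-1 = sK K.-1 - gL / lam K.-1.
Proof. by rewrite /uhat /wL eqxx /= ?ifF//; lia. Qed.

Lemma uhatL_K : u K = gL.
Proof. by rewrite /uhat /wL eqxx /= ?ifF//; lia. Qed.

Lemma uhatL_succK : u K.+1 = - gL / lam K.+1.
Proof. by rewrite /uhat /wL eqxx /= ?ifF//; lia. Qed.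

Lemma wL_K : wL K = gL.
Proof. by rewrite -uhatL_K /uhat ifF//; lia. Qed.

Lemma wL_1 : wL 1 = tauL.
Proof. by []. Qed.

Lemma conv_u k : (k < K)%N -> conv u u k = conv sK sK k.
Proof. by move=> hk; apply: (eq_conv hK) => i hi; apply: u_sK; lia. Qed.

(** The correction at mode K-1 enters mode K through the pairs (1, K-1) and (K-1, 1). *)
Lemma conv_uK : conv u u K = conv sK sK K - 2 * (gL / lam K.-1).
Proof.
pose h := - (gL / lam K.-1).
have uE i : (0 < i < K)%N -> u i = sK i + (i == K.-1)%:R * h.
  have [->|i1] := eqVneq i K.-1; first by rewrite uhatL_predK mul1r.
  by move=> hi; rewrite mul0r addr0; apply: u_sK; lia.
have E p q : (p < n)%N -> (q < n)%N ->
    [&& 0 < p, 0 < q & p + q == K]%N%:R * (u p * u q) =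
    [&& 0 < p, 0 < q & p + q == K]%N%:R * (sK p * sK q) +
    ((is_pair 1 K.-1 p q)%:R * h + (is_pair K.-1 1 p q)%:R * h) :> R.
  move=> pn qn; have [/and3P[p0 q0 /eqP pq]|pq] := boolP [&& _, _ & _].
    rewrite !mul1r !uE; try lia.
    have pE : (p == K.-1) = (q == 1%N) by lia.
    have qE : (q == K.-1) = (p == 1%N) by lia.
    rewrite /is_pair pE qE !andbb.
    have [q1|_] := eqVneq q 1%N; have [p1|_] := eqVneq p 1%N; first by lia.
    - by rewrite q1 (sK1 hK) /=; ring.
    - by rewrite p1 (sK1 hK) /=; ring.
    - by rewrite /=; ring.
  have -> : is_pair 1 K.-1 p q = 0%N by rewrite /is_pair; lia.
  have -> : is_pair K.-1 1 p q = 0%N by rewrite /is_pair; lia.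
  by rewrite !mul0r !addr0.
rewrite /mode_conv (eq_dsum E) !dsumD !(@dsum_on R K _ _ (fun _ _ => h)); try lia.
by rewrite /h; ring.
Qed.

Lemma tau_u : tauL + 2 * u 0%N + u 2%N = 0.
Proof.
have c : conv sK sK 2%N = 1.
  have on11 p q : [&& 0 < p, 0 < q & p + q == 2]%N = (is_pair 1 1 p q == 1%N).
    by rewrite /is_pair; lia.
  transitivity (dsum K (fun p q => (is_pair 1 1 p q)%:R * (sK p * sK q))).
    apply: eq_dsum => p q _ _; rewrite on11 /is_pair.
    by case: (_ && _).
  by rewrite dsum_on ?sK1 ?mulr1//; lia.
have l2 : lam 2 != 0 by rewrite lam_neq0//; lia.
have l0 : lam 0 != 0 by rewrite lam_neq0//; lia.
have h : lam 2 * sK 2%N + 2^-1 * conv sK sK 2%N = 0 by apply: sK_rec => //; lia.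
have -> : u 2%N = - (2 * lam 2)^-1.
  rewrite u_sK; last by lia.
  rewrite c in h.
  apply: (mulfI l2); rewrite [RHS](_ : _ = - 2^-1); last by field.
  by lra.
by rewrite /tauL uhatL_0; field; rewrite l0 l2.
Qed.

Lemma detLE : detL = tauL + 2 * u 0%N - (lam K.-1)^-1 - (lam K.+1)^-1.
Proof.
have l0 : lam 0 != 0 by rewrite lam_neq0//; lia.
have -> : tauL + 2 * u 0%N = (2 * lam 2)^-1 by rewrite /tauL uhatL_0; field; rewrite l0 lam_neq0//; lia.
by [].
Qed.

Lemma conv_small x y k : (k <= 1)%N -> conv x y k = 0.
Proof.
move=> k1; rewrite /mode_conv /dsum big1// => p _; rewrite big1// => q _.
by rewrite (_ : [&& _, _ & _] = false) ?mul0r//; lia.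
Qed.

Lemma lead_resL phi : lead_res K (dL K) 2 n wL phi = 0.
Proof.
have lK1 : lam K.-1 != 0 by rewrite lam_neq0//; lia.
have lKS : lam K.+1 != 0 by rewrite lam_neq0//; lia.
have l0 : lam 0 != 0 by rewrite lam_neq0//; lia.
have -> : lead_res K (dL K) 2 n wL phi =
  \sum_(k < n) u k * (lam k * phi k) + tauL * (phi 1%N + gL * phi K) +
  dsum K (fun p q => u p * u q * theta K (dL K) 2 phi p q).
  rewrite /lead_res wL_K; congr (_ + _); apply: eq_bigr => p _.
  by rewrite mulr_sumr; apply: eq_bigr => q _; rewrite mulrA.
rewrite sum_theta//.
(* What the linear part and the cascade leave over: nothing below K-1 except at mode 0, and the
   terms at 0, K-1, K, K+1 that the remaining interactions compensate. *)
pose r k : R := (k == 0%N)%:R * - 2^-1 + (k == K.-1)%:R * - gL +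
  (k == K)%:R * (2^-1 * conv u u K) + (k == K.+1)%:R * - gL.
have rE k : (k < n)%N -> lam k * u k + 2^-1 * ((k <= K)%N%:R * conv u u k) = r k.
  move=> hk; rewrite /r.
  have [->|k0] := eqVneq k 0%N.
    rewrite (@conv_small u u 0%N)// uhatL_0.
    have [-> -> ->] : [/\ 0%N == K.-1 = false, 0%N == K = false & 0%N == K.+1 = false].
      by split; lia.
    by rewrite /=; field.
  have [->|kK] := eqVneq k K.
    rewrite lamK leqnn /=.
    have [-> ->] : (K == K.-1 = false) /\ (K == K.+1 = false) by split; lia.
    by rewrite /=; ring.
  have [->|kK1] := eqVneq k K.-1.
    have [-> ->] : (K.-1 == K.+1 = false) /\ (K.-1 <= K)%N by split; lia.
    rewrite conv_u; last by lia.
    have h : lam K.-1 * sK K.-1 + 2^-1 * conv sK sK K.-1 = 0 by apply: sK_rec => //; lia.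
    have -> : lam K.-1 * u K.-1 = lam K.-1 * sK K.-1 - gL by rewrite uhatL_predK; field.
    by rewrite /=; lra.
  have [->|kKS] := eqVneq k K.+1.
    rewrite ltnn uhatL_succK /=; by field.
  rewrite /= !mul0r !addr0 conv_u; last by lia.
  have -> : (k <= K)%N by lia.
  have [->|k1] := eqVneq k 1%N; first by rewrite lam1 (@conv_small _ _ 1%N)//; ring.
  rewrite u_sK; last by lia.
  by rewrite mul1r; apply: sK_rec; [lia..|rewrite lam_neq0].
have -> : \sum_(k < n) u k * (lam k * phi k) =
    (- 2^-1 * phi 0%N + - gL * phi K.-1 + 2^-1 * conv u u K * phi K + - gL * phi K.+1) -
    2^-1 * (\sum_(k < n) (k <= K)%N%:R * conv u u k * phi k).
  apply/eqP; rewrite -subr_eq opprK mulr_sumr -big_split /=; apply/eqP.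
  rewrite -(@sum_pick R K 0%N (fun k => - 2^-1 * phi k))//.
  rewrite -(@sum_pick R K K.-1 (fun k => - gL * phi k)); last by lia.
  rewrite -(@sum_pick R K K (fun k => 2^-1 * conv u u K * phi k))//.
  rewrite -(@sum_pick R K K.+1 (fun k => - gL * phi k))//.
  rewrite -!big_split /=; apply: eq_bigr => -[k kn] _ /=.
  rewrite [LHS](_ : _ = (lam k * u k + 2^-1 * ((k <= K)%N%:R * conv u u k)) * phi k); last by ring.
  by rewrite rE// /r; ring.
have h2 : u 2%N = - tauL - 2 * u 0%N by have := tau_u; lra.
rewrite uhatL_1 h2 uhatL_K uhatL_succK.
(* The balance of mode K, solved by the choice of [gL]. *)
have g0 : 2^-1 * conv u u K + tauL * gL + 2 * u 0%N * gL - gL / lam K.+1 = 0.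
  rewrite conv_uK [LHS](_ : _ = 2^-1 * conv sK sK K + detL * gL); last by rewrite detLE; field; rewrite lK1 lKS.
  by rewrite /gL mulrCA mulfV ?detL_neq0// mulr1 subrr.
rewrite [LHS](_ : _ = phi K * (2^-1 * conv u u K + tauL * gL + 2 * u 0%N * gL - gL / lam K.+1)).
  by rewrite g0 mulr0.
by field.
Qed.

Lemma lead_suppL q : (q < n)%N -> forall phi : nat -> R,
  (forall k, (k < n)%N -> phi k = 0) -> lead_lin K (dL K) 2 n wL phi q = 0.
Proof.
move=> qn phi h; rewrite /lead_lin (h q qn) (h 1%N)// (h K)//.
rewrite big1 => [|p _]; first by rewrite !(mulr0, addr0, if_same).
have pn := ltn_ord p; move: (nat_of_ord p) pn => {}p pn.
rewrite /theta orderS_eq// (h (distn' p q)); last by rewrite /distn'; lia.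
have [hpq|hpq] := ltnP (p + q) n; first by rewrite (h _ hpq) !mulr0 addr0 !mulr0.
have -> : [&& 0 < p, 0 < q & p + q <= K]%N = false by lia.
by rewrite (_ : (_ + _ + _ + _)%N = 0%N) ?mul0r ?mulr0 ?addr0 ?mulr0//; rewrite /is_pair; lia.
Qed.

Lemma conv_last y : (forall i, (0 < i < K.-1)%N -> y i = 0) -> conv u y K = y K.-1.
Proof.
move=> hy; transitivity (dsum K (fun p q => (is_pair 1 K.-1 p q)%:R * y K.-1)); last first.
  by rewrite (@dsum_on R K _ _ (fun _ _ => y K.-1))//; lia.
apply: eq_dsum => p q _ _; have [/and3P[p0 q0 /eqP pq]|pq] := boolP [&& _, _ & _].
  have [p1|p1] := eqVneq p 1%N.
    have q1 : q = K.-1 by lia.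
    by rewrite /is_pair p1 q1 !eqxx /= uhatL_1 !mul1r.
  have -> : is_pair 1 K.-1 p q = 0%N by rewrite /is_pair; lia.
  by rewrite (hy q) ?mulr0 ?mul0r//; lia.
have -> : is_pair 1 K.-1 p q = 0%N by rewrite /is_pair; lia.
by rewrite !mul0r.
Qed.

(** Triangular elimination: modes below K-1 vanish upwards one after another, mode 1 then removes
    the velocity, and modes K-1, K, K+1 reduce to [detL] times the second amplitude. *)
Lemma lead_injL (z : nat -> R) :
  (forall k, (k < n)%N ->
    \sum_(q < n) z q * lead_lin K (dL K) 2 n wL (delta_seq k) q = 0) ->
  forall q, (q < n)%N -> z q = 0.
Proof.
move=> hz.
(* Slot 1 of [z] varies the velocity, so the varied profile has no component there. *)
pose y q : R := if q == 1%N then 0 else z q.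
have y1 : y 1%N = 0 by [].
have yE q : q != 1%N -> y q = z q by rewrite /y => /negbTE ->.
have lead phi : \sum_(q < n) z q * lead_lin K (dL K) 2 n wL phi q =
    \sum_(q < n) lam q * z q * phi q + z 1%N * (phi 1%N + gL * phi K) +
    tauL * z K * phi K + 2 * dsum K (fun p q => u p * y q * theta K (dL K) 2 phi p q).
  rewrite -(@sum_pick R K 1 (fun q => z q * (phi 1%N + gL * phi K)))//.
  rewrite -(@sum_pick R K K (fun q => tauL * z q * phi K))//.
  rewrite /dsum exchange_big/= mulr_sumr -!big_split/=; apply: eq_bigr => -[q qn] _ /=.
  rewrite /lead_lin wL_K; have [->|q1] := eqVneq q 1%N.
    have -> : 1%N == K = false by lia.
    by rewrite lam1 big1 => [|p _]; [rewrite /=; ring|rewrite y1 mulr0 mul0r].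
  have -> : \sum_(p < n) u p * y q * theta K (dL K) 2 phi p q =
      z q * \sum_(p < n) u p * theta K (dL K) 2 phi p q.
    by rewrite mulr_sumr; apply: eq_bigr => p _; rewrite yE//; ring.
  by have [->|_] := eqVneq q K; rewrite /= ?wL_1; ring.
have E k : (k < n)%N ->
    lam k * z k + z 1%N * (delta_seq k 1%N + gL * delta_seq k K) + tauL * z K * delta_seq k K +
    (k <= K)%N%:R * conv u y k + (2 * z 0%N + z 2%N) * delta_seq k 1%N +
    z K * (delta_seq k K.-1 + delta_seq k K.+1) +
    (2 * u 0%N * z K + 2 * gL * z 0%N + z K.+1) * delta_seq k K = 0.
  move=> kn; have := hz k kn; rewrite lead sum_theta// /delta_seq.
  under eq_bigr do rewrite mulrC.
  rewrite (@sum_pick R K k (fun q => lam q * z q))//.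
  under eq_bigr do rewrite mulrC.
  rewrite (@sum_pick R K k (fun q => (q <= K)%N%:R * conv u y q))//.
  rewrite y1 uhatL_1 uhatL_K !yE; try lia.
  by move=> h; rewrite -[RHS]h /delta_seq; field.
have F j k : (j == k) = false -> delta_seq k j = 0 :> R by rewrite /delta_seq => ->.
have T k : delta_seq k k = 1 :> R by rewrite /delta_seq eqxx.
have conv0 k : (forall i, (0 < i < k)%N -> y i = 0) -> conv u y k = 0.
  move=> hy; rewrite (@eq_conv R K hK u u y (fun=> 0) k)//.
  by rewrite /mode_conv /dsum big1// => p _; rewrite big1// => q _; rewrite !mulr0.
have lz k : k != 1%N -> k != K -> lam k * z k = 0 -> z k = 0.
  by move=> k1 kK /eqP; rewrite mulf_eq0 (negbTE (lam_neq0 k1 kK)) => /eqP.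
have z0 : z 0%N = 0.
  apply: lz; try lia.
  by have := E 0%N isT; rewrite conv_small// !F; try lia; lra.
have zs k : (1 < k < K.-1)%N -> z k = 0.
  elim/ltn_ind: k => k IH hk; apply: lz; try lia.
  have c0 : conv u y k = 0.
    apply: conv0 => i hi; have [->//|i1] := eqVneq i 1%N.
    by rewrite yE//; apply: IH; lia.
  have kn : (k < n)%N by lia.
  by have := E k kn; rewrite c0 !F; try lia; lra.
have ys i : (0 < i < K.-1)%N -> y i = 0.
  by move=> hi; have [->//|i1] := eqVneq i 1%N; rewrite yE// zs//; lia.
have eK1 : lam K.-1 * z K.-1 + z K = 0.
  have kn : (K.-1 < n)%N by lia.
  have := E _ kn; rewrite conv0// T !F; try lia; lra.
have eKS : lam K.+1 * z K.+1 + z K = 0.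
  have := E K.+1 (leqnn _); rewrite ltnn mul0r T !F; try lia; lra.
have z2 : z 2%N = 0 by apply: zs; lia.
have z1 : z 1%N = 0.
  by have := E 1%N isT; rewrite lam1 conv_small// T !F; try lia; rewrite z0 z2; lra.
have eK : tauL * z K + z K.-1 + 2 * u 0%N * z K + z K.+1 = 0.
  have kn : (K < n)%N by lia.
  have := E _ kn; rewrite leqnn mul1r T !F; try lia.
  by rewrite z1 z0 lamK conv_last// yE; try lia; lra.
have lK1 : lam K.-1 != 0 by rewrite lam_neq0//; lia.
have lKS : lam K.+1 != 0 by rewrite lam_neq0//; lia.
have zK1 : z K.-1 = - z K / lam K.-1 by apply: (mulfI lK1); rewrite mulrC mulrC mulrCA mulfV//; lra.
have zKS : z K.+1 = - z K / lam K.+1 by apply: (mulfI lKS); rewrite mulrC mulrC mulrCA mulfV//; lra.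
have zK : z K = 0.
  apply/eqP; rewrite -(mulrI_eq0 _ (mulfI detL_neq0)); apply/eqP.
  by rewrite -[RHS]eK zK1 zKS detLE; field; rewrite lK1 lKS.
have {}zK1 : z K.-1 = 0 by rewrite zK1 zK oppr0 mul0r.
have {}zKS : z K.+1 = 0 by rewrite zKS zK oppr0 mul0r.
move=> q qn; have [->//|q0] := eqVneq q 0%N.
have [->//|q1] := eqVneq q 1%N; have [->//|qK] := eqVneq q K.
have [->//|qK1] := eqVneq q K.-1; have [->//|qKS] := eqVneq q K.+1.
by apply: zs; lia.
Qed.

End KLargeBranch.

(** * Nonvanishing of analytic functions near a point *)

Section AnalyticNonzero.
Context {R : realType}.

Lemma geometric_tail_le (t : R) N : 0 <= t -> t <= 2^-1 ->
  \sum_(i < N) t ^+ i.+1 <= 2 * t.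
Proof.
move=> t0 th; suff : \sum_(i < N) t ^+ i.+1 + 2 * t ^+ N.+1 <= 2 * t.
  by apply: le_trans; rewrite lerDl mulr_ge0// exprn_ge0.
elim: N => [|N IH]; first by rewrite big_ord0 add0r expr1.
rewrite big_ord_recr /=; apply: le_trans IH; rewrite -addrA lerD2l.
have p0 : 0 <= t ^+ N.+1 by exact: exprn_ge0.
by rewrite [t ^+ N.+2]exprS; nra.
Qed.

(** The point must differ from x, since the function is used multiplied by a power of a that
    vanishes at 0. Boundedness of the terms at r / 2 gives a geometric bound on the nonconstant
    part. *)
Lemma analytic_at_nonzero (f : R -> R) x : analytic_at f x -> f x != 0 ->
  forall eps, 0 < eps -> exists h, [/\ h != 0, `|h| < eps & f (x + h) != 0].
Proof.
move=> [c [r [r0 cv]]] fx eps eps0.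
have r20 : 0 < r / 2 by rewrite divr_gt0.
have f0 : f x = c 0%N.
  have h0 : `|0 : R| < r by rewrite normr0.
  have := cv 0 h0; rewrite addr0 -cvg_shiftS => cv0.
  have E : (fun N => pseries c 0 N.+1) = fun=> c 0%N.
    apply/funext => N; rewrite /pseries /series /= big_nat_recl//= expr0 mulr1 big1 ?addr0// => i _.
    by rewrite expr0n mulr0.
  by rewrite E in cv0; rewrite -(cvg_lim _ cv0)//; apply: lim_cst.
have [B [B0 hB]] : exists B : R, 0 <= B /\ forall n, `|c n * (r / 2) ^+ n| <= B.
  have : cvgn (pseries c (r / 2)).
    by apply/cvg_ex; exists (f (x + r / 2)); apply: cv; rewrite gtr0_norm//; lra.
  move=> /cvg_series_bounded[M [Mr hM]]; exists (`|M| + 1); split; first by rewrite addr_ge0.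
  by move=> n; apply: hM => //; apply: le_lt_trans (ler_norm M) _; rewrite ltrDl.
have c0 : 0 < `|c 0%N| by rewrite -f0 normr_gt0.
(* The bounds make the tail geometric, keep h within eps, and hold the tail 2 B t below half of the
   constant coefficient. *)
pose t := Num.min 2^-1 (Num.min (eps / r) (`|c 0%N| / (4 * (B + 1)))).
have B1 : 0 < 4 * (B + 1) by lra.
have t0 : 0 < t by rewrite !lt_min (divr_gt0 eps0 r0) (divr_gt0 c0 B1) invr_gt0 ltr0n.
have [t2 te tB] : [/\ t <= 2^-1, t <= eps / r & t <= `|c 0%N| / (4 * (B + 1))].
  by split; rewrite !ge_min lexx ?orbT.
have t0' := ltW t0; exists (r / 2 * t); have h0 : 0 < r / 2 * t by exact: mulr_gt0.
have hr : `|r / 2 * t| < r by rewrite gtr0_norm//; nra.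
split; first by rewrite gt_eqF.
  by rewrite gtr0_norm//; rewrite ler_pdivlMr// in te; nra.
have le N : `|pseries c (r / 2 * t) N.+1 - c 0%N| <= B * (2 * t).
  rewrite /pseries /series /= big_nat_recl//= expr0 mulr1 addrC addKr big_mkord.
  apply: le_trans (ler_norm_sum _ _ _) _.
  apply: le_trans (ler_wpM2l B0 (geometric_tail_le N (ltW t0) t2)).
  rewrite mulr_sumr; apply: ler_sum => i _.
  rewrite exprMn mulrA normrM [`|t ^+ _|]ger0_norm ?exprn_ge0//.
  by apply: ler_wpM2r => //; exact: exprn_ge0.
have lim : `|f (x + r / 2 * t) - c 0%N| <= B * (2 * t).
  have cvn : (fun N => `|pseries c (r / 2 * t) N.+1 - c 0%N|) @ \oo -->
      `|f (x + r / 2 * t) - c 0%N|.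
    apply: cvg_norm; apply: cvgB; last exact: cvg_cst.
    by have := cv _ hr; rewrite -cvg_shiftS.
  rewrite -(cvg_lim _ cvn)//; apply: limr_le; first by apply: cvgP cvn.
  by apply: nearW.
apply: contraTneq lim => ->; rewrite sub0r normrN -ltNge.
rewrite ler_pdivlMr// in tB; nra.
Qed.

End AnalyticNonzero.

(** * The three cases of K *)

Section Cases.
Context {R : realType}.
Implicit Types (ur : R -> R -> R -> R -> R) (b : R -> nat -> R).

Lemma real_analytic_unknown b eps (l : R) k j :
  0 < eps -> (forall k (x : R), `|x| < eps -> analytic_at (b^~ k) x) ->
  real_analytic (fun a => l * (a ^+ j * b a k)).
Proof.
move=> e0 h; exists eps; split => // a ae.
by apply: analytic_atZ; apply: (analytic_atXn (f := b^~ k)); exact: h.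
Qed.

Lemma wilton_two ur (s : R) : is_ur 2 ur -> s = 1 \/ s = -1 ->
  exists (u : R -> R -> R) (c tc tb : R -> R),
    [/\ real_analytic tc, tc 0 = s, real_analytic tb, tb 0 = s &
        exists eps : R, 0 < eps /\ forall a : R, `|a| < eps ->
        [/\ kawahara 2 (c a) (u a),
            c a = 4 / 5 - a / Num.sqrt 2 * tc a &
            forall x : R,
              u a x = a * (cos x + (Num.sqrt 2)^-1 * tb a * cos (2 * x))
                      + ur a (a / Num.sqrt 2 * tb a)
                             (- (a / Num.sqrt 2) * tc a) x]].
Proof.
move=> hur hs; pose q : R := Num.sqrt 2.
have q0 : q != 0 by rewrite gt_eqF// sqrtr_gt0.
have q2 : q ^+ 2 = 2 by rewrite sqr_sqrtr.
(* The two square roots of 1/2; rescaling by the square root of 2 turns the limits of second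
   amplitude and velocity into the sign s. *)
pose b0 := s / q.
have b2 : b0 ^+ 2 = 2^-1.
  have s2 : s ^+ 2 = 1 by case: hs => ->; rewrite ?sqrrN expr1n.
  by rewrite /b0 expr_div_n s2 q2 mul1r.
have w2n k : (5 <= k)%N -> w2 b0 k = 0 by move=> hk; rewrite /w2 nth_default.
have d2p k : (0 < d2 k)%N by rewrite /d2; case: ifP.
have [b [eps [M [e0 ban bw bg bsol]]]] :=
  wilton_branch (isT : 2 <= 2)%N (isT : 0 < 1)%N (isT : 2 < 5)%N w2n
    (fun p r => d2_order p r _) (fun p r => d2_order p r _) d2p (erefl _)
    (lead_res2 b2) (lead_diag2 b0) (lead_supp2 b0) (lead_inj2 b2) hur.
exists (fun a => cos_series (profile d2 (b a) a)), (fun a => vel0 2 + a ^+ 1 * b a 1%N),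
  (fun a => - q * (a ^+ 0 * b a 1%N)), (fun a => q * (a ^+ 0 * b a 2%N)); split.
- exact: real_analytic_unknown e0 ban.
- by rewrite bw expr0 mul1r /w2 /= mulNr mulrN opprK /b0 mulrC divfK.
- exact: real_analytic_unknown e0 ban.
- by rewrite bw expr0 mul1r /w2 /= /b0 mulrC divfK.
exists eps; split => // a ae; have [kw prof] := bsol a ae; split => //.
  rewrite -/q (_ : vel0 2 = 4 / 5); last by rewrite /vel0 /beta; field.
  by rewrite expr0 expr1; field.
move=> x; rewrite prof -/q expr0 !mul1r (_ : d2 2 = 1%N)// !expr1.
have -> : a / q * (q * b a 2%N) = a * b a 2%N by field.
have -> : - (a / q) * (- q * b a 1%N) = a * b a 1%N by field.
by field.
Qed.

Lemma wilton_three ur (b0 : R) : is_ur 3 ur -> cubic3 b0 = 0 -> dcubic3 b0 != 0 ->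
  exists (u : R -> R -> R) (c tc tb : R -> R),
    [/\ real_analytic tc, tc 0 = tau3 b0, real_analytic tb, tb 0 = b0 &
        exists eps : R, 0 < eps /\ forall a : R, `|a| < eps ->
        [/\ kawahara 3 (c a) (u a), c a = 9 / 10 + a ^+ 2 * tc a &
            forall x : R,
              u a x = a * (cos x + tb a * cos (3 * x))
                      + ur a (a * tb a) (a ^+ 2 * tc a) x]].
Proof.
move=> hur root simple.
have w3n k : (7 <= k)%N -> w3 b0 k = 0 by move=> hk; rewrite /w3 nth_default.
have d3p k : (0 < d3 k)%N by rewrite /d3; case: ifP.
have [b [eps [M [e0 ban bw bg bsol]]]] :=
  wilton_branch (isT : 2 <= 3)%N (isT : 0 < 2)%N (isT : 3 < 7)%N w3n
    d3_orderS d3_orderD d3p (erefl _) (lead_res3 root) (lead_diag3 b0)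
    (lead_supp3 b0) (lead_inj3 simple) hur.
exists (fun a => cos_series (profile d3 (b a) a)), (fun a => vel0 3 + a ^+ 2 * b a 1%N),
  (fun a => 1 * (a ^+ 0 * b a 1%N)), (fun a => 1 * (a ^+ 0 * b a 3%N)); split.
- exact: real_analytic_unknown e0 ban.
- by rewrite bw expr0 !mul1r.
- exact: real_analytic_unknown e0 ban.
- by rewrite bw expr0 !mul1r.
exists eps; split => // a ae; have [kw prof] := bsol a ae; split => //.
  rewrite (_ : vel0 3 = 9 / 10); last by rewrite /vel0 /beta; field.
  by rewrite expr0 !mul1r.
by move=> x; rewrite prof expr0 !mul1r (_ : d3 3 = 1%N)// !expr1; ring.
Qed.

Lemma wilton_large K ur : (4 <= K)%N -> is_ur K ur ->
  exists (u : R -> R -> R) (c tc tb : R -> R),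
    [/\ real_analytic tc,
        tc 0 = ((K%:R ^+ 2 + 1) * (5 * K%:R ^+ 2 - 24))
               / (6 * K%:R ^+ 2 * (K%:R ^+ 2 - 4)),
        real_analytic tb,
        (forall eps : R, 0 < eps -> exists a : R, `|a| < eps /\ tb a <> 0)
        /\ tb =O_ (nbhs (0 : R)) (fun a : R => a ^+ (K - 3)) &
        exists eps : R, 0 < eps /\ forall a : R, `|a| < eps ->
        [/\ kawahara K (c a) (u a),
            c a = K%:R ^+ 2 / (K%:R ^+ 2 + 1) + a ^+ 2 * tc a &
            forall x : R,
              u a x = a * (cos x + tb a * cos (K%:R * x))
                      + ur a (a * tb a) (a ^+ 2 * tc a) x]].
Proof.
move=> hK hur.
have k4 : 4 <= K%:R :> R by rewrite ler_nat.
have d1 : dL K 1 = 1%N by rewrite /dL; do ![case: ifP => ?]; lia.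
have [b [eps [M [e0 ban bw bg bsol]]]] :=
  wilton_branch (ltnW (ltnW hK)) (isT : 0 < 2)%N (leqnSn K.+1) (@wL_ge R K hK)
    (dL_orderS hK) (dL_orderD hK) (dL_gt0 hK) d1
    (lead_resL hK) (@lead_diagL R K hK _) (lead_suppL hK) (lead_injL hK) hur.
have M0 : 0 <= M by apply: geom_ge0 (bg 0 _); rewrite normr0.
have n0 : K%:R ^+ 2 + 1 != 0 :> R by rewrite gt_eqF//; nra.
have n1 : 1 + K%:R ^+ 2 != 0 :> R by rewrite addrC.
exists (fun a => cos_series (profile (dL K) (b a) a)),
  (fun a => vel0 K + a ^+ 2 * b a 1%N),
  (* The second amplitude a^(K-2) b is split as a times a^(K-3) b, which is the order claimed for
     the second function. *)
  (fun a => 1 * (a ^+ 0 * b a 1%N)), (fun a => 1 * (a ^+ (K - 3) * b a K)); split.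
- exact: real_analytic_unknown e0 ban.
- rewrite bw expr0 !mul1r wL_1 /tauL /lam /beta expr0n /=.
  by field; rewrite ?n0 //; do ?split; rewrite gt_eqF//; nra.
- exact: real_analytic_unknown e0 ban.
- split.
    move=> r r0; have bK0 : b 0 K != 0.
      (* The limit is nonzero because the cascade forcing of mode K is a convolution of positive
         amplitudes. *)
      rewrite bw wL_K// /gL mulf_neq0 ?invr_eq0 ?detL_neq0// oppr_eq0 gt_eqF// mulr_gt0//.
      apply: conv_gt0 => //; first by lia.
        by move=> i hi; apply: sK_gt0 => //.
      by move=> i hi; apply: sK_gt0 => //.
    have h00 : `|0 : R| < eps by rewrite normr0.
    have [h [h0 hr]] := analytic_at_nonzero (ban K 0 h00) bK0 r0.
    rewrite add0r => bh; exists h; split => //; apply/eqP.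
    by rewrite mul1r mulf_neq0// expf_neq0.
  apply/eqO_exP; exists (M + 1); first by rewrite ltr_wpDl.
  apply/nbhs_ballP; exists eps => // a; rewrite /ball /= sub0r normrN => ae.
  rewrite mul1r normrM mulrC ler_wpM2r//; apply: le_trans (bg a ae K) _.
  apply: (@le_trans _ _ M); last by rewrite lerDl.
  by rewrite ler_pdivrMr ?exprn_gt0// ler_peMr// exprn_ege1// ler1n.
exists eps; split => // a ae; have [kw prof] := bsol a ae; split => //.
  rewrite expr0 !mul1r; congr (_ + _); rewrite /vel0 /beta.
  by field; rewrite ?n0 ?n1.
move=> x; rewrite prof expr0 !mul1r.
have -> : dL K K = (K - 3).+1.
  by rewrite /dL eqxx ifF; lia.
by rewrite exprS mulrA; ring.
Qed.

End Cases.

Unset Implicit Arguments.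

Theorem theorem1 (R : realType) (K : nat) (hK : (2 <= K)%N) :
  (exists ur : R -> R -> R -> R -> R, is_ur K ur) /\
  forall ur : R -> R -> R -> R -> R, is_ur K ur ->
  [/\ exists eps : R, 0 < eps /\
        forall a b c : R, `|a| < eps -> `|b| < eps -> `|c| < eps ->
          Hinfty_per_even (ur a b c) /\ analytic3_at 4 ur a b c,
      K = 2%N ->
      forall s : R, s = 1 \/ s = -1 ->
      exists (u : R -> R -> R) (c tc tb : R -> R),
        [/\ real_analytic tc, tc 0 = s, real_analytic tb, tb 0 = s &
            exists eps : R, 0 < eps /\ forall a : R, `|a| < eps ->
            [/\ kawahara K (c a) (u a),
                c a = 4 / 5 - a / Num.sqrt 2 * tc a &
                forall x : R,
                  u a x = a * (cos x + (Num.sqrt 2)^-1 * tb a * cos (2 * x))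
                          + ur a (a / Num.sqrt 2 * tb a)
                                 (- (a / Num.sqrt 2) * tc a) x]],
      K = 3%N ->
      exists (u : 'I_3 -> R -> R -> R) (c tc tb : 'I_3 -> R -> R),
        [/\ forall i : 'I_3,
              [/\ real_analytic (tc i), real_analytic (tb i) &
                  exists eps : R, 0 < eps /\ forall a : R, `|a| < eps ->
                  [/\ kawahara K (c i a) (u i a),
                      c i a = 9 / 10 + a ^+ 2 * tc i a &
                      forall x : R,
                        u i a x = a * (cos x + tb i a * cos (3 * x))
                                  + ur a (a * tb i a) (a ^+ 2 * tc i a) x]],
            [/\ approx5 (tc (inord 0) 0) (4 + 278 / 10 ^+ 3 + 63 / 10 ^+ 5),
                approx5 (tc (inord 1) 0) (1 + 482 / 10 ^+ 3 + 89 / 10 ^+ 5) &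
                approx5 (tc (inord 2) 0) (373 / 10 ^+ 3 + 96 / 10 ^+ 5)] &
            [/\ approx5 (tb (inord 0) 0) (- (1 + 783 / 10 ^+ 3 + 74 / 10 ^+ 5)),
                approx5 (tb (inord 1) 0) (- (544 / 10 ^+ 3 + 88 / 10 ^+ 5)) &
                approx5 (tb (inord 2) 0) (594 / 10 ^+ 3 + 68 / 10 ^+ 5)]] &
      (4 <= K)%N ->
      exists (u : R -> R -> R) (c tc tb : R -> R),
        [/\ real_analytic tc,
            tc 0 = ((K%:R ^+ 2 + 1) * (5 * K%:R ^+ 2 - 24))
                   / (6 * K%:R ^+ 2 * (K%:R ^+ 2 - 4)),
            real_analytic tb,
            (forall eps : R, 0 < eps -> exists a : R, `|a| < eps /\ tb a <> 0)
            /\ tb =O_ (nbhs (0 : R)) (fun a : R => a ^+ (K - 3)) &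
            exists eps : R, 0 < eps /\ forall a : R, `|a| < eps ->
            [/\ kawahara K (c a) (u a),
                c a = K%:R ^+ 2 / (K%:R ^+ 2 + 1) + a ^+ 2 * tc a &
                forall x : R,
                  u a x = a * (cos x + tb a * cos (K%:R * x))
                          + ur a (a * tb a) (a ^+ 2 * tc a) x]]].
Proof.
split; first by exists (ur_sol K); exact: exists_is_ur.
move=> ur hur; split.
- exact (is_ur_regular hK hur).
- by move=> K2 s hs; move: hur; rewrite K2 => hur; exact: wilton_two hur hs.
- move=> K3; move: hur; rewrite K3 => hur.
  have [b1 [r1 s1 hb1 ht1]] := @cubic3_root1 R.
  have [b2 [r2 s2 hb2 ht2]] := @cubic3_root2 R.
  have [b3 [r3 s3 hb3 ht3]] := @cubic3_root3 R.
  have [u1 [c1 [tc1 [tb1 [ac1 v1 ab1 w1 sol1]]]]] := wilton_three hur r1 s1.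
  have [u2 [c2 [tc2 [tb2 [ac2 v2 ab2 w2 sol2]]]]] := wilton_three hur r2 s2.
  have [u3 [c3 [tc3 [tb3 [ac3 v3 ab3 w3 sol3]]]]] := wilton_three hur r3 s3.
  exists (fun i : 'I_3 => nth u1 [:: u1; u2; u3] i),
    (fun i : 'I_3 => nth c1 [:: c1; c2; c3] i),
    (fun i : 'I_3 => nth tc1 [:: tc1; tc2; tc3] i),
    (fun i : 'I_3 => nth tb1 [:: tb1; tb2; tb3] i); split.
  + by case=> -[|[|[|//]]] i3; split.
  + by rewrite !inordK //= v1 v2 v3.
  + by rewrite !inordK //= w1 w2 w3.
- by move=> K4; exact: wilton_large K4 hur.
Qed.
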